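(* Consider the system $\dot x=\partial_y H(x,y,t)$, $\dot y=-\partial_x H(x,y,t)+F(x,y,t)$, $t>0$, under the standing assumptions stated in the context, with $H\sim H_0+\sum_{k\ge1}t^{-k/q}H_k$ and $F\sim\sum_{k\ge1}t^{-k/q}F_k$ as $t\to\infty$. Let $n$ be an integer with $1\le n\le q$ and suppose that $$F_i(x,y)\equiv0\ \ (1\le i<n),\qquad F_n(x,y)\equiv\partial_yH_0(x,y)\big(\lambda_n-\mu_nH_0(x,y)\big)+\hat F_n(x,y),$$ where $\lambda_n,\mu_n$ are nonzero constants and $$\int_0^{2\pi}\hat F_n\big(X(\varphi,E),Y(\varphi,E)\big)\,\partial_yH_0\big(X(\varphi,E),Y(\varphi,E)\big)\,d\varphi=0\quad\text{for all }E\in(0,E_0).$$ Then the equilibrium $(0,0)$ of the system is unstable if $\lambda_n>0$ and is asymptotically stable if $\lambda_n<0$. Moreover, if $\lambda_n>0$, $\mu_n>0$ and $|\lambda_n/\mu_n|<E_0$, there exists a stable limit cycle $H_0(x,y)=\lambda_n/\mu_n$.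
   Context: Standing assumptions. $H(x,y,t)$ and $F(x,y,t)$ are real-valued and infinitely differentiable; on every compact $D\subset\mathbb R^2$, $H(x,y,t)\to H_0(x,y)$ and $F(x,y,t)\to0$ as $t\to\infty$. There are smooth functions $H_k,F_k$ and a positive integer $q$ such that $H-H_0=\sum_{k\ge1}t^{-k/q}H_k(x,y)$, $F=\sum_{k\ge1}t^{-k/q}F_k(x,y)$ as asymptotic expansions for $t\to\infty$ (locally uniform in $(x,y)$ and termwise differentiable in $(x,y)$). The limiting system $\dot x=\partial_yH_0$, $\dot y=-\partial_xH_0$ has the isolated fixed point $(0,0)$ of center type, with $H_0(x,y)=\frac{x^2+y^2}{2}+\mathcal O(r^3)$ as $r=\sqrt{x^2+y^2}\to0$. The level lines $\{H_0(x,y)=E\}$, $E\in(0,E_0]$ ($E_0>0$ constant), form a family of closed curves (around $(0,0)$); level sets of $H_0$ always refer to the curves of this family. The equilibrium is preserved: $\partial_xH(0,0,t)\equiv\partial_yH(0,0,t)\equiv F(0,0,t)\equiv0$. Notation. To each $E\in(0,E_0]$ corresponds a periodic solution $x_0(t,E),y_0(t,E)$ of the limiting system on $\{H_0=E\}$ with period $T(E)=2\pi/\omega(E)$, where $\omega(E)\ne0$ for all $E\in[0,E_0]$ and $\omega(E)=1+\mathcal O(E)$ as $E\to0$. Put $X(\varphi,E)=x_0(\varphi/\omega(E),E)$, $Y(\varphi,E)=y_0(\varphi/\omega(E),E)$; these are $2\pi$-periodic in $\varphi$. Stability. The equilibrium is stable if it is Lyapunov stable as $t\to\infty$: for every initial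 time $\tau_0>0$ and every $\epsilon>0$ there is $\delta>0$ such that every solution with $|(x(\tau_0),y(\tau_0))|\le\delta$ satisfies $|(x(t),y(t))|<\epsilon$ for all $t\ge\tau_0$; it is unstable if it is not stable; it is asymptotically stable if it is stable and all solutions starting sufficiently close to $(0,0)$ tend to $(0,0)$ as $t\to\infty$. Stable limit cycle. For $V_c\in(0,E_0)$, the curve $H_0(x,y)=V_c$ is called a stable limit cycle of the (non-autonomous) system if for every $\epsilon>0$ there exist $\delta_*>0$ and $t_*>0$ such that for all $(x_0,y_0)$ (in the region filled by the closed level curves) with $|H_0(x_0,y_0)-V_c|\le\delta_*$ and all $\tau_0\ge t_*$, the solution with $x(\tau_0)=x_0$, $y(\tau_0)=y_0$ satisfies $|H_0(x(t),y(t))-V_c|<\epsilon$ for all $t\ge\tau_0$, and $H_0(x(t),y(t))\to V_c$ as $t\to\infty$. *)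

(* Defs.v *)
(* Stdlib reals with Coquelicot. *)
From Stdlib Require Import Reals.
From Coquelicot Require Import Coquelicot.

Local Open Scope R_scope.

Definition rad (x y : R) : R := sqrt (x ^ 2 + y ^ 2).

Definition d_x (f : R -> R -> R) (x y : R) : R := Derive (fun u => f u y) x.
Definition d_y (f : R -> R -> R) (x y : R) : R := Derive (fun v => f x v) y.

(** * Smoothness *)

Fixpoint Ck2 (k : nat) (f : R -> R -> R) : Prop :=
  (forall x y, continuous (fun p : R * R => f (fst p) (snd p)) (x, y)) /\
  match k with
  | O => True
  | S k' =>
      (forall x y, ex_derive (fun u => f u y) x /\ ex_derive (fun v => f x v) y) /\
      Ck2 k' (d_x f) /\ Ck2 k' (d_y f)
  end.

Definition smooth2 (f : R -> R -> R) : Prop := forall k, Ck2 k f.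

(* [C^k] on the open half-space [t > 0]; values at [t <= 0] are irrelevant. *)
Fixpoint Ck3 (k : nat) (f : R -> R -> R -> R) : Prop :=
  (forall x y t, 0 < t ->
     continuous (fun p : R * R * R => f (fst (fst p)) (snd (fst p)) (snd p))
       (x, y, t)) /\
  match k with
  | O => True
  | S k' =>
      (forall x y t, 0 < t ->
         ex_derive (fun u => f u y t) x /\
         ex_derive (fun v => f x v t) y /\
         ex_derive (fun s => f x y s) t) /\
      Ck3 k' (fun x y t => Derive (fun u => f u y t) x) /\
      Ck3 k' (fun x y t => Derive (fun v => f x v t) y) /\
      Ck3 k' (fun x y t => Derive (fun s => f x y s) t)
  end.

Definition smooth3 (f : R -> R -> R -> R) : Prop := forall k, Ck3 k f.

(** * Asymptotic expansions as t -> +oo *)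

(* Uniform convergence to 0 on compact sets of the plane; every compact set
   lies in a closed disc, so discs suffice. *)
Definition vanishes_loc_unif (G : R -> R -> R -> R) : Prop :=
  forall rho eps : R, 0 < eps ->
  exists t1 : R, forall x y t : R, rad x y <= rho -> t1 <= t ->
    Rabs (G x y t) < eps.

(* [G ~ sum_{k >= 1} t^(-k/q) G_k], termwise differentiable in (x,y): for all
   i, j and N, the remainder after N terms of the expansion of
   [d^(i+j) G / dx^i dy^j] is o(t^(-N/q)), locally uniformly in (x,y).
   The entry [Gk 0] is not used. *)
Definition asymptotic_expansion (q : nat) (G : R -> R -> R -> R)
    (Gk : nat -> R -> R -> R) : Prop :=
  forall N i j : nat,
  vanishes_loc_unif (fun x y t =>
    Rpower t (INR N / INR q) *
    (partial_derive i j (fun u v => G u v t) x y -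
     sum_n_m (fun k => Rpower t (- (INR k / INR q)) *
                       partial_derive i j (Gk k) x y) 1 N)).

(** * Plane curves *)

Definition path_joined (S : R -> R -> Prop) (a b a' b' : R) : Prop :=
  exists c1 c2 : R -> R,
    (forall s, continuous c1 s) /\ (forall s, continuous c2 s) /\
    c1 0 = a /\ c2 0 = b /\ c1 1 = a' /\ c2 1 = b' /\
    (forall s, 0 <= s <= 1 -> S (c1 s) (c2 s)).

Definition closed_curve (S : R -> R -> Prop) : Prop :=
  exists c1 c2 : R -> R,
    (forall s, continuous c1 s) /\ (forall s, continuous c2 s) /\
    c1 0 = c1 1 /\ c2 0 = c2 1 /\
    (forall s s', 0 <= s < 1 -> 0 <= s' < 1 ->
       c1 s = c1 s' -> c2 s = c2 s' -> s = s') /\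
    (forall u v, S u v <-> exists s, 0 <= s <= 1 /\ c1 s = u /\ c2 s = v).

(* The origin lies in a bounded component of the complement of [S]. *)
Definition encloses_origin (S : R -> R -> Prop) : Prop :=
  ~ S 0 0 /\
  exists rho : R, forall u v : R,
    path_joined (fun a b => ~ S a b) 0 0 u v -> rad u v <= rho.

(** * The limiting Hamiltonian system *)

Definition limit_solution (H0 : R -> R -> R) (x y : R -> R) : Prop :=
  forall t : R,
    is_derive x t (d_y H0 (x t) (y t)) /\
    is_derive y t (- d_x H0 (x t) (y t)).

Definition periodic (x y : R -> R) (T : R) : Prop :=
  forall t : R, x (t + T) = x t /\ y (t + T) = y t.

Definition least_period (x y : R -> R) (T : R) : Prop :=
  0 < T /\ periodic x y T /\ forall s, 0 < s -> periodic x y s -> T <= s.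

Definition orbit (x y : R -> R) (u v : R) : Prop :=
  exists t : R, x t = u /\ y t = v.

Definition isolated_fixed_point (H0 : R -> R -> R) : Prop :=
  d_x H0 0 0 = 0 /\ d_y H0 0 0 = 0 /\
  exists r : R, 0 < r /\ forall x y : R, rad x y < r ->
    d_x H0 x y = 0 -> d_y H0 x y = 0 -> x = 0 /\ y = 0.

(* A punctured neighbourhood is filled with closed orbits around the origin. *)
Definition center (H0 : R -> R -> R) : Prop :=
  exists r : R, 0 < r /\ forall a b : R, 0 < rad a b < r ->
  exists (x y : R -> R) (T : R),
    limit_solution H0 x y /\ x 0 = a /\ y 0 = b /\
    least_period x y T /\ encloses_origin (orbit x y).

(* The set {H0 = E} may have other components in the plane; the curve of the
   family around the origin is the part lying in the path component of the
   origin in {H0 <= E0}. *)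
Definition level_curve (H0 : R -> R -> R) (E0 E : R) (u v : R) : Prop :=
  H0 u v = E /\ path_joined (fun a b => H0 a b <= E0) 0 0 u v.

Definition filled_region (H0 : R -> R -> R) (E0 : R) (u v : R) : Prop :=
  exists E : R, 0 < E <= E0 /\ level_curve H0 E0 E u v.

(* [phi |-> X(phi,E)] and [phi |-> Y(phi,E)], with [z0] being [x0] or [y0]. *)
Definition angle_param (z0 : R -> R -> R) (omega : R -> R) (phi E : R) : R :=
  z0 (phi / omega E) E.

(** * Standing assumptions *)

Record standing_assumptions (H F : R -> R -> R -> R) (H0 : R -> R -> R)
    (Hk Fk : nat -> R -> R -> R) (q : nat) (E0 : R)
    (x0 y0 : R -> R -> R) (omega : R -> R) : Prop := {
  H_smooth : smooth3 H;
  F_smooth : smooth3 F;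
  H0_smooth : smooth2 H0;
  Hk_smooth : forall k, (1 <= k)%nat -> smooth2 (Hk k);
  Fk_smooth : forall k, (1 <= k)%nat -> smooth2 (Fk k);
  H_limit : vanishes_loc_unif (fun x y t => H x y t - H0 x y);
  F_limit : vanishes_loc_unif F;
  q_pos : (0 < q)%nat;
  H_expansion : asymptotic_expansion q (fun x y t => H x y t - H0 x y) Hk;
  F_expansion : asymptotic_expansion q F Fk;
  origin_isolated : isolated_fixed_point H0;
  origin_center : center H0;
  H0_quadratic : exists C r : R, 0 < r /\ forall x y : R, rad x y < r ->
    Rabs (H0 x y - (x ^ 2 + y ^ 2) / 2) <= C * rad x y ^ 3;
  E0_pos : 0 < E0;
  level_closed : forall E, 0 < E <= E0 ->
    closed_curve (level_curve H0 E0 E) /\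
    encloses_origin (level_curve H0 E0 E);
  orbit_solution : forall E, 0 < E <= E0 ->
    limit_solution H0 (fun t => x0 t E) (fun t => y0 t E);
  orbit_level : forall E, 0 < E <= E0 -> forall u v,
    orbit (fun t => x0 t E) (fun t => y0 t E) u v <-> level_curve H0 E0 E u v;
  orbit_period : forall E, 0 < E <= E0 ->
    least_period (fun t => x0 t E) (fun t => y0 t E) (2 * PI / omega E);
  omega_neq0 : forall E, 0 <= E <= E0 -> omega E <> 0;
  omega_zero : exists C e : R, 0 < e /\ forall E, 0 < E < e ->
    Rabs (omega E - 1) <= C * E;
  equilibrium : forall t, 0 < t ->
    d_x (fun u v => H u v t) 0 0 = 0 /\
    d_y (fun u v => H u v t) 0 0 = 0 /\
    F 0 0 t = 0
}.

(** * Solutions of the perturbed system and stability *)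

(* Solution on [[tau0, T)], [T] finite or [+oo].  The derivative at [tau0] is
   two-sided, which only concerns the irrelevant values before [tau0]. *)
Definition solution_on (H F : R -> R -> R -> R) (tau0 : R) (T : Rbar)
    (x y : R -> R) : Prop :=
  Rbar_lt tau0 T /\
  forall t : R, tau0 <= t -> Rbar_lt t T ->
    is_derive x t (d_y (fun u v => H u v t) (x t) (y t)) /\
    is_derive y t (- d_x (fun u v => H u v t) (x t) (y t) + F (x t) (y t) t).

(* Every solution starting at [(a,b)] at time [tau0] continues to
   [[tau0, +oo)] and there satisfies [P].  Quantifying over solutions on all
   intervals [[tau0, T)] makes blow-up in finite time a failure. *)
Definition every_solution (H F : R -> R -> R -> R) (tau0 a b : R)
    (P : (R -> R) -> (R -> R) -> Prop) : Prop :=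
  forall (T : Rbar) (x y : R -> R),
    solution_on H F tau0 T x y -> x tau0 = a -> y tau0 = b ->
  exists x' y' : R -> R,
    solution_on H F tau0 p_infty x' y' /\
    (forall t : R, tau0 <= t -> Rbar_lt t T -> x' t = x t /\ y' t = y t) /\
    P x' y'.

Definition stable (H F : R -> R -> R -> R) : Prop :=
  forall tau0 eps : R, 0 < tau0 -> 0 < eps ->
  exists delta : R, 0 < delta /\ forall a b : R, rad a b <= delta ->
    every_solution H F tau0 a b (fun x y =>
      forall t : R, tau0 <= t -> rad (x t) (y t) < eps).

Definition unstable (H F : R -> R -> R -> R) : Prop := ~ stable H F.

Definition asymptotically_stable (H F : R -> R -> R -> R) : Prop :=
  stable H F /\
  forall tau0 : R, 0 < tau0 ->
  exists delta : R, 0 < delta /\ forall a b : R, rad a b <= delta ->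
    every_solution H F tau0 a b (fun x y =>
      is_lim x p_infty 0 /\ is_lim y p_infty 0).

Definition stable_limit_cycle (H F : R -> R -> R -> R) (H0 : R -> R -> R)
    (E0 Vc : R) : Prop :=
  forall eps : R, 0 < eps ->
  exists delta tstar : R, 0 < delta /\ 0 < tstar /\
  forall a b tau0 : R,
    filled_region H0 E0 a b -> Rabs (H0 a b - Vc) <= delta -> tstar <= tau0 ->
    every_solution H F tau0 a b (fun x y =>
      (forall t : R, tau0 <= t -> Rabs (H0 (x t) (y t) - Vc) < eps) /\
      is_lim (fun t => H0 (x t) (y t)) p_infty Vc).

(* Main.v *)
(* The energy [H0] is corrected to [L = H0 + sum_(1 <= k <= n) t^(-k/q) (Hk - Hk(0,0))].  Along the
   perturbed system the Poisson bracket of [L] with [H] is [o(t^(-n/q))], so that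
   [dL/dt = t^(-n/q) (d_y H0 * Fk n + o(1))] with an error of order [x^2 + y^2].

   Near the origin [Fk n] is linear up to higher order; the zero-average condition on [Fhat], tested
   on one small orbit, forces [d_y (Fk n) (0,0) = lambda].  Subtracting a quadratic form times
   [t^(-n/q)] from [L] gives a Lyapunov function with derivative close to
   [t^(-n/q) lambda (x^2 + y^2) / 2]; since [n <= q], the factor [t^(-n/q) >= 1/t] is not integrable.

   Near the cycle, a solution follows a limiting orbit of energy [E] for one period by Gronwall's
   lemma, so [L] changes by [t^(-n/q) (lambda - mu E) * int (d_y H0)^2] up to [o(t^(-n/q))].  As no
   continuity of [omega] is available, these steps are made uniform by compactness of the annulus in
   the plane.  Summing them yields trapping near the cycle and, by divergence of [int dt / t],
   convergence to it.  Global solutions come from Picard iteration for the field clamped to a box. *)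
Require Import Defs.
From Stdlib Require Import Reals Lra Lia Psatz Classical ClassicalEpsilon FunctionalExtensionality.
From Coquelicot Require Import Coquelicot.

Local Open Scope R_scope.

(** * One-variable calculus *)

(** Two features of the hypotheses shape the argument. The expansions give errors o(t^(-N/q)) that
    need not be small at the origin, while stability requires errors relative to x^2 + y^2. As the
    equilibrium is preserved at all times, the gradients of all [Hk] and the values of all [Fk]
    vanish at the origin too; the mean value theorem, applied to remainders whose derivatives are
    expanded as well, supplies the missing powers of the norm. Secondly, the orbits [x0 t E],
    [y0 t E] are not assumed to depend continuously on [E], so action-angle variables are not at
    hand. Averaging is done on one limiting orbit at a time: a primitive of the leading rate along
    that orbit is the comparison function for every solution starting nearby. During one period the
    weight t^(-n/q) may be frozen, its relative variation being O(1/t). Progress is measured in ln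
    t, since 1/t <= t^(-n/q). *)

Lemma is_derive_cont (f : R -> R) (x l : R) : is_derive f x l -> continuous f x.
Proof.
  intros Hf; apply (ex_derive_continuous (K := R_AbsRing) (V := R_NormedModule)); now exists l.
Qed.

Lemma is_derive_eq (f : R -> R) (x l l' : R) : is_derive f x l -> l = l' -> is_derive f x l'.
Proof. now intros Hf <-. Qed.

Lemma is_derive_Ropp (f : R -> R) (x l : R) :
  is_derive f x l -> is_derive (fun t => - f t) x (- l).
Proof. exact (is_derive_opp f x l). Qed.

Lemma is_derive_Rplus (f g : R -> R) (x l m : R) :
  is_derive f x l -> is_derive g x m -> is_derive (fun t => f t + g t) x (l + m).
Proof. exact (is_derive_plus f g x l m). Qed.

Lemma is_derive_Rminus (f g : R -> R) (x l m : R) :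
  is_derive f x l -> is_derive g x m -> is_derive (fun t => f t - g t) x (l - m).
Proof. exact (is_derive_minus f g x l m). Qed.

Lemma is_derive_Rscal (f : R -> R) (x c l : R) :
  is_derive f x l -> is_derive (fun t => c * f t) x (c * l).
Proof. exact (is_derive_scal f x c l). Qed.

Lemma is_derive_Rmult (f g : R -> R) (x l m : R) :
  is_derive f x l -> is_derive g x m -> is_derive (fun t => f t * g t) x (l * g x + f x * m).
Proof.
  intros Hf Hg; apply (is_derive_mult f g x l m Hf Hg); intros; apply Rmult_comm.
Qed.

Lemma continuous_Rplus {T : UniformSpace} (f g : T -> R) (x : T) :
  continuous f x -> continuous g x -> continuous (fun s => f s + g s) x.
Proof. exact (continuous_plus f g x). Qed.

Lemma continuous_Rminus {T : UniformSpace} (f g : T -> R) (x : T) :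
  continuous f x -> continuous g x -> continuous (fun s => f s - g s) x.
Proof. exact (continuous_minus f g x). Qed.

Lemma continuous_Ropp {T : UniformSpace} (f : T -> R) (x : T) :
  continuous f x -> continuous (fun s => - f s) x.
Proof. exact (continuous_opp f x). Qed.

Lemma continuous_Rscal {T : UniformSpace} (k : R) (f : T -> R) (x : T) :
  continuous f x -> continuous (fun s => k * f s) x.
Proof. exact (continuous_scal_r k f x). Qed.

Lemma continuous_Rmult {T : UniformSpace} (f g : T -> R) (x : T) :
  continuous f x -> continuous g x -> continuous (fun s => f s * g s) x.
Proof. exact (continuous_mult f g x). Qed.

Lemma exp_ge_1 (a : R) : 0 <= a -> 1 <= exp a.
Proof. intros [Ha | <-]; [rewrite <- exp_0; left; now apply exp_increasing | rewrite exp_0; lra]. Qed.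

Lemma exp_monotone (a b : R) : a <= b -> exp a <= exp b.
Proof. intros [Hab | ->]; [left; now apply exp_increasing | apply Rle_refl]. Qed.

Lemma Rabs_sign (s : R) : s * s = 1 -> Rabs s = 1.
Proof. intros Hs; assert (H1 := Rsqr_abs s); unfold Rsqr in H1; assert (H2 := Rabs_pos s); nra. Qed.

Ltac triangle := eapply Rle_trans; [apply Rabs_triang |].

(** Recurses into the right argument only, so minima and maxima below are nested to the right. *)
Ltac bounds_of m e :=
  lazymatch e with
  | Rmin ?a ?b =>
      let Ha := fresh "Hmin" in pose proof (Rmin_l a b : m <= a) as Ha;
      let Hb := fresh "Hmin" in pose proof (Rmin_r a b : m <= b) as Hb; bounds_of b b
  | Rmax ?a ?b =>
      let Ha := fresh "Hmax" in pose proof (Rmax_l a b : a <= m) as Ha;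
      let Hb := fresh "Hmax" in pose proof (Rmax_r a b : b <= m) as Hb; bounds_of b b
  | _ => idtac
  end.

Ltac minmax_bounds m := let e := eval cbv delta [m] in m in bounds_of m e.

Lemma mvt_le (f df : R -> R) (a b M : R) :
  a <= b ->
  (forall t, a <= t <= b -> is_derive f t (df t)) ->
  (forall t, a <= t <= b -> df t <= M) ->
  f b - f a <= M * (b - a).
Proof.
  intros Hab Hd Hle.
  destruct (MVT_gen f a b df) as [c [Hc ->]].
  - rewrite Rmin_left, Rmax_right by lra; intros; apply Hd; lra.
  - rewrite Rmin_left, Rmax_right by lra; intros.
    apply continuity_pt_filterlim, (is_derive_cont _ _ (df x)), Hd; lra.
  - rewrite Rmin_left, Rmax_right in Hc by lra.
    apply Rmult_le_compat_r; [lra | now apply Hle].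
Qed.

Lemma nonneg_derive_le (f df : R -> R) (a b : R) :
  a <= b ->
  (forall t, a <= t <= b -> is_derive f t (df t)) ->
  (forall t, a <= t <= b -> 0 <= df t) ->
  f a <= f b.
Proof.
  intros Hab Hd Hle.
  assert (H := mvt_le (fun t => - f t) (fun t => - df t) a b 0 Hab).
  enough (- f b - - f a <= 0 * (b - a)) by lra; apply H; intros t Ht.
  - now apply is_derive_Ropp, Hd.
  - specialize (Hle t Ht); lra.
Qed.

(** Both [E - D] and [E + D] are nondecreasing. No integral occurs, so the derivatives need not be
    integrable. *)
Lemma dominated_increment (D dD E dE : R -> R) (a b : R) :
  a <= b ->
  (forall t, a <= t <= b -> is_derive D t (dD t)) ->
  (forall t, a <= t <= b -> is_derive E t (dE t)) ->
  (forall t, a <= t <= b -> Rabs (dD t) <= dE t) ->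
  Rabs (D b - D a) <= E b - E a.
Proof.
  intros Hab HD HE Hle.
  assert (H1 : E a - D a <= E b - D b).
  { apply (nonneg_derive_le (fun t => E t - D t) (fun t => dE t - dD t)); auto; intros t Ht.
    - now apply is_derive_Rminus; [apply HE | apply HD].
    - specialize (Hle t Ht); apply Rabs_le_between in Hle; lra. }
  assert (H2 : E a + D a <= E b + D b).
  { apply (nonneg_derive_le (fun t => E t + D t) (fun t => dE t + dD t)); auto; intros t Ht.
    - now apply is_derive_Rplus; [apply HE | apply HD].
    - specialize (Hle t Ht); apply Rabs_le_between in Hle; lra. }
  apply Rabs_le; lra.
Qed.

Lemma mvt_abs (f df : R -> R) (a b M : R) :
  a <= b ->
  (forall t, a <= t <= b -> is_derive f t (df t)) ->
  (forall t, a <= t <= b -> Rabs (df t) <= M) ->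
  Rabs (f b - f a) <= M * (b - a).
Proof.
  intros Hab Hd Hle; rewrite Rmult_minus_distr_l.
  apply (dominated_increment f df (fun t => M * t) (fun _ => M)); auto.
  intros t _; eapply is_derive_eq; [| apply Rmult_1_r].
  apply is_derive_Rscal, (is_derive_id (K := R_AbsRing)).
Qed.

Lemma mvt_abs_sym (f df : R -> R) (a b M : R) :
  (forall t, Rmin a b <= t <= Rmax a b -> is_derive f t (df t)) ->
  (forall t, Rmin a b <= t <= Rmax a b -> Rabs (df t) <= M) ->
  Rabs (f b - f a) <= M * Rabs (b - a).
Proof.
  intros Hd Hle; destruct (Rle_dec a b) as [Hab | Hab].
  - rewrite Rmin_left, Rmax_right in Hd, Hle by lra.
    rewrite (Rabs_pos_eq (b - a)) by lra; now apply (mvt_abs f df).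
  - rewrite Rmin_right, Rmax_left in Hd, Hle by lra.
    rewrite Rabs_minus_sym, (Rabs_minus_sym b a), (Rabs_pos_eq (a - b)) by lra.
    apply (mvt_abs f df); auto; lra.
Qed.

(** The integrating factor [exp (- A (t - t0))] is at most 1, so its product with [D] has derivative
    at most [B]. *)
Lemma gronwall (D dD : R -> R) (t0 t1 A B : R) :
  0 <= A -> 0 <= B -> t0 <= t1 ->
  (forall t, t0 <= t <= t1 -> is_derive D t (dD t)) ->
  (forall t, t0 <= t <= t1 -> dD t <= A * D t + B) ->
  D t1 <= (D t0 + B * (t1 - t0)) * exp (A * (t1 - t0)).
Proof.
  intros HA HB Ht Hd Hle.
  assert (HE : forall t, t0 <= t <= t1 ->
    is_derive (fun s => exp (- A * (s - t0)) * D s) t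
      (exp (- A * (t - t0)) * (dD t - A * D t))).
  { intros t Htt; specialize (Hd t Htt).
    eapply is_derive_eq.
    - apply is_derive_Rmult; [| exact Hd].
      assert (He : is_derive (fun s => exp (- A * (s - t0))) t (- A * exp (- A * (t - t0)))).
      { auto_derive; [exact I |]; rewrite Rmult_1_r; reflexivity. }
      exact He.
    - simpl; ring. }
  assert (H := mvt_le _ _ t0 t1 B Ht HE); simpl in H.
  rewrite Rminus_diag, Rmult_0_r, exp_0 in H.
  replace (- A * (t1 - t0)) with (- (A * (t1 - t0))) in H by ring.
  rewrite exp_Ropp in H.
  set (e := exp (A * (t1 - t0))) in *.
  assert (He : 0 < e) by apply exp_pos.
  assert (HI : / e * D t1 - 1 * D t0 <= B * (t1 - t0)).
  { apply H; intros t Htt; specialize (Hle t Htt).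
    assert (He1 : exp (- A * (t - t0)) <= 1).
    { rewrite <- exp_0; apply exp_monotone.
      assert (0 <= A * (t - t0)) by (apply Rmult_le_pos; lra). lra. }
    assert (Hpos := exp_pos (- A * (t - t0))).
    apply Rle_trans with (exp (- A * (t - t0)) * B);
      [apply Rmult_le_compat_l; lra |].
    rewrite <- (Rmult_1_l B) at 2; apply Rmult_le_compat_r; lra. }
  replace (D t1) with (/ e * D t1 * e) by (field; lra).
  apply Rmult_le_compat_r; lra.
Qed.

(** The time is the supremum of those up to which [u] stays below [c]; continuity from the left
    gives [u t <= c], from the right [c <= u t]. *)
Lemma first_hit (u : R -> R) (a b c : R) :
  a <= b -> (forall t, a <= t <= b -> continuous u t) -> u a <= c -> c <= u b ->
  exists t, a <= t <= b /\ u t = c /\ forall s, a <= s <= t -> u s <= c.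
Proof.
  intros Hab Hc Ha Hb.
  destruct (completeness (fun t => a <= t <= b /\ forall s, a <= s <= t -> u s <= c))
    as [t [Hub Hlub]].
  - exists b; intros t [Ht _]; lra.
  - exists a; split; [lra | intros s Hs; now replace s with a by lra].
  - assert (Hat : a <= t).
    { apply Hub; split; [lra | intros s Hs; now replace s with a by lra]. }
    assert (Htb : t <= b) by (apply Hlub; intros s [Hs _]; lra).
    assert (Hbelow : forall s, a <= s < t -> u s <= c).
    { intros s Hs; apply Rnot_lt_le; intros Hlt.
      apply (Rlt_not_le t s); [lra |]; apply Hlub; intros r [Hr Hr'].
      apply Rnot_lt_le; intros Hsr; specialize (Hr' s); lra. }
    assert (Hct := Hc t (conj Hat Htb)).
    assert (Hloc : forall e, 0 < e -> exists d, 0 < d /\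
       forall s, Rabs (s - t) < d -> Rabs (u s - u t) < e).
    { intros e He.
      destruct (proj1 (continuity_pt_locally u t) (proj2 (continuity_pt_filterlim u t) Hct)
        (mkposreal e He)) as [d Hd].
      exists d; split; [apply cond_pos |]; intros s Hs; now apply Hd. }
    assert (Hle : u t <= c).
    { apply Rnot_lt_le; intros Hlt.
      destruct (Hloc (u t - c)) as [d [Hd Hd']]; [lra |].
      destruct (Req_dec t a) as [-> | Hne]; [lra |].
      set (s := Rmax a (t - d / 2)).
      assert (Hs : a <= s < t) by (unfold s, Rmax; destruct (Rle_dec _ _); lra).
      assert (Hs2 : t - d / 2 <= s) by apply Rmax_r.
      specialize (Hbelow s Hs); specialize (Hd' s).
      assert (Rabs (u s - u t) < u t - c) by (apply Hd', Rabs_lt_between'; lra).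
      apply Rabs_lt_between' in H; lra. }
    exists t; split; [lra |]; split.
    + apply Rle_antisym; auto; apply Rnot_lt_le; intros Hlt.
      destruct (Hloc (c - u t)) as [d [Hd Hd']]; [lra |].
      destruct (Req_dec t b) as [-> | Hne]; [lra |].
      set (r := Rmin b (t + d / 2)).
      assert (Hr : t < r <= b) by (unfold r, Rmin; destruct (Rle_dec _ _); lra).
      assert (Hr2 : r <= t + d / 2) by apply Rmin_r.
      apply (Rlt_not_le r t); [lra |]; apply Hub; split; [lra |].
      intros s Hs; destruct (Rlt_dec s t) as [Hst | Hst]; [apply Hbelow; lra |].
      assert (Rabs (u s - u t) < c - u t) by (apply Hd', Rabs_lt_between'; lra).
      apply Rabs_lt_between' in H; lra.
    + intros s Hs; destruct (Req_dec s t) as [-> | Hne]; auto; apply Hbelow; lra.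
Qed.

Lemma last_hit (u : R -> R) (a b c : R) :
  a <= b -> (forall t, a <= t <= b -> continuous u t) -> u a <= c -> c <= u b ->
  exists t, a <= t <= b /\ u t = c /\ forall s, t <= s <= b -> c <= u s.
Proof.
  intros Hab Hc Ha Hb.
  destruct (first_hit (fun s => - u (- s)) (- b) (- a) (- c)) as [t [Ht [Htc Hs]]].
  - lra.
  - intros t Ht; apply continuous_Ropp.
    apply (continuous_comp Ropp u); [| apply Hc; lra].
    apply continuous_Ropp; apply continuous_id.
  - rewrite Ropp_involutive; lra.
  - rewrite Ropp_involutive; lra.
  - exists (- t); split; [lra |]; split; [lra |].
    intros s Hst; specialize (Hs (- s)); rewrite Ropp_involutive in Hs; lra.
Qed.

(** * Functions of two and three variables *)

(** The l1 norm suits bounds obtained coordinate by coordinate, and boxes are the compact sets of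
    the covering lemmas; [rad] is converted at the cost of a factor 2. *)
Definition nm (x y : R) : R := Rabs x + Rabs y.
Definition inbox (R0 x y : R) : Prop := Rabs x <= R0 /\ Rabs y <= R0.

Lemma nm_pos (x y : R) : 0 <= nm x y.
Proof. unfold nm; assert (H := Rabs_pos x); assert (H' := Rabs_pos y); lra. Qed.

Lemma nm_le (x y : R) : Rabs x <= nm x y /\ Rabs y <= nm x y.
Proof. unfold nm; assert (H := Rabs_pos x); assert (H' := Rabs_pos y); lra. Qed.

Lemma inbox_nm (R0 x y : R) : inbox R0 x y -> nm x y <= 2 * R0.
Proof. unfold inbox, nm; lra. Qed.

Lemma nm_inbox (R0 x y : R) : nm x y <= R0 -> inbox R0 x y.
Proof. assert (H := nm_le x y); unfold inbox; lra. Qed.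

Lemma nm_sqr (x y : R) : nm x y * nm x y <= 2 * (x * x + y * y).
Proof.
  unfold nm.
  assert (Hx := Rsqr_abs x : x * x = Rabs x * Rabs x).
  assert (Hy := Rsqr_abs y : y * y = Rabs y * Rabs y).
  rewrite Hx, Hy; assert (H := Rle_0_sqr (Rabs x - Rabs y)); unfold Rsqr in H; lra.
Qed.

Lemma sqr_nm (x y : R) : x * x + y * y <= nm x y * nm x y.
Proof.
  unfold nm.
  assert (Hx := Rsqr_abs x : x * x = Rabs x * Rabs x).
  assert (Hy := Rsqr_abs y : y * y = Rabs y * Rabs y).
  rewrite Hx, Hy; assert (H := Rabs_pos x); assert (H' := Rabs_pos y); nra.
Qed.

Lemma rad_sqr (x y : R) : 0 <= rad x y /\ rad x y * rad x y = x * x + y * y.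
Proof.
  unfold rad; split; [apply sqrt_pos |]; rewrite sqrt_sqrt; nra.
Qed.

Lemma rad_le_nm (x y : R) : rad x y <= nm x y.
Proof.
  assert (H := rad_sqr x y); assert (H' := sqr_nm x y); assert (H'' := nm_pos x y); nra.
Qed.

Lemma nm_le_rad (x y : R) : nm x y <= 2 * rad x y.
Proof.
  assert (H := rad_sqr x y); assert (H' := nm_sqr x y); assert (H'' := nm_pos x y); nra.
Qed.

Lemma rad_inbox (R0 x y : R) : rad x y <= R0 -> inbox R0 x y.
Proof.
  intros HR; assert (H := rad_sqr x y); split; apply Rabs_le; nra.
Qed.

Lemma inbox_rad (R0 x y : R) : inbox R0 x y -> rad x y <= 2 * R0.
Proof.
  intros H; apply inbox_nm in H; assert (H' := rad_le_nm x y); lra.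
Qed.

Lemma Rabs_mult_le (a b A B : R) : Rabs a <= A -> Rabs b <= B -> Rabs (a * b) <= A * B.
Proof.
  intros; rewrite Rabs_mult; apply Rmult_le_compat; auto using Rabs_pos.
Qed.

Lemma continuous_pair {T U V : UniformSpace} (f : T -> U) (g : T -> V) (x : T) :
  continuous f x -> continuous g x -> continuous (fun s => (f s, g s)) x.
Proof.
  intros Hf Hg; apply (continuous_comp_2 f g pair); auto.
  apply continuous_ext with (fun p => p); [now intros [u v] | apply continuous_id].
Qed.

Lemma continuous_nm {T : UniformSpace} (x y : T -> R) (s : T) :
  continuous x s -> continuous y s -> continuous (fun r => nm (x r) (y r)) s.
Proof. intros Hx Hy; apply continuous_Rplus; apply (continuous_comp _ Rabs); auto; apply continuous_Rabs. Qed.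

Local Notation continuous2 f x y := (continuous (fun p : R * R => f (fst p) (snd p)) (x, y)).
Local Notation continuous3 f x y t :=
  (continuous (fun p : R * R * R => f (fst (fst p)) (snd (fst p)) (snd p)) (x, y, t)).

Lemma continuous_uncurry {T : UniformSpace} (f : R -> R -> R) (a b : T -> R) (s : T) :
  continuous2 f (a s) (b s) ->
  continuous a s -> continuous b s -> continuous (fun r => f (a r) (b r)) s.
Proof. intros Hf Ha Hb; now apply (continuous_comp_2 a b f). Qed.

Lemma continuous_uncurry3 {T : UniformSpace} (f : R -> R -> R -> R) (a b c : T -> R) (s : T) :
  continuous3 f (a s) (b s) (c s) ->
  continuous a s -> continuous b s -> continuous c s ->
  continuous (fun r => f (a r) (b r) (c r)) s.
Proof.
  intros Hf Ha Hb Hc.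
  apply (continuous_comp_2 (fun r => (a r, b r)) c
    (fun (p : R * R) t => f (fst p) (snd p) t)); auto.
  now apply continuous_pair.
Qed.

Lemma continuous_eps3 (f : R * R * R -> R) (x y t eps : R) :
  0 < eps -> continuous f (x, y, t) ->
  exists d : posreal, forall u v s,
    Rabs (u - x) < d -> Rabs (v - y) < d -> Rabs (s - t) < d ->
    Rabs (f (u, v, s) - f (x, y, t)) < eps.
Proof.
  intros He Hf.
  destruct (Hf _ (locally_ball (f (x, y, t)) (mkposreal eps He))) as [d Hd].
  exists d; intros u v s Hu Hv Hs; apply (Hd (u, v, s)).
  repeat split; assumption.
Qed.

Lemma continuous_eps2 (f : R -> R -> R) (x y eps : R) :
  0 < eps -> continuous2 f x y ->
  exists d : posreal, forall u v,
    Rabs (u - x) < d -> Rabs (v - y) < d -> Rabs (f u v - f x y) < eps.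
Proof.
  intros He Hf.
  destruct (Hf _ (locally_ball (f x y) (mkposreal eps He))) as [d Hd].
  exists d; intros u v Hu Hv; apply (Hd (u, v)); split; assumption.
Qed.

(** The gauge at a point is kept below the inverse of 1 + |f| there. A positive lower bound [d] for
    the gauges of a cover then bounds |f| by [/ d], and no maximum over a finite family has to be
    formed. *)
Lemma continuous_bounded3 (f : R -> R -> R -> R) (R0 t0 t1 : R) :
  (forall x y t, t0 <= t <= t1 -> continuous3 f x y t) ->
  exists M, 0 < M /\ forall x y t, inbox R0 x y -> t0 <= t <= t1 -> Rabs (f x y t) <= M.
Proof.
  intros Hc.
  assert (Hdel : forall x y t, exists d : posreal, t0 <= t <= t1 ->
     d <= / (1 + Rabs (f x y t)) /\ forall u v s,
      Rabs (u - x) < d -> Rabs (v - y) < d -> Rabs (s - t) < d ->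
      Rabs (f u v s - f x y t) < 1).
  (* The gauge must exist at every point of the space; outside the time interval its value is
     arbitrary. *)
  { intros x y t; destruct (classic (t0 <= t <= t1)) as [Ht | Ht];
      [| exists posreal_one; tauto].
    destruct (continuous_eps3 _ x y t 1 Rlt_0_1 (Hc x y t Ht)) as [d Hd].
    assert (Hi : 0 < / (1 + Rabs (f x y t)))
      by (apply Rinv_0_lt_compat; assert (H := Rabs_pos (f x y t)); lra).
    assert (Hm : 0 < Rmin d (/ (1 + Rabs (f x y t)))) by (apply Rmin_pos; auto; apply cond_pos).
    exists (mkposreal _ Hm); intros _; simpl; split; [apply Rmin_r |].
    assert (Hl := Rmin_l d (/ (1 + Rabs (f x y t)))).
    intros u v s Hu Hv Hs; apply (Hd u v s); lra. }
  set (delta := fun p : Compactness.Tn 3 R =>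
     let '(x, (y, (t, _))) := p in
     proj1_sig (constructive_indefinite_description _ (Hdel x y t))).
  destruct (compactness_value 3 (- R0, (- R0, (t0, tt))) (R0, (R0, (t1, tt))) delta)
    as [d Hd].
  exists (/ d); split; [apply Rinv_0_lt_compat, cond_pos |].
  intros x y t [Hx Hy] Ht; apply Rabs_le_between in Hx; apply Rabs_le_between in Hy.
  apply NNPP; intros Hn; apply (Hd (x, (y, (t, tt)))).
  { simpl; repeat split; lra. }
  intros [[u [v [s []]]] [Hb [Hcl Hdd]]]; apply Hn; clear Hn.
  simpl in Hb, Hcl; unfold delta in Hcl, Hdd.
  destruct (constructive_indefinite_description _ (Hdel u v s)) as [e He]; simpl in *.
  destruct He as [He1 He2]; [tauto |].
  assert (H1 : Rabs (f x y t - f u v s) < 1) by (apply He2; tauto).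
  assert (Hdp := cond_pos d).
  apply Rle_trans with (1 + Rabs (f u v s)).
  - assert (Ht' := Rabs_triang (f x y t - f u v s) (f u v s)).
    replace (f x y t - f u v s + f u v s) with (f x y t) in Ht' by ring; lra.
  - rewrite <- (Rinv_inv (1 + Rabs (f u v s))).
    apply Rinv_le_contravar; lra.
Qed.

Lemma continuous_bounded2 (f : R -> R -> R) (R0 : R) :
  (forall x y, continuous2 f x y) ->
  exists M, 0 < M /\ forall x y, inbox R0 x y -> Rabs (f x y) <= M.
Proof.
  intros Hc.
  destruct (continuous_bounded3 (fun x y _ => f x y) R0 0 0) as [M [HM HM']].
  - intros x y t _.
    apply (continuous_comp fst (fun p : R * R => f (fst p) (snd p)));
      [apply continuous_fst | apply Hc].
  - exists M; split; auto; intros x y Hb; apply (HM' x y 0); auto; lra.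
Qed.

Lemma continuous_bounded1 (f : R -> R) (t0 t1 : R) :
  (forall t, t0 <= t <= t1 -> continuous f t) ->
  exists M, 0 < M /\ forall t, t0 <= t <= t1 -> Rabs (f t) <= M.
Proof.
  intros Hc.
  destruct (continuous_bounded3 (fun _ _ t => f t) 0 t0 t1) as [M [HM HM']].
  - intros x y t Ht; apply (continuous_comp snd f); [apply continuous_snd | now apply Hc].
  - exists M; split; auto; intros t Ht; apply (HM' 0 0 t); auto.
    split; rewrite Rabs_R0; lra.
Qed.

(** * Smooth functions *)

Lemma smooth2_cont (f : R -> R -> R) (x y : R) :
  smooth2 f -> continuous2 f x y.
Proof. intros Hf; apply (Hf O). Qed.

Lemma smooth2_dx (f : R -> R -> R) : smooth2 f -> smooth2 (d_x f).
Proof. intros Hf k; apply (Hf (S k)). Qed.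

Lemma smooth2_dy (f : R -> R -> R) : smooth2 f -> smooth2 (d_y f).
Proof. intros Hf k; apply (Hf (S k)). Qed.

Lemma smooth2_is_dx (f : R -> R -> R) (x y : R) :
  smooth2 f -> is_derive (fun u => f u y) x (d_x f x y).
Proof.
  intros Hf; destruct (Hf 1%nat) as [_ [Hd _]]; exact (Derive_correct _ _ (proj1 (Hd x y))).
Qed.

Lemma smooth2_is_dy (f : R -> R -> R) (x y : R) :
  smooth2 f -> is_derive (fun v => f x v) y (d_y f x y).
Proof.
  intros Hf; destruct (Hf 1%nat) as [_ [Hd _]]; exact (Derive_correct _ _ (proj2 (Hd x y))).
Qed.

Lemma smooth2_differentiable (f : R -> R -> R) (x y : R) :
  smooth2 f -> differentiable_pt_lim f x y (d_x f x y) (d_y f x y).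
Proof.
  intros Hf; apply filterdiff_differentiable_pt_lim.
  apply (is_derive_filterdiff f x y (d_x f) (d_y f x y)).
  - apply filter_forall; intros [u v]; now apply smooth2_is_dx.
  - now apply smooth2_is_dy.
  - now apply smooth2_cont, smooth2_dx.
Qed.

Lemma smooth2_chain (f : R -> R -> R) (x y : R -> R) (t dx dy : R) :
  smooth2 f -> is_derive x t dx -> is_derive y t dy ->
  is_derive (fun s => f (x s) (y s)) t
    (d_x f (x t) (y t) * dx + d_y f (x t) (y t) * dy).
Proof.
  intros Hf Hx Hy; apply is_derive_Reals, derivable_pt_lim_comp_2d.
  - now apply smooth2_differentiable.
  - now apply is_derive_Reals.
  - now apply is_derive_Reals.
Qed.

Lemma smooth2_comp_cont (f : R -> R -> R) (x y : R -> R) (t : R) :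
  smooth2 f -> continuous x t -> continuous y t ->
  continuous (fun s => f (x s) (y s)) t.
Proof. intros Hf Hx Hy; apply continuous_uncurry; auto; now apply smooth2_cont. Qed.

Lemma smooth2_schwarz (f : R -> R -> R) (x y : R) :
  smooth2 f -> d_x (d_y f) x y = d_y (d_x f) x y.
Proof.
  intros Hf; apply (Schwarz f x y).
  - exists posreal_one; intros u v _ _; repeat split.
    + exists (d_x f u v); now apply smooth2_is_dx.
    + exists (d_y f u v); now apply smooth2_is_dy.
    + exists (d_x (d_y f) u v); now apply (smooth2_is_dx (d_y f)), smooth2_dy.
    + exists (d_y (d_x f) u v); now apply (smooth2_is_dy (d_x f)), smooth2_dx.
  - apply continuity_2d_pt_filterlim, (smooth2_cont (d_x (d_y f))).
    now apply smooth2_dx, smooth2_dy.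
  - apply continuity_2d_pt_filterlim, (smooth2_cont (d_y (d_x f))).
    now apply smooth2_dy, smooth2_dx.
Qed.

(** Remainders and energies are built from binary linear combinations alone, which explains shapes
    such as [1 * f + (- c) * 1] further on. *)
Lemma d_x_lin (f g : R -> R -> R) (a b : R) : smooth2 f -> smooth2 g ->
  d_x (fun x y => a * f x y + b * g x y) = (fun x y => a * d_x f x y + b * d_x g x y).
Proof.
  intros Hf Hg; extensionality x; extensionality y; apply is_derive_unique.
  apply is_derive_Rplus; apply is_derive_Rscal; now apply smooth2_is_dx.
Qed.

Lemma d_y_lin (f g : R -> R -> R) (a b : R) : smooth2 f -> smooth2 g ->
  d_y (fun x y => a * f x y + b * g x y) = (fun x y => a * d_y f x y + b * d_y g x y).
Proof.
  intros Hf Hg; extensionality x; extensionality y; apply is_derive_unique.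
  apply is_derive_Rplus; apply is_derive_Rscal; now apply smooth2_is_dy.
Qed.

Lemma smooth2_lin (f g : R -> R -> R) (a b : R) : smooth2 f -> smooth2 g ->
  smooth2 (fun x y => a * f x y + b * g x y).
Proof.
  intros Hf Hg k; revert f g Hf Hg; induction k as [| k IH]; intros f g Hf Hg;
    (split; [intros x y; apply continuous_Rplus;
       apply continuous_Rscal; now apply smooth2_cont |]).
  - exact I.
  - split; [| split].
    + intros x y; split.
      * exists (a * d_x f x y + b * d_x g x y).
        apply is_derive_Rplus; apply is_derive_Rscal; now apply smooth2_is_dx.
      * exists (a * d_y f x y + b * d_y g x y).
        apply is_derive_Rplus; apply is_derive_Rscal; now apply smooth2_is_dy.
    + rewrite d_x_lin by auto; apply IH; now apply smooth2_dx.
    + rewrite d_y_lin by auto; apply IH; now apply smooth2_dy.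
Qed.

Lemma Ck2_const (c : R) (k : nat) : Ck2 k (fun _ _ => c).
Proof.
  assert (Hz : forall z, d_x (fun _ _ => z) = (fun _ _ => 0) /\ d_y (fun _ _ => z) = (fun _ _ => 0)).
  { intros z; split; extensionality x; extensionality y; exact (Derive_const z _). }
  revert c; induction k as [| k IH]; intros c; (split; [intros; apply continuous_const |]); auto.
  destruct (Hz c) as [-> ->]; repeat split; auto; apply ex_derive_const.
Qed.

Lemma smooth2_const (c : R) : smooth2 (fun _ _ => c).
Proof. intros k; apply Ck2_const. Qed.

Lemma smooth3_cont (f : R -> R -> R -> R) (x y t : R) : smooth3 f -> 0 < t ->
  continuous3 f x y t.
Proof. intros Hf Ht; now apply (Hf O). Qed.

Lemma smooth3_dx (f : R -> R -> R -> R) :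
  smooth3 f -> smooth3 (fun x y t => d_x (fun u v => f u v t) x y).
Proof. intros Hf k; apply (Hf (S k)). Qed.

Lemma smooth3_dy (f : R -> R -> R -> R) :
  smooth3 f -> smooth3 (fun x y t => d_y (fun u v => f u v t) x y).
Proof. intros Hf k; apply (Hf (S k)). Qed.

Lemma smooth3_slice (f : R -> R -> R -> R) (t : R) :
  smooth3 f -> 0 < t -> smooth2 (fun x y => f x y t).
Proof.
  intros Hf Ht k; revert f Hf; induction k as [| k IH]; intros f Hf;
    (split; [intros x y;
       apply (continuous_uncurry3 f fst snd (fun _ => t));
       [now apply smooth3_cont | apply continuous_fst | apply continuous_snd
        | apply continuous_const] |]); auto.
  split; [| split].
  - intros x y; destruct (Hf 1%nat) as [_ [Hd _]]; specialize (Hd x y t Ht); tauto.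
  - apply (IH (fun x y t => d_x (fun u v => f u v t) x y)); now apply smooth3_dx.
  - apply (IH (fun x y t => d_y (fun u v => f u v t) x y)); now apply smooth3_dy.
Qed.

Lemma inbox_between (R0 a b s : R) :
  Rabs a <= R0 -> Rabs b <= R0 -> Rmin a b <= s <= Rmax a b -> Rabs s <= R0.
Proof.
  intros Ha Hb Hs; apply Rabs_le; apply Rabs_le_between in Ha; apply Rabs_le_between in Hb.
  unfold Rmin, Rmax in Hs; destruct (Rle_dec a b); lra.
Qed.

(** Moves along one horizontal and one vertical segment, both inside the box. *)
Lemma smooth2_lipschitz (f : R -> R -> R) (R0 M x y x' y' : R) :
  smooth2 f ->
  (forall u v, inbox R0 u v -> Rabs (d_x f u v) <= M /\ Rabs (d_y f u v) <= M) ->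
  inbox R0 x y -> inbox R0 x' y' ->
  Rabs (f x y - f x' y') <= M * nm (x - x') (y - y').
Proof.
  intros Hf HM [Hx Hy] [Hx' Hy'].
  assert (H1 : Rabs (f x y - f x' y) <= M * Rabs (x - x')).
  { apply (mvt_abs_sym (fun u => f u y) (fun u => d_x f u y)).
    - intros; now apply smooth2_is_dx.
    - intros s Hs; apply HM; split; auto; now apply (inbox_between R0 x' x). }
  assert (H2 : Rabs (f x' y - f x' y') <= M * Rabs (y - y')).
  { apply (mvt_abs_sym (fun u => f x' u) (fun u => d_y f x' u)).
    - intros; now apply smooth2_is_dy.
    - intros s Hs; apply HM; split; auto; now apply (inbox_between R0 y' y). }
  replace (f x y - f x' y') with ((f x y - f x' y) + (f x' y - f x' y')) by ring.
  eapply Rle_trans; [apply Rabs_triang | unfold nm; lra].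
Qed.

Lemma smooth2_vanish (f : R -> R -> R) (R0 M x y : R) :
  smooth2 f -> f 0 0 = 0 ->
  (forall u v, inbox R0 u v -> Rabs (d_x f u v) <= M /\ Rabs (d_y f u v) <= M) ->
  inbox R0 x y -> Rabs (f x y) <= M * nm x y.
Proof.
  intros Hf H0 HM Hb.
  assert (H := smooth2_lipschitz f R0 M x y 0 0 Hf HM Hb).
  rewrite H0, !Rminus_0_r in H; apply H.
  destruct Hb as [Hx _]; assert (Hp := Rabs_pos x).
  split; rewrite Rabs_R0; lra.
Qed.

Lemma smooth2_locally_lipschitz (f : R -> R -> R) (R0 : R) :
  smooth2 f -> exists M, 0 < M /\ forall x y x' y', inbox R0 x y -> inbox R0 x' y' ->
    Rabs (f x y - f x' y') <= M * nm (x - x') (y - y').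
Proof.
  intros Hf.
  destruct (continuous_bounded2 (d_x f) R0) as [M1 [HM1 H1]];
    [intros; now apply smooth2_cont, smooth2_dx |].
  destruct (continuous_bounded2 (d_y f) R0) as [M2 [HM2 H2]];
    [intros; now apply smooth2_cont, smooth2_dy |].
  exists (M1 + M2); split; [lra |]; intros x y x' y' Hb Hb'.
  apply (smooth2_lipschitz f R0); auto.
  intros u v Huv; specialize (H1 u v Huv); specialize (H2 u v Huv); lra.
Qed.

Lemma smooth2_vanish_linear (f : R -> R -> R) (R0 : R) :
  smooth2 f -> f 0 0 = 0 ->
  exists M, 0 < M /\ forall x y, inbox R0 x y -> Rabs (f x y) <= M * nm x y.
Proof.
  intros Hf H0; destruct (smooth2_locally_lipschitz f R0 Hf) as [M [HM H]].
  exists M; split; auto; intros x y Hb; specialize (H x y 0 0 Hb).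
  rewrite H0, !Rminus_0_r in H; apply H.
  destruct Hb as [Hx _]; assert (Hp := Rabs_pos x); split; rewrite Rabs_R0; lra.
Qed.

(** Along the ray from the origin the gradient is O(r) and the velocity is O(r), where r is
    [nm x y]. *)
Lemma smooth2_vanish_quadratic (f : R -> R -> R) (R0 : R) :
  smooth2 f -> d_x f 0 0 = 0 -> d_y f 0 0 = 0 ->
  exists M, 0 < M /\ forall x y, inbox R0 x y ->
    Rabs (f x y - f 0 0) <= M * (nm x y * nm x y).
Proof.
  intros Hf Hx0 Hy0.
  destruct (smooth2_vanish_linear (d_x f) R0 (smooth2_dx f Hf) Hx0) as [M1 [HM1 H1]].
  destruct (smooth2_vanish_linear (d_y f) R0 (smooth2_dy f Hf) Hy0) as [M2 [HM2 H2]].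
  exists (M1 + M2); split; [lra |]; intros x y Hb.
  set (r := nm x y).
  assert (Hpath : forall s, 0 <= s <= 1 -> inbox R0 (s * x) (s * y) /\ nm (s * x) (s * y) <= r).
  { intros s Hs; unfold inbox, r, nm; rewrite !Rabs_mult, (Rabs_pos_eq s) by lra.
    destruct Hb as [Hbx Hby].
    assert (Hpx := Rabs_pos x); assert (Hpy := Rabs_pos y); repeat split; nra. }
  assert (H := mvt_abs (fun s => f (s * x) (s * y))
    (fun s => d_x f (s * x) (s * y) * x + d_y f (s * x) (s * y) * y) 0 1
    ((M1 + M2) * (r * r))).
  cbv beta in H; rewrite !Rmult_1_l, !Rmult_0_l, Rminus_0_r, Rmult_1_r in H.
  apply H; [lra | |].
  - intros s Hs; apply (smooth2_chain f (fun s => s * x) (fun s => s * y)); auto;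
      auto_derive; auto; ring.
  - intros s Hs; destruct (Hpath s Hs) as [Hin Hle].
    specialize (H1 _ _ Hin); specialize (H2 _ _ Hin).
    destruct (nm_le x y) as [Hlx Hly]; fold r in Hlx, Hly.
    triangle.
    apply Rle_trans with (M1 * r * r + M2 * r * r); [| lra].
    apply Rplus_le_compat; apply Rabs_mult_le; auto;
      eapply Rle_trans; eauto; apply Rmult_le_compat_l; lra.
Qed.

Lemma smooth2_first_order (f : R -> R -> R) (eta : R) :
  0 < eta -> smooth2 f -> f 0 0 = 0 ->
  exists r, 0 < r /\ forall x y, nm x y < r ->
    Rabs (f x y - (d_x f 0 0 * x + d_y f 0 0 * y)) <= eta * nm x y.
Proof.
  intros He Hf H0.
  destruct (smooth2_differentiable f 0 0 Hf (mkposreal eta He)) as [d Hd].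
  exists d; split; [apply cond_pos |]; intros x y Hr.
  destruct (nm_le x y) as [Hx Hy].
  specialize (Hd x y); rewrite !Rminus_0_r, H0, Rminus_0_r in Hd; simpl in Hd.
  eapply Rle_trans; [apply Hd; lra |].
  apply Rmult_le_compat_l; [lra |]; now apply Rmax_lub.
Qed.

(** * Existence and uniqueness of solutions *)

Lemma half_pow_small (C e : R) : 0 < e -> exists N, forall n, (N <= n)%nat -> C * (/ 2) ^ n < e.
Proof.
  intros He.
  assert (HC : 0 < Rabs C + 1) by (assert (H := Rabs_pos C); lra).
  destruct (pow_lt_1_zero (/ 2)) with (y := e / (Rabs C + 1)) as [N HN].
  - rewrite Rabs_pos_eq; lra.
  - now apply Rdiv_lt_0_compat.
  - exists N; intros n Hn; specialize (HN n Hn).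
    assert (Hp : 0 < (/ 2) ^ n) by (apply pow_lt; lra).
    rewrite Rabs_pos_eq in HN by lra.
    apply Rmult_lt_compat_l with (r := Rabs C + 1) in HN; auto.
    replace ((Rabs C + 1) * (e / (Rabs C + 1))) with e in HN by (field; lra).
    assert (H := Rle_abs C); nra.
Qed.

Lemma half_pow_zero (C x : R) : (forall n, Rabs x <= C * (/ 2) ^ n) -> x = 0.
Proof.
  intros H; apply NNPP; intros Hx.
  destruct (half_pow_small C (Rabs x)) as [N HN]; [now apply Rabs_pos_lt |].
  specialize (H N); specialize (HN N (le_n N)); lra.
Qed.

(** The induction on the gap carries the telescoping bound 2 C (2^(-n) - 2^(-n-p)), whose limit in p
    is the claim. *)
Lemma geometric_limit (u : nat -> R) (C : R) :
  (forall n, Rabs (u (S n) - u n) <= C * (/ 2) ^ n) ->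
  forall n, Rabs (u n - real (Lim_seq u)) <= 2 * C * (/ 2) ^ n.
Proof.
  intros Hu.
  assert (Hp : forall n, 0 < (/ 2) ^ n) by (intros; apply pow_lt; lra).
  assert (Hnp : forall n p, Rabs (u (n + p)%nat - u n) <= 2 * C * ((/ 2) ^ n - (/ 2) ^ (n + p))).
  { intros n p; induction p as [| p IH].
    - rewrite Nat.add_0_r, !Rminus_diag, Rabs_R0; lra.
    - rewrite Nat.add_succ_r; specialize (Hu (n + p)%nat).
      replace (u (S (n + p)) - u n) with ((u (S (n + p)) - u (n + p)%nat) + (u (n + p)%nat - u n))
        by ring.
      triangle; simpl pow; lra. }
  assert (HC : 0 <= C).
  { specialize (Hu O); simpl in Hu; assert (H := Rabs_pos (u 1%nat - u O)); lra. }
  assert (Hnp' : forall n p, (n <= p)%nat -> Rabs (u p - u n) <= 2 * C * (/ 2) ^ n).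
  { intros n p Hle; replace p with (n + (p - n))%nat by lia.
    eapply Rle_trans; [apply Hnp |].
    assert (H := Hp (n + (p - n))%nat); nra. }
  assert (Hex : ex_finite_lim_seq u).
  { apply ex_lim_seq_cauchy_corr; intros eps.
    destruct (half_pow_small (4 * C) eps (cond_pos eps)) as [N HN].
    exists N; intros n m Hn Hm.
    assert (H1 := Hnp' N n Hn); assert (H2 := Hnp' N m Hm); specialize (HN N (le_n N)).
    replace (u n - u m) with ((u n - u N) - (u m - u N)) by ring.
    eapply Rle_lt_trans; [apply Rabs_triang |]; rewrite Rabs_Ropp; lra. }
  destruct Hex as [l Hex]; rewrite (is_lim_seq_unique _ _ Hex); simpl real; intros n.
  assert (Hlim : is_lim_seq (fun p => Rabs (u n - u (p + n)%nat)) (Rabs (u n - l))).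
  { apply (is_lim_seq_abs _ (Finite (u n - l))).
    apply is_lim_seq_minus'; [apply is_lim_seq_const |].
    now apply (is_lim_seq_incr_n u n). }
  apply (is_lim_seq_le _ _ _ (2 * C * (/ 2) ^ n)) with (2 := Hlim) (3 := is_lim_seq_const _).
  intros p; rewrite Rabs_minus_sym; apply Hnp'; lia.
Qed.

Lemma is_derive_primitive (w : R -> R) (a t0 t : R) :
  (forall s, continuous w s) -> is_derive (fun r => a + RInt w t0 r) t (w t).
Proof.
  intros Hw; rewrite <- (Rplus_0_l (w t)).
  apply is_derive_Rplus; [apply (is_derive_const (V := R_NormedModule)) |].
  apply (is_derive_RInt w (fun r => RInt w t0 r) t0 t); auto.
  apply filter_forall; intros r; apply (RInt_correct (V := R_CompleteNormedModule)).
  apply (ex_RInt_continuous (V := R_CompleteNormedModule)); auto.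
Qed.

Lemma continuous_Rmax_l (c s : R) : continuous (fun r => Rmax r c) s.
Proof.
  apply continuous_ext with (fun r => (r + c + Rabs (r - c)) / 2).
  - intros r; unfold Rmax, Rabs; destruct (Rle_dec r c), (Rcase_abs (r - c)); lra.
  - apply continuous_Rmult; [| apply continuous_const].
    apply continuous_Rplus.
    + apply continuous_Rplus; [apply continuous_id | apply continuous_const].
    + apply continuous_Rabs_comp, continuous_Rminus;
        [apply continuous_id | apply continuous_const].
Qed.

Lemma continuous_Rmin_l (c s : R) : continuous (fun r => Rmin r c) s.
Proof.
  apply continuous_ext with (fun r => - Rmax (- r) (- c)).
  - intros r; unfold Rmin, Rmax; destruct (Rle_dec r c), (Rle_dec (- r) (- c)); lra.
  - apply continuous_Ropp.
    apply (continuous_comp Ropp (fun r => Rmax r (- c))); [| apply continuous_Rmax_l].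
    apply continuous_Ropp, continuous_id.
Qed.

(** Convergence is controlled on bounded intervals after [t0] only; freezing the argument by [Rmax]
    yields a function continuous on the whole line, as the primitives below require. *)
Lemma geometric_limit_continuous (f : nat -> R -> R) (g : R -> R) (t0 : R) :
  (forall n t, continuous (f n) t) ->
  (forall T, t0 <= T -> exists C, forall n t, t0 <= t <= T -> Rabs (f n t - g t) <= C * (/ 2) ^ n) ->
  forall s, continuous (fun r => g (Rmax r t0)) s.
Proof.
  intros Hf Hg s; apply continuity_pt_filterlim, continuity_pt_locally; intros eps.
  destruct (Hg (Rmax s t0 + 1)) as [C HC]; [assert (H := Rmax_r s t0); lra |].
  assert (He : 0 < eps / 3) by (assert (H := cond_pos eps); lra).
  destruct (half_pow_small C (eps / 3) He) as [N HN]; specialize (HN N (le_n N)).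
  assert (HcN : continuous (fun r => f N (Rmax r t0)) s).
  { apply (continuous_comp (fun r => Rmax r t0) (f N)); [apply continuous_Rmax_l | apply Hf]. }
  destruct (proj1 (continuity_pt_locally _ s) (proj2 (continuity_pt_filterlim _ s) HcN)
    (mkposreal _ He)) as [d Hd].
  assert (Hd1 : 0 < Rmin d 1) by (apply Rmin_pos; [apply cond_pos | lra]).
  exists (mkposreal _ Hd1); intros r Hr.
  assert (Hr' : Rabs (r - s) < Rmin d 1) by exact Hr.
  assert (Hml := Rmin_l d 1); assert (Hmr := Rmin_r d 1).
  assert (H1 : Rabs (f N (Rmax r t0) - f N (Rmax s t0)) < eps / 3).
  { apply (Hd r); change (Rabs (r - s) < d); lra. }
  assert (H2 : Rabs (f N (Rmax r t0) - g (Rmax r t0)) <= C * (/ 2) ^ N).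
  { apply HC; split; [apply Rmax_r |].
    apply Rabs_lt_between' in Hr'; unfold Rmax; destruct (Rle_dec r t0), (Rle_dec s t0); lra. }
  assert (H3 : Rabs (f N (Rmax s t0) - g (Rmax s t0)) <= C * (/ 2) ^ N).
  { apply HC; split; [apply Rmax_r | lra]. }
  apply Rabs_def1; apply Rabs_lt_between in H1; apply Rabs_le_between in H2;
    apply Rabs_le_between in H3; lra.
Qed.

Section Picard.

Variables (G1 G2 : R -> R -> R -> R) (t0 K a b : R).
Hypothesis HK : 0 < K.
Hypothesis HG1 : forall x y t, continuous3 G1 x y t.
Hypothesis HG2 : forall x y t, continuous3 G2 x y t.
Hypothesis HL : forall x y x' y' t,
  Rabs (G1 x y t - G1 x' y' t) <= K * nm (x - x') (y - y') /\
  Rabs (G2 x y t - G2 x' y' t) <= K * nm (x - x') (y - y').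

Let step (z : (R -> R) * (R -> R)) : (R -> R) * (R -> R) :=
  (fun t => a + RInt (fun s => G1 (fst z s) (snd z s) s) t0 t,
   fun t => b + RInt (fun s => G2 (fst z s) (snd z s) s) t0 t).

Let it (n : nat) := Nat.iter n step (fun _ => a, fun _ => b).
Let X n := fst (it n).
Let Y n := snd (it n).

Let cont_comp (G : R -> R -> R -> R) (x y : R -> R) :
  (forall x y t, continuous3 G x y t) ->
  (forall t, continuous x t) -> (forall t, continuous y t) ->
  forall r, continuous (fun s => G (x s) (y s) s) r.
Proof. intros HG Hx Hy r; apply continuous_uncurry3; auto; apply continuous_id. Qed.

Let it_derive n : (forall t, continuous (X n) t) /\ (forall t, continuous (Y n) t) /\
  (forall t, is_derive (X (S n)) t (G1 (X n t) (Y n t) t)) /\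
  (forall t, is_derive (Y (S n)) t (G2 (X n t) (Y n t) t)).
Proof.
  induction n as [| n [_ [_ [IHX IHY]]]].
  - split; [intros; apply continuous_const | split; [intros; apply continuous_const | split]].
    + intros t; apply (is_derive_primitive (fun s => G1 (X 0 s) (Y 0 s) s)).
      apply cont_comp; auto; intros; apply continuous_const.
    + intros t; apply (is_derive_primitive (fun s => G2 (X 0 s) (Y 0 s) s)).
      apply cont_comp; auto; intros; apply continuous_const.
  - assert (HX : forall t, continuous (X (S n)) t)
      by (intros t; apply (is_derive_cont _ _ _ (IHX t))).
    assert (HY : forall t, continuous (Y (S n)) t)
      by (intros t; apply (is_derive_cont _ _ _ (IHY t))).
    split; [exact HX | split; [exact HY | split]].
    + intros t; apply (is_derive_primitive (fun s => G1 (X (S n) s) (Y (S n) s) s)).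
      now apply cont_comp.
    + intros t; apply (is_derive_primitive (fun s => G2 (X (S n) s) (Y (S n) s) s)).
      now apply cont_comp.
Qed.

Let it_start n : X n t0 = a /\ Y n t0 = b.
Proof.
  destruct n as [| n]; [now split |]; unfold X, Y; simpl.
  rewrite !(RInt_point (V := R_CompleteNormedModule)); split; apply Rplus_0_r.
Qed.

(* Each Picard step halves the distance in the norm weighted by [exp (4 K (t - t0))]. *)
Let it_contract T : t0 <= T -> exists C, forall n t, t0 <= t <= T ->
  nm (X (S n) t - X n t) (Y (S n) t - Y n t) <= C * (/ 2) ^ n * exp (4 * K * (t - t0)).
Proof.
  intros HT.
  destruct (it_derive 0) as [HX0 [HY0 [HX1 HY1]]].
  destruct (continuous_bounded1 (fun t => nm (X 1 t - X 0 t) (Y 1 t - Y 0 t)) t0 T)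
    as [C [HC HCb]].
  { intros t _; apply continuous_nm; apply continuous_Rminus; auto;
      eapply is_derive_cont; [apply HX1 | apply HY1]. }
  exists C; intros n; induction n as [| n IH]; intros t Ht.
  - assert (H1 : 1 <= exp (4 * K * (t - t0))).
    { apply exp_ge_1, Rmult_le_pos; lra. }
    assert (Hb : nm (X 1 t - X 0 t) (Y 1 t - Y 0 t) <= C).
    { eapply Rle_trans; [apply Rle_abs | now apply HCb]. }
    simpl pow; nra.
  - destruct (it_derive n) as [_ [_ [HXn HYn]]].
    destruct (it_derive (S n)) as [_ [_ [HXs HYs]]].
    destruct (it_start n) as [Ex Ey]; destruct (it_start (S n)) as [Ex' Ey'];
      destruct (it_start (S (S n))) as [Ex'' Ey''].
    (* Integrating K exp(4 K s) produces the factor 1/4 in each component; the two components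
       together give 1/2. *)
    set (c := C * (/ 2) ^ n / 4).
    assert (Hc : 0 < c) by (unfold c; assert (0 < (/ 2) ^ n) by (apply pow_lt; lra); nra).
    assert (HE : forall s, t0 <= s <= t ->
      is_derive (fun s => c * exp (4 * K * (s - t0))) s (c * (4 * K * exp (4 * K * (s - t0))))).
    { intros s _; apply is_derive_Rscal; auto_derive; [exact I |];
      rewrite Rmult_1_r; reflexivity. }
    assert (Hest : forall s, t0 <= s <= t ->
      K * nm (X (S n) s - X n s) (Y (S n) s - Y n s) <= c * (4 * K * exp (4 * K * (s - t0)))).
    { intros s Hs; specialize (IH s ltac:(lra)).
      apply Rmult_le_compat_l with (r := K) in IH; [| lra].
      eapply Rle_trans; [exact IH |]; right; unfold c; field. }
    assert (HDx := dominated_increment (fun s => X (S (S n)) s - X (S n) s)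
      (fun s => G1 (X (S n) s) (Y (S n) s) s - G1 (X n s) (Y n s) s) _ _ t0 t (proj1 Ht)
      (fun s _ => is_derive_Rminus _ _ _ _ _ (HXs s) (HXn s)) HE
      (fun s Hs => Rle_trans _ _ _ (proj1 (HL _ _ _ _ _)) (Hest s Hs))).
    assert (HDy := dominated_increment (fun s => Y (S (S n)) s - Y (S n) s)
      (fun s => G2 (X (S n) s) (Y (S n) s) s - G2 (X n s) (Y n s) s) _ _ t0 t (proj1 Ht)
      (fun s _ => is_derive_Rminus _ _ _ _ _ (HYs s) (HYn s)) HE
      (fun s Hs => Rle_trans _ _ _ (proj2 (HL _ _ _ _ _)) (Hest s Hs))).
    cbv beta in HDx, HDy.
    rewrite Ex', Ex'', Rminus_diag, Rminus_0_r in HDx.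
    rewrite Ey', Ey'', Rminus_diag, Rminus_0_r in HDy.
    assert (Hp := exp_pos (4 * K * (t0 - t0))).
    unfold nm; simpl pow; unfold c in *; nra.
Qed.

Theorem picard_global : exists x y : R -> R, x t0 = a /\ y t0 = b /\
  forall t, t0 <= t ->
    is_derive x t (G1 (x t) (y t) t) /\ is_derive y t (G2 (x t) (y t) t).
Proof.
  set (Xl := fun t => real (Lim_seq (fun n => X n t))).
  set (Yl := fun t => real (Lim_seq (fun n => Y n t))).
  assert (Hlim : forall T, t0 <= T -> exists C, 0 <= C /\ forall n t, t0 <= t <= T ->
    Rabs (X n t - Xl t) <= C * (/ 2) ^ n /\ Rabs (Y n t - Yl t) <= C * (/ 2) ^ n).
  { intros T HT; destruct (it_contract T HT) as [C HC].
    assert (Hbound : forall n t, t0 <= t <= T ->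
       nm (X (S n) t - X n t) (Y (S n) t - Y n t) <= Rabs C * exp (4 * K * (T - t0)) * (/ 2) ^ n).
    { intros n t Ht; eapply Rle_trans; [now apply HC |].
      assert (Hp : 0 < (/ 2) ^ n) by (apply pow_lt; lra).
      assert (He : exp (4 * K * (t - t0)) <= exp (4 * K * (T - t0))).
      { apply exp_monotone, Rmult_le_compat_l; lra. }
      assert (Hp' := exp_pos (4 * K * (t - t0))); assert (H1 := Rle_abs C); assert (H2 := Rabs_pos C).
      apply Rle_trans with (Rabs C * (/ 2) ^ n * exp (4 * K * (t - t0))).
      - apply Rmult_le_compat_r; [lra |]; apply Rmult_le_compat_r; lra.
      - replace (Rabs C * exp (4 * K * (T - t0)) * (/ 2) ^ n)
          with (Rabs C * (/ 2) ^ n * exp (4 * K * (T - t0))) by ring.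
        apply Rmult_le_compat_l; auto; apply Rmult_le_pos; lra. }
    exists (2 * (Rabs C * exp (4 * K * (T - t0)))); split.
    - apply Rmult_le_pos; [lra |]; apply Rmult_le_pos; [apply Rabs_pos | left; apply exp_pos].
    - intros n t Ht; split.
      + apply (geometric_limit (fun n => X n t)); intros m.
        eapply Rle_trans; [apply (proj1 (nm_le _ (Y (S m) t - Y m t))) | now apply Hbound].
      + apply (geometric_limit (fun n => Y n t)); intros m.
        eapply Rle_trans; [apply (proj2 (nm_le (X (S m) t - X m t) _)) | now apply Hbound]. }
  set (wx := fun s => Xl (Rmax s t0)); set (wy := fun s => Yl (Rmax s t0)).
  assert (Hwx : forall s, continuous wx s).
  { apply (geometric_limit_continuous X); [intros n; apply (it_derive n) |].
    intros T HT; destruct (Hlim T HT) as [C [_ HC]]; exists C; intros; now apply HC. }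
  assert (Hwy : forall s, continuous wy s).
  { apply (geometric_limit_continuous Y); [intros n; apply (it_derive n) |].
    intros T HT; destruct (Hlim T HT) as [C [_ HC]]; exists C; intros; now apply HC. }
  (* Differentiating the limit directly would need convergence of derivatives. Instead the integral
     operator is applied once to the limit: the result is differentiable, and it remains to see that
     it equals the limit after [t0]. *)
  set (Px := fun t => a + RInt (fun s => G1 (wx s) (wy s) s) t0 t).
  set (Py := fun t => b + RInt (fun s => G2 (wx s) (wy s) s) t0 t).
  assert (HPx : forall t, is_derive Px t (G1 (wx t) (wy t) t)).
  { intros t; apply (is_derive_primitive (fun s => G1 (wx s) (wy s) s)); now apply cont_comp. }
  assert (HPy : forall t, is_derive Py t (G2 (wx t) (wy t) t)).
  { intros t; apply (is_derive_primitive (fun s => G2 (wx s) (wy s) s)); now apply cont_comp. }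
  assert (HP0 : Px t0 = a /\ Py t0 = b).
  { unfold Px, Py; rewrite !(RInt_point (V := R_CompleteNormedModule)); split; apply Rplus_0_r. }
  assert (Heq : forall t, t0 <= t -> wx t = Px t /\ wy t = Py t).
  { intros t Ht; destruct (Hlim t Ht) as [C [HC0 HC]].
    assert (Hw : forall s, t0 <= s -> wx s = Xl s /\ wy s = Yl s)
      by (intros s Hs; unfold wx, wy; now rewrite Rmax_left).
    assert (Hd : forall n s, t0 <= s <= t ->
      K * nm (X n s - wx s) (Y n s - wy s) <= K * (2 * C * (/ 2) ^ n)).
    { intros n s Hs; apply Rmult_le_compat_l; [lra |].
      destruct (Hw s (proj1 Hs)) as [-> ->]; destruct (HC n s Hs); unfold nm; lra. }
    assert (Hp : forall n, 0 < (/ 2) ^ n) by (intros; apply pow_lt; lra).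
    (* The derivatives of iterate n + 1 and of the primitive differ by at most 2 K C 2^(-n), so both
       the primitive and the limit are within O(2^(-n)) of that iterate. *)
    assert (Hone : forall (Z : nat -> R -> R) (G : R -> R -> R -> R) (Zl Pz : R -> R),
      (forall n s, is_derive (Z (S n)) s (G (X n s) (Y n s) s)) ->
      (forall s, is_derive Pz s (G (wx s) (wy s) s)) ->
      (forall x y x' y' s, Rabs (G x y s - G x' y' s) <= K * nm (x - x') (y - y')) ->
      (forall n, Z (S n) t0 = Pz t0) ->
      (forall n, Rabs (Z n t - Zl t) <= C * (/ 2) ^ n) -> Zl t = Pz t).
    { intros Z G Zl Pz HZ HPz HG HZ0 HZl.
      apply Rminus_diag_uniq, (half_pow_zero (C + 2 * K * C * (t - t0))); intros n.
      assert (HX := mvt_abs (fun s => Z (S n) s - Pz s)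
        (fun s => G (X n s) (Y n s) s - G (wx s) (wy s) s) t0 t _ Ht
        (fun s _ => is_derive_Rminus _ _ _ _ _ (HZ n s) (HPz s))
        (fun s Hs => Rle_trans _ _ _ (HG _ _ _ _ _) (Hd n s Hs))).
      cbv beta in HX; rewrite HZ0, Rminus_diag, Rminus_0_r in HX.
      replace (Zl t - Pz t) with (Z (S n) t - Pz t - (Z (S n) t - Zl t)) by ring.
      triangle; rewrite Rabs_Ropp.
      specialize (HZl (S n)); simpl pow in HZl; specialize (Hp n); nra. }
    destruct (Hw t Ht) as [-> ->]; split.
    - apply (Hone X G1); auto; [intros n; apply (it_derive n) | intros; apply HL | |].
      + intros n; destruct (it_start (S n)), HP0; congruence.
      + intros n; apply HC; lra.
    - apply (Hone Y G2); auto; [intros n; apply (it_derive n) | intros; apply HL | |].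
      + intros n; destruct (it_start (S n)), HP0; congruence.
      + intros n; apply HC; lra. }
  exists Px, Py; split; [apply HP0 | split; [apply HP0 |]].
  intros t Ht; destruct (Heq t Ht) as [<- <-]; split; auto.
Qed.

End Picard.

(* Gronwall for the squared distance; [(nm - 2 eta)^2 >= 0] absorbs the linear term [eta nm],
   whence the constants. *)
Lemma curves_close (x y x' y' vx vy vx' vy' : R -> R) (K eta t0 t1 : R) :
  0 <= K -> 0 <= eta -> t0 <= t1 ->
  (forall t, t0 <= t <= t1 ->
     is_derive x t (vx t) /\ is_derive y t (vy t) /\
     is_derive x' t (vx' t) /\ is_derive y' t (vy' t)) ->
  (forall t, t0 <= t <= t1 ->
     Rabs (vx t - vx' t) <= K * nm (x t - x' t) (y t - y' t) + eta /\
     Rabs (vy t - vy' t) <= K * nm (x t - x' t) (y t - y' t) + eta) ->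
  let D t := (x t - x' t) * (x t - x' t) + (y t - y' t) * (y t - y' t) in
  D t1 <= (D t0 + 2 * eta * eta * (t1 - t0)) * exp ((4 * K + 2) * (t1 - t0)).
Proof.
  intros HK Heta Ht Hd Hv D.
  assert (HD : forall t, t0 <= t <= t1 -> is_derive D t
    (2 * (x t - x' t) * (vx t - vx' t) + 2 * (y t - y' t) * (vy t - vy' t))).
  { intros t Htt; destruct (Hd t Htt) as [H1 [H2 [H3 H4]]].
    assert (Hx := is_derive_Rminus _ _ _ _ _ H1 H3).
    assert (Hy := is_derive_Rminus _ _ _ _ _ H2 H4).
    eapply is_derive_eq.
    - apply is_derive_Rplus; apply is_derive_Rmult; eassumption.
    - simpl; ring. }
  apply (gronwall D (fun t => 2 * (x t - x' t) * (vx t - vx' t) + 2 * (y t - y' t) * (vy t - vy' t))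
    t0 t1 (4 * K + 2) (2 * eta * eta)); auto.
  - lra.
  - apply Rmult_le_pos; lra.
  - intros t Htt; destruct (Hv t Htt) as [Hx Hy]; clear Hv Hd HD; unfold D.
    set (u := x t - x' t) in *; set (v := y t - y' t) in *.
    set (p := vx t - vx' t) in *; set (r := vy t - vy' t) in *.
    assert (Hu := nm_sqr u v); assert (Hn := nm_pos u v).
    assert (Hup : u * p <= Rabs u * (K * nm u v + eta)).
    { eapply Rle_trans; [apply Rle_abs |]; rewrite Rabs_mult.
      apply Rmult_le_compat_l; auto using Rabs_pos. }
    assert (Hvr : v * r <= Rabs v * (K * nm u v + eta)).
    { eapply Rle_trans; [apply Rle_abs |]; rewrite Rabs_mult.
      apply Rmult_le_compat_l; auto using Rabs_pos. }
    assert (Hsum : u * p + v * r <= nm u v * (K * nm u v + eta)).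
    { replace (nm u v * (K * nm u v + eta))
        with (Rabs u * (K * nm u v + eta) + Rabs v * (K * nm u v + eta)) by (unfold nm; ring). lra. }
    assert (HKn : K * (nm u v * nm u v) <= K * (2 * (u * u + v * v)))
      by (apply Rmult_le_compat_l; auto).
    nra.
Qed.

(** * Asymptotic expansions *)

(** [partial_derive] recast so that each order adds one [d_x] or [d_y], the form in which smoothness
    is inherited. *)
Definition pdiff (i j : nat) (f : R -> R -> R) : R -> R -> R := Nat.iter i d_x (Nat.iter j d_y f).

Lemma partial_derive_pdiff (i j : nat) (f : R -> R -> R) (x y : R) :
  partial_derive i j f x y = pdiff i j f x y.
Proof.
  assert (Hj : forall k u v, Derive_n (fun z => f u z) k v = Nat.iter k d_y f u v).
  { induction k as [| k IH]; intros u v; [reflexivity |].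
    apply Derive_ext; intros z; apply IH. }
  revert x; unfold partial_derive; induction i as [| i IH]; intros x; simpl.
  - apply Hj.
  - apply Derive_ext; intros z; apply IH.
Qed.

Lemma iter_dy_smooth2 (j : nat) (f : R -> R -> R) : smooth2 f -> smooth2 (Nat.iter j d_y f).
Proof. intros Hf; induction j as [| j IH]; [easy | now apply smooth2_dy]. Qed.

Lemma pdiff_smooth2 (i j : nat) (f : R -> R -> R) : smooth2 f -> smooth2 (pdiff i j f).
Proof.
  intros Hf; induction i as [| i IH]; [now apply iter_dy_smooth2 | now apply smooth2_dx].
Qed.

Lemma pdiff_lin (i j : nat) (f g : R -> R -> R) (a b : R) : smooth2 f -> smooth2 g ->
  pdiff i j (fun x y => a * f x y + b * g x y) = (fun x y => a * pdiff i j f x y + b * pdiff i j g x y).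
Proof.
  intros Hf Hg; induction i as [| i IH].
  - induction j as [| j IH]; [reflexivity |].
    change (d_y (pdiff 0 j (fun x y => a * f x y + b * g x y)) =
      (fun x y => a * d_y (pdiff 0 j f) x y + b * d_y (pdiff 0 j g) x y)).
    rewrite IH; apply d_y_lin; now apply pdiff_smooth2.
  - change (d_x (pdiff i j (fun x y => a * f x y + b * g x y)) =
      (fun x y => a * d_x (pdiff i j f) x y + b * d_x (pdiff i j g) x y)).
    rewrite IH; apply d_x_lin; now apply pdiff_smooth2.
Qed.

Lemma d_y_pdiff (i j : nat) (f : R -> R -> R) : smooth2 f -> d_y (pdiff i j f) = pdiff i (S j) f.
Proof.
  intros Hf; induction i as [| i IH]; [reflexivity |].
  change (d_y (d_x (pdiff i j f)) = d_x (pdiff i (S j) f)); rewrite <- IH.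
  extensionality x; extensionality y; symmetry; now apply smooth2_schwarz, pdiff_smooth2.
Qed.

Lemma pdiff_smooth3 (i j : nat) (G : R -> R -> R -> R) :
  smooth3 G -> smooth3 (fun x y t => pdiff i j (fun u v => G u v t) x y).
Proof.
  intros HG; induction i as [| i IH].
  - induction j as [| j IH]; [exact HG |].
    exact (smooth3_dy _ IH).
  - exact (smooth3_dx _ IH).
Qed.

Lemma Rpower_inv_mult (t a : R) : Rpower t a * Rpower t (- a) = 1.
Proof.
  rewrite <- Rpower_plus, Rplus_opp_r; unfold Rpower; rewrite Rmult_0_l; apply exp_0.
Qed.

Lemma Rpower_neg_le (t a b : R) : 1 <= t -> a <= b -> Rpower t (- b) <= Rpower t (- a).
Proof. intros Ht Hab; apply Rle_Rpower; lra. Qed.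

Lemma Rpower_neg_small (a eta : R) : 0 < a -> 0 < eta ->
  exists t1, 1 <= t1 /\ forall t, t1 <= t -> Rpower t (- a) <= eta.
Proof.
  intros Ha He; exists (Rmax 1 (exp (- ln eta / a))); split; [apply Rmax_l |].
  intros t Ht.
  assert (H1 := Rmax_l 1 (exp (- ln eta / a))); assert (H2 := Rmax_r 1 (exp (- ln eta / a))).
  assert (Hln : - ln eta / a <= ln t).
  { rewrite <- (ln_exp (- ln eta / a)); apply ln_le; [apply exp_pos | lra]. }
  unfold Rpower; rewrite <- (exp_ln eta) by auto.
  assert (Hle : - a * ln t <= ln eta).
  { apply Rmult_le_compat_l with (r := a) in Hln; [| lra].
    replace (a * (- ln eta / a)) with (- ln eta) in Hln by (field; lra); lra. }
  destruct Hle as [Hlt | ->]; [left; now apply exp_increasing | lra].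
Qed.

Section Expansion.

Variables (q : nat) (G : R -> R -> R -> R) (Gk : nat -> R -> R -> R).
Hypothesis HG : forall t, 0 < t -> smooth2 (fun x y => G x y t).
Hypothesis HGk : forall k, (1 <= k)%nat -> smooth2 (Gk k).
Hypothesis Hexp : asymptotic_expansion q G Gk.

(** Subtracting one term at a time keeps smoothness and differentiation within [smooth2_lin] and
    [pdiff_lin]. *)
Fixpoint remainder (N : nat) (t : R) : R -> R -> R :=
  match N with
  | O => fun x y => G x y t
  | S N' => fun x y =>
      1 * remainder N' t x y + - Rpower t (- (INR N / INR q)) * Gk N x y
  end.

Lemma remainder_smooth2 (N : nat) (t : R) : 0 < t -> smooth2 (remainder N t).
Proof.
  intros Ht; induction N as [| N IH]; [now apply HG |].
  apply (smooth2_lin (remainder N t) (Gk (S N))); auto; apply HGk; lia.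
Qed.

Lemma pdiff_remainder_S (i j N : nat) (t x y : R) : 0 < t ->
  pdiff i j (remainder (S N) t) x y =
  pdiff i j (remainder N t) x y - Rpower t (- (INR (S N) / INR q)) * pdiff i j (Gk (S N)) x y.
Proof.
  intros Ht; unfold remainder at 1; fold (remainder N t).
  rewrite (pdiff_lin i j (remainder N t) (Gk (S N)));
    [ring | now apply remainder_smooth2 | apply HGk; lia].
Qed.

Lemma remainder_vanishes (N i j : nat) :
  vanishes_loc_unif (fun x y t => Rpower t (INR N / INR q) * pdiff i j (remainder N t) x y).
Proof.
  intros rho eps Heps; destruct (Hexp N i j rho eps Heps) as [t1 Ht1].
  exists (Rmax 1 t1); intros x y t Hr Ht.
  assert (H1 := Rmax_l 1 t1); assert (H2 := Rmax_r 1 t1).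
  replace (pdiff i j (remainder N t) x y) with
    (partial_derive i j (fun u v => G u v t) x y -
     sum_n_m (fun k => Rpower t (- (INR k / INR q)) * partial_derive i j (Gk k) x y) 1 N).
  { apply Ht1; lra. }
  clear Ht1; induction N as [| N IH].
  - rewrite sum_n_m_zero by lia; rewrite partial_derive_pdiff.
    apply (Rminus_0_r (pdiff i j (fun u v => G u v t) x y)).
  - rewrite sum_n_Sm by lia; rewrite pdiff_remainder_S, <- IH, partial_derive_pdiff by lra.
    rewrite (partial_derive_pdiff i j (Gk (S N))); change plus with Rplus; ring.
Qed.

(** Once the coefficients before order N are known to vanish at the origin, t^(N/q) times the
    remainder there is minus the N-th coefficient, independent of t; being o(1), it is 0. *)
Lemma coefficient_zero (i j : nat) :
  (forall t, 0 < t -> pdiff i j (fun x y => G x y t) 0 0 = 0) ->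
  forall N, (forall k, (1 <= k <= N)%nat -> pdiff i j (Gk k) 0 0 = 0) /\
    (forall t, 0 < t -> pdiff i j (remainder N t) 0 0 = 0).
Proof.
  intros H0 N; induction N as [| N [IH IH']].
  - split; [intros k Hk; lia | exact H0].
  - assert (Hz : pdiff i j (Gk (S N)) 0 0 = 0).
    { apply NNPP; intros Hne.
      destruct (remainder_vanishes (S N) i j 0 (Rabs (pdiff i j (Gk (S N)) 0 0))) as [t1 Ht1];
        [now apply Rabs_pos_lt |].
      assert (H1 := Rmax_l 1 t1); assert (H2 := Rmax_r 1 t1).
      specialize (Ht1 0 0 (Rmax 1 t1)); rewrite pdiff_remainder_S, IH' in Ht1 by lra.
      replace (Rpower (Rmax 1 t1) (INR (S N) / INR q) *
        (0 - Rpower (Rmax 1 t1) (- (INR (S N) / INR q)) * pdiff i j (Gk (S N)) 0 0))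
        with (- (Rpower (Rmax 1 t1) (INR (S N) / INR q) * Rpower (Rmax 1 t1) (- (INR (S N) / INR q)))
              * pdiff i j (Gk (S N)) 0 0) in Ht1 by ring.
      rewrite Rpower_inv_mult, <- Ropp_mult_distr_l, Rmult_1_l, Rabs_Ropp in Ht1.
      apply (Rlt_irrefl (Rabs (pdiff i j (Gk (S N)) 0 0))), Ht1; auto.
      unfold rad; replace (0 ^ 2 + 0 ^ 2) with 0 by ring; rewrite sqrt_0; lra. }
    split.
    + intros k Hk; destruct (Nat.eq_dec k (S N)) as [-> | Hne]; auto; apply IH; lia.
    + intros t Ht; rewrite pdiff_remainder_S, Hz, IH' by auto; ring.
Qed.

(** The factor [nm x y] comes from vanishing at the origin and from the expansions of the two next
    derivatives; termwise differentiability in (x,y) enters here. *)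
Lemma remainder_small (i j N : nat) (R0 eta : R) : 0 < eta ->
  (forall t, 0 < t -> pdiff i j (fun x y => G x y t) 0 0 = 0) ->
  exists t1, 1 <= t1 /\ forall x y t, t1 <= t -> inbox R0 x y ->
    Rabs (pdiff i j (remainder N t) x y) <= eta * Rpower t (- (INR N / INR q)) * nm x y.
Proof.
  intros He H0.
  destruct (remainder_vanishes N (S i) j (2 * R0) eta He) as [t1 Ht1].
  destruct (remainder_vanishes N i (S j) (2 * R0) eta He) as [t2 Ht2].
  exists (Rmax 1 (Rmax t1 t2)); split; [apply Rmax_l |]; intros x y t Ht Hb.
  bounds_of (Rmax 1 (Rmax t1 t2)) (Rmax 1 (Rmax t1 t2)).
  assert (Htp : 0 < t) by lra.
  assert (Hw : forall z, Rabs (Rpower t (INR N / INR q) * z) < eta ->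
    Rabs z <= eta * Rpower t (- (INR N / INR q))).
  { intros z Hz.
    replace z with (Rpower t (INR N / INR q) * Rpower t (- (INR N / INR q)) * z)
      by (rewrite Rpower_inv_mult; ring).
    replace (Rpower t (INR N / INR q) * Rpower t (- (INR N / INR q)) * z)
      with (Rpower t (INR N / INR q) * z * Rpower t (- (INR N / INR q))) by ring.
    apply Rabs_mult_le; [lra |]; rewrite Rabs_pos_eq; [lra |].
    left; apply exp_pos. }
  apply (smooth2_vanish _ R0); auto.
  - now apply pdiff_smooth2, remainder_smooth2.
  - now apply (coefficient_zero i j H0 N).
  - intros u v Huv; apply inbox_rad in Huv; rewrite d_y_pdiff by now apply remainder_smooth2.
    split; apply Hw; [apply Ht1 | apply Ht2]; lra.
Qed.

End Expansion.

Lemma smooth3_bounded (G : R -> R -> R -> R) (R0 tau0 t1 M1 : R) :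
  smooth3 G -> 0 < tau0 ->
  (forall x y t, t1 <= t -> inbox R0 x y -> Rabs (G x y t) <= M1) ->
  exists M, 0 < M /\ forall x y t, tau0 <= t -> inbox R0 x y -> Rabs (G x y t) <= M.
Proof.
  intros HG Htau Hlate.
  destruct (continuous_bounded3 G R0 tau0 t1) as [M [HM HM']].
  { intros x y t Ht; apply smooth3_cont; auto; lra. }
  exists (M + Rabs M1); split; [assert (H := Rabs_pos M1); lra |].
  intros x y t Ht Hb; assert (H := Rabs_pos M1); assert (H' := Rle_abs M1).
  destruct (Rle_dec t t1) as [Hle | Hgt].
  - specialize (HM' x y t Hb (conj Ht Hle)); lra.
  - specialize (Hlate x y t); enough (Rabs (G x y t) <= M1) by lra; apply Hlate; auto; lra.
Qed.

Arguments F_smooth {_ _ _ _ _ _ _ _ _ _} _.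
Arguments H0_smooth {_ _ _ _ _ _ _ _ _ _} _.
Arguments Hk_smooth {_ _ _ _ _ _ _ _ _ _} _.
Arguments Fk_smooth {_ _ _ _ _ _ _ _ _ _} _.
Arguments H_expansion {_ _ _ _ _ _ _ _ _ _} _.
Arguments F_expansion {_ _ _ _ _ _ _ _ _ _} _.
Arguments origin_isolated {_ _ _ _ _ _ _ _ _ _} _.
Arguments H0_quadratic {_ _ _ _ _ _ _ _ _ _} _.
Arguments E0_pos {_ _ _ _ _ _ _ _ _ _} _.
Arguments level_closed {_ _ _ _ _ _ _ _ _ _} _.
Arguments orbit_solution {_ _ _ _ _ _ _ _ _ _} _.
Arguments orbit_level {_ _ _ _ _ _ _ _ _ _} _.
Arguments orbit_period {_ _ _ _ _ _ _ _ _ _} _.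
Arguments equilibrium {_ _ _ _ _ _ _ _ _ _} _.

(** * The perturbed system: uniform bounds and limits of its field *)

Section Perturbed.

Variables (H F : R -> R -> R -> R) (H0 : R -> R -> R) (Hk Fk : nat -> R -> R -> R) (q : nat)
  (E0 : R) (x0 y0 : R -> R -> R) (omega : R -> R).
Hypothesis Hstd : standing_assumptions H F H0 Hk Fk q E0 x0 y0 omega.

Definition dH (x y t : R) : R := H x y t - H0 x y.

Lemma dH_lin (t : R) : (fun x y => dH x y t) = (fun x y => 1 * H x y t + (- 1) * H0 x y).
Proof. extensionality x; extensionality y; unfold dH; ring. Qed.

Lemma dH_smooth2 (t : R) : 0 < t -> smooth2 (fun x y => dH x y t).
Proof.
  intros Ht; rewrite dH_lin; apply (smooth2_lin (fun x y => H x y t) H0); [| apply Hstd].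
  apply smooth3_slice; auto; apply Hstd.
Qed.

Lemma pdiff_dH (i j : nat) (x y t : R) : 0 < t ->
  pdiff i j (fun u v => dH u v t) x y = pdiff i j (fun u v => H u v t) x y - pdiff i j H0 x y.
Proof.
  intros Ht; rewrite dH_lin, (pdiff_lin i j (fun x y => H x y t) H0).
  - ring.
  - apply smooth3_slice; auto; apply Hstd.
  - apply Hstd.
Qed.

Lemma dH_grad_zero (t : R) : 0 < t ->
  pdiff 1 0 (fun u v => dH u v t) 0 0 = 0 /\ pdiff 0 1 (fun u v => dH u v t) 0 0 = 0.
Proof.
  intros Ht; rewrite !pdiff_dH by auto.
  destruct (equilibrium Hstd t Ht) as [Hx [Hy _]].
  destruct (origin_isolated Hstd) as [Hx0 [Hy0 _]].
  change (d_x (fun u v => H u v t) 0 0 - d_x H0 0 0 = 0 /\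
    d_y (fun u v => H u v t) 0 0 - d_y H0 0 0 = 0).
  rewrite Hx, Hy, Hx0, Hy0; lra.
Qed.

(** At order 0 the sum is empty and the weight is 1, so the expansion is mere convergence of
    derivatives; this bounds late times, and compactness bounds the others. *)
Lemma H_pdiff_bounded (i j : nat) (R0 tau0 : R) : 0 < tau0 ->
  exists M, 0 < M /\ forall x y t, tau0 <= t -> inbox R0 x y ->
    Rabs (pdiff i j (fun u v => H u v t) x y) <= M.
Proof.
  intros Htau.
  destruct (continuous_bounded2 (pdiff i j H0) R0) as [M [HM HM']].
  { intros; apply smooth2_cont, pdiff_smooth2, Hstd. }
  destruct (H_expansion Hstd 0%nat i j (2 * R0) 1 Rlt_0_1) as [t1 Ht1].
  apply (smooth3_bounded (fun x y t => pdiff i j (fun u v => H u v t) x y) R0 tau0 (Rmax 1 t1) (M + 1));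
    auto; [apply pdiff_smooth3, Hstd |].
  intros x y t Ht Hb; assert (Hl := Rmax_l 1 t1); assert (Hr := Rmax_r 1 t1).
  specialize (HM' x y Hb); specialize (Ht1 x y t (inbox_rad _ _ _ Hb) ltac:(lra)).
  rewrite sum_n_m_zero, partial_derive_pdiff in Ht1 by lia.
  change (fun u v => H u v t - H0 u v) with (fun u v => dH u v t) in Ht1.
  rewrite pdiff_dH in Ht1 by lra; change zero with 0 in Ht1; simpl INR in Ht1.
  unfold Rdiv in Ht1; rewrite Rmult_0_l, Rpower_O, Rmult_1_l, Rminus_0_r in Ht1 by lra.
  apply Rabs_lt_between in Ht1; apply Rabs_le_between in HM'; apply Rabs_le; lra.
Qed.

Lemma F_pdiff_bounded (i j : nat) (R0 tau0 : R) : 0 < tau0 ->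
  exists M, 0 < M /\ forall x y t, tau0 <= t -> inbox R0 x y ->
    Rabs (pdiff i j (fun u v => F u v t) x y) <= M.
Proof.
  intros Htau.
  destruct (F_expansion Hstd 0%nat i j (2 * R0) 1 Rlt_0_1) as [t1 Ht1].
  apply (smooth3_bounded (fun x y t => pdiff i j (fun u v => F u v t) x y) R0 tau0 (Rmax 1 t1) 1);
    auto; [apply pdiff_smooth3, Hstd |].
  intros x y t Ht Hb; assert (Hl := Rmax_l 1 t1); assert (Hr := Rmax_r 1 t1).
  specialize (Ht1 x y t (inbox_rad _ _ _ Hb) ltac:(lra)).
  rewrite sum_n_m_zero, partial_derive_pdiff in Ht1 by lia.
  change zero with 0 in Ht1; simpl INR in Ht1.
  unfold Rdiv in Ht1; rewrite Rmult_0_l, Rpower_O, Rmult_1_l, Rminus_0_r in Ht1 by lra.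
  lra.
Qed.

Definition vf1 (x y t : R) : R := d_y (fun u v => H u v t) x y.
Definition vf2 (x y t : R) : R := - d_x (fun u v => H u v t) x y + F x y t.

Lemma vf_continuous (x y t : R) : 0 < t ->
  continuous3 vf1 x y t /\
  continuous3 vf2 x y t.
Proof.
  intros Ht; split.
  - apply (smooth3_cont (fun x y t => d_y (fun u v => H u v t) x y)); auto.
    apply smooth3_dy, Hstd.
  - apply continuous_Rplus.
    + apply continuous_Ropp.
      apply (smooth3_cont (fun x y t => d_x (fun u v => H u v t) x y)); auto.
      apply smooth3_dx, Hstd.
    + apply (smooth3_cont F); auto; apply Hstd.
Qed.

(** One constant serves all [t >= tau0]; Picard iteration on an unbounded time interval needs
    this. *)
Lemma vf_lipschitz (R0 tau0 : R) : 0 < tau0 ->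
  exists K, 0 < K /\ forall x y x' y' t, tau0 <= t -> inbox R0 x y -> inbox R0 x' y' ->
    Rabs (vf1 x y t - vf1 x' y' t) <= K * nm (x - x') (y - y') /\
    Rabs (vf2 x y t - vf2 x' y' t) <= K * nm (x - x') (y - y').
Proof.
  intros Htau.
  destruct (H_pdiff_bounded 2 0 R0 tau0 Htau) as [M1 [HM1 B1]].
  destruct (H_pdiff_bounded 1 1 R0 tau0 Htau) as [M2 [HM2 B2]].
  destruct (H_pdiff_bounded 0 2 R0 tau0 Htau) as [M3 [HM3 B3]].
  destruct (F_pdiff_bounded 1 0 R0 tau0 Htau) as [M4 [HM4 B4]].
  destruct (F_pdiff_bounded 0 1 R0 tau0 Htau) as [M5 [HM5 B5]].
  exists (M1 + M2 + M3 + M4 + M5); split; [lra |].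
  intros x y x' y' t Ht Hb Hb'; assert (Htp : 0 < t) by lra.
  assert (HS : smooth2 (fun u v => H u v t)) by (apply smooth3_slice; auto; apply Hstd).
  assert (FS : smooth2 (fun u v => F u v t)) by (apply smooth3_slice; auto; apply Hstd).
  assert (Hy : Rabs (vf1 x y t - vf1 x' y' t) <= (M2 + M3) * nm (x - x') (y - y')).
  { apply (smooth2_lipschitz (d_y (fun u v => H u v t)) R0); auto; [now apply smooth2_dy |].
    intros u v Huv; specialize (B2 u v t Ht Huv); specialize (B3 u v t Ht Huv).
    split; [apply Rle_trans with M2; [exact B2 | lra] | apply Rle_trans with M3; [exact B3 | lra]]. }
  assert (Hx : Rabs (d_x (fun u v => H u v t) x y - d_x (fun u v => H u v t) x' y') <=
    (M1 + M2) * nm (x - x') (y - y')).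
  { apply (smooth2_lipschitz (d_x (fun u v => H u v t)) R0); auto; [now apply smooth2_dx |].
    intros u v Huv; specialize (B1 u v t Ht Huv); specialize (B2 u v t Ht Huv).
    split; [apply Rle_trans with M1; [exact B1 | lra] |].
    rewrite <- smooth2_schwarz by auto; apply Rle_trans with M2; [exact B2 | lra]. }
  assert (HF : Rabs (F x y t - F x' y' t) <= (M4 + M5) * nm (x - x') (y - y')).
  { apply (smooth2_lipschitz (fun u v => F u v t) R0); auto.
    intros u v Huv; specialize (B4 u v t Ht Huv); specialize (B5 u v t Ht Huv).
    split; [apply Rle_trans with M4; [exact B4 | lra] | apply Rle_trans with M5; [exact B5 | lra]]. }
  assert (Hn := nm_pos (x - x') (y - y')).
  split.
  - eapply Rle_trans; [exact Hy |]; apply Rmult_le_compat_r; lra.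
  - apply Rle_trans with ((M1 + M2 + M4 + M5) * nm (x - x') (y - y'));
      [| apply Rmult_le_compat_r; lra].
    unfold vf2; apply Rabs_le_between in Hx; apply Rabs_le_between in HF; apply Rabs_le; lra.
Qed.

Lemma vf_zero (t : R) : 0 < t -> vf1 0 0 t = 0 /\ vf2 0 0 t = 0.
Proof.
  intros Ht; destruct (equilibrium Hstd t Ht) as [Hx [Hy HF]].
  unfold vf1, vf2; rewrite Hx, Hy, HF; lra.
Qed.

Lemma dH_remainder_small (i j N : nat) (R0 eta : R) : 0 < eta -> 
  (i, j) = (1, 0)%nat \/ (i, j) = (0, 1)%nat ->
  exists t1, 1 <= t1 /\ forall x y t, t1 <= t -> inbox R0 x y ->
    Rabs (pdiff i j (remainder q dH Hk N t) x y) <= eta * Rpower t (- (INR N / INR q)) * nm x y.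
Proof.
  intros He Hij; apply (remainder_small q dH Hk dH_smooth2 (Hk_smooth Hstd) (H_expansion Hstd)); auto.
  intros t Ht; destruct Hij as [[= -> ->] | [= -> ->]]; now apply dH_grad_zero.
Qed.

Lemma F_remainder_small (N : nat) (R0 eta : R) : 0 < eta ->
  exists t1, 1 <= t1 /\ forall x y t, t1 <= t -> inbox R0 x y ->
    Rabs (remainder q F Fk N t x y) <= eta * Rpower t (- (INR N / INR q)) * nm x y.
Proof.
  intros He.
  apply (remainder_small q F Fk (fun t => smooth3_slice F t (F_smooth Hstd)) (Fk_smooth Hstd)
    (F_expansion Hstd) 0 0); auto.
  intros t Ht; apply (equilibrium Hstd t Ht).
Qed.

Lemma grad_limit (R0 eta : R) : 0 < eta ->
  exists t1, 1 <= t1 /\ forall x y t, t1 <= t -> inbox R0 x y ->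
    Rabs (d_x (fun u v => H u v t) x y - d_x H0 x y) <= eta * nm x y /\
    Rabs (d_y (fun u v => H u v t) x y - d_y H0 x y) <= eta * nm x y /\
    Rabs (F x y t) <= eta * nm x y.
Proof.
  intros He.
  destruct (dH_remainder_small 1 0 0 R0 eta He ltac:(tauto)) as [t1 [Ht1 B1]].
  destruct (dH_remainder_small 0 1 0 R0 eta He ltac:(tauto)) as [t2 [Ht2 B2]].
  destruct (F_remainder_small 0 R0 eta He) as [t3 [Ht3 B3]].
  exists (Rmax t1 (Rmax t2 t3)).
  bounds_of (Rmax t1 (Rmax t2 t3)) (Rmax t1 (Rmax t2 t3)).
  split; [lra |]; intros x y t Ht Hb.
  specialize (B1 x y t ltac:(lra) Hb); specialize (B2 x y t ltac:(lra) Hb);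
    specialize (B3 x y t ltac:(lra) Hb).
  simpl INR in *; unfold Rdiv in *.
  rewrite Rmult_0_l, Ropp_0, Rpower_O, Rmult_1_r in B1, B2, B3 by lra.
  change (remainder q dH Hk 0 t) with (fun u v => dH u v t) in B1, B2.
  rewrite pdiff_dH in B1, B2 by lra.
  repeat split; assumption.
Qed.

Lemma vf_limit (R0 eta : R) : 0 < eta ->
  exists t1, 1 <= t1 /\ forall x y t, t1 <= t -> inbox R0 x y ->
    Rabs (vf1 x y t - d_y H0 x y) <= eta * nm x y /\
    Rabs (vf2 x y t - - d_x H0 x y) <= eta * nm x y.
Proof.
  intros He; destruct (grad_limit R0 (eta / 2)) as [t1 [Ht1 B]]; [lra |].
  exists t1; split; auto; intros x y t Ht Hb; destruct (B x y t Ht Hb) as [B1 [B2 B3]].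
  assert (Hn := nm_pos x y); unfold vf1, vf2; split; [nra |].
  apply Rabs_le_between in B1; apply Rabs_le_between in B3; apply Rabs_le; nra.
Qed.

(** * The truncated energy *)

(* [H] itself cannot serve as energy: its expansion is not differentiable in [t]. *)
Fixpoint energy (N : nat) (t x y : R) : R :=
  match N with
  | O => H0 x y
  | S N' => 1 * energy N' t x y +
      Rpower t (- (INR N / INR q)) * (1 * Hk N x y + (- Hk N 0 0) * 1)
  end.

Fixpoint energy_dt (N : nat) (t x y : R) : R :=
  match N with
  | O => 0
  | S N' => energy_dt N' t x y +
      - (INR N / INR q) * Rpower t (- (INR N / INR q) - 1) * (Hk N x y - Hk N 0 0)
  end.

Lemma energy_dt_S (N : nat) (t x y : R) :
  energy_dt (S N) t x y = energy_dt N t x y +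
    - (INR (S N) / INR q) * Rpower t (- (INR (S N) / INR q) - 1) * (Hk (S N) x y - Hk (S N) 0 0).
Proof. reflexivity. Qed.

Lemma energy_S (N : nat) (t x y : R) :
  energy (S N) t x y = 1 * energy N t x y +
    Rpower t (- (INR (S N) / INR q)) * (1 * Hk (S N) x y + (- Hk (S N) 0 0) * 1).
Proof. reflexivity. Qed.

Lemma Hk_shift_smooth2 (k : nat) : (1 <= k)%nat ->
  smooth2 (fun x y => 1 * Hk k x y + (- Hk k 0 0) * 1).
Proof.
  intros Hk1; apply (smooth2_lin (Hk k) (fun _ _ => 1)); [now apply Hstd | apply smooth2_const].
Qed.

Lemma energy_smooth2 (N : nat) (t : R) : smooth2 (energy N t).
Proof.
  induction N as [| N IH]; [apply Hstd |].
  apply (smooth2_lin (energy N t) _ 1 _ IH (Hk_shift_smooth2 (S N) ltac:(lia))).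
Qed.

(** The truncated energy and [H] differ by the remainder up to a function of time. In the Poisson
    bracket of the energy with [H] only the gradient of the remainder survives. *)
Lemma energy_grad (N : nat) (t x y : R) : 0 < t ->
  d_x (energy N t) x y = d_x (fun u v => H u v t) x y - pdiff 1 0 (remainder q dH Hk N t) x y /\
  d_y (energy N t) x y = d_y (fun u v => H u v t) x y - pdiff 0 1 (remainder q dH Hk N t) x y.
Proof.
  intros Ht; induction N as [| N [IHx IHy]].
  - change (remainder q dH Hk 0 t) with (fun u v => dH u v t); rewrite !pdiff_dH by auto.
    change (d_x H0 x y = d_x (fun u v => H u v t) x y -
        (d_x (fun u v => H u v t) x y - d_x H0 x y) /\
      d_y H0 x y = d_y (fun u v => H u v t) x y -
        (d_y (fun u v => H u v t) x y - d_y H0 x y)).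
    split; ring.
  - assert (HkS : smooth2 (Hk (S N))) by (apply Hstd; lia).
    rewrite !pdiff_remainder_S; auto; try apply dH_smooth2; try apply Hstd.
    assert (Es : energy (S N) t = (fun u v => 1 * energy N t u v +
      Rpower t (- (INR (S N) / INR q)) * (1 * Hk (S N) u v + - Hk (S N) 0 0 * 1))) by reflexivity.
    rewrite Es, (d_x_lin (energy N t) (fun u v => 1 * Hk (S N) u v + - Hk (S N) 0 0 * 1)),
      (d_y_lin (energy N t) (fun u v => 1 * Hk (S N) u v + - Hk (S N) 0 0 * 1));
      try apply energy_smooth2; try (apply Hk_shift_smooth2; lia).
    rewrite IHx, IHy.
    rewrite (d_x_lin (Hk (S N)) (fun _ _ => 1)), (d_y_lin (Hk (S N)) (fun _ _ => 1));
      auto using smooth2_const.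
    assert (C1 : d_x (fun _ _ => 1) x y = 0) by exact (Derive_const 1 x).
    assert (C2 : d_y (fun _ _ => 1) x y = 0) by exact (Derive_const 1 y).
    rewrite C1, C2.
    change (pdiff 1 0 (Hk (S N)) x y) with (d_x (Hk (S N)) x y).
    change (pdiff 0 1 (Hk (S N)) x y) with (d_y (Hk (S N)) x y).
    split; ring.
Qed.

Lemma energy_chain (N : nat) (x y : R -> R) (t dx dy : R) :
  0 < t -> is_derive x t dx -> is_derive y t dy ->
  is_derive (fun s => energy N s (x s) (y s)) t
    (d_x (energy N t) (x t) (y t) * dx + d_y (energy N t) (x t) (y t) * dy +
     energy_dt N t (x t) (y t)).
Proof.
  intros Ht Hx Hy; induction N as [| N IH].
  - eapply is_derive_eq; [apply (smooth2_chain H0 x y t dx dy); auto; apply Hstd |].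
    change (energy 0 t) with H0; change (energy_dt 0 t (x t) (y t)) with 0; ring.
  - assert (HkS := Hk_shift_smooth2 (S N) ltac:(lia)).
    assert (Hw : is_derive (fun s => Rpower s (- (INR (S N) / INR q))) t
      (- (INR (S N) / INR q) * Rpower t (- (INR (S N) / INR q) - 1)))
      by (apply is_derive_Reals; now apply derivable_pt_lim_power).
    assert (Es : energy (S N) t = (fun u v => 1 * energy N t u v +
      Rpower t (- (INR (S N) / INR q)) * (1 * Hk (S N) u v + - Hk (S N) 0 0 * 1))) by reflexivity.
    eapply is_derive_eq.
    + apply is_derive_Rplus; [apply is_derive_Rscal, IH |].
      apply is_derive_Rmult; [exact Hw |].
      exact (smooth2_chain _ x y t dx dy HkS Hx Hy).
    + rewrite Es, (d_x_lin (energy N t) (fun u v => 1 * Hk (S N) u v + - Hk (S N) 0 0 * 1)),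
        (d_y_lin (energy N t) (fun u v => 1 * Hk (S N) u v + - Hk (S N) 0 0 * 1));
        auto using energy_smooth2.
      rewrite energy_dt_S; ring.
Qed.

(** Preservation of the equilibrium forces a critical point of each [Hk] at the origin. *)
Lemma Hk_quadratic (k : nat) (R0 : R) : (1 <= k)%nat ->
  exists C, 0 < C /\ forall x y, inbox R0 x y ->
    Rabs (Hk k x y - Hk k 0 0) <= C * (nm x y * nm x y).
Proof.
  intros Hk1; apply smooth2_vanish_quadratic; [now apply Hstd | |].
  - apply (coefficient_zero q dH Hk dH_smooth2 (Hk_smooth Hstd)
      (H_expansion Hstd) 1 0 (fun t Ht => proj1 (dH_grad_zero t Ht)) k).
    lia.
  - apply (coefficient_zero q dH Hk dH_smooth2 (Hk_smooth Hstd)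
      (H_expansion Hstd) 0 1 (fun t Ht => proj2 (dH_grad_zero t Ht)) k).
    lia.
Qed.

Lemma q_R_pos : 0 < INR q.
Proof. apply lt_0_INR, Hstd. Qed.

(** The slowest correction is of order t^(-1/q), and differentiation in time gains a factor 1/t.
    Removing the constants [Hk k 0 0] is what makes both bounds quadratic. *)
Lemma energy_close (N : nat) (R0 : R) :
  exists C, 0 < C /\ forall x y t, 1 <= t -> inbox R0 x y ->
    Rabs (energy N t x y - H0 x y) <= C * Rpower t (- (1 / INR q)) * (nm x y * nm x y) /\
    Rabs (energy_dt N t x y) <= C * Rpower t (- (1 / INR q)) * / t * (nm x y * nm x y).
Proof.
  assert (Hq := q_R_pos).
  induction N as [| N [C [HC IH]]].
  - exists 1; split; [lra |]; intros x y t Ht Hb; simpl.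
    rewrite Rminus_diag, Rabs_R0.
    assert (Hp : 0 < Rpower t (- (1 / INR q))) by apply exp_pos.
    assert (Hn := nm_pos x y).
    assert (Hi : 0 < / t) by (apply Rinv_0_lt_compat; lra).
    split; repeat apply Rmult_le_pos; lra.
  - destruct (Hk_quadratic (S N) R0) as [C' [HC' B]]; [lia |].
    assert (HNq : 0 < INR (S N) / INR q) by (apply Rdiv_lt_0_compat; auto; apply lt_0_INR; lia).
    assert (H1q : 1 / INR q <= INR (S N) / INR q).
    { apply Rmult_le_compat_r; [left; now apply Rinv_0_lt_compat |].
      apply (le_INR 1); lia. }
    exists (C + C' + INR (S N) / INR q * C'); split.
    { assert (0 < INR (S N) / INR q * C') by now apply Rmult_lt_0_compat. lra. }
    intros x y t Ht Hb; destruct (IH x y t Ht Hb) as [I1 I2]; specialize (B x y Hb).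
    set (r := nm x y * nm x y) in *.
    assert (Hr : 0 <= r) by (unfold r; assert (Hn := nm_pos x y); nra).
    set (p := Rpower t (- (1 / INR q))) in *.
    set (w := Rpower t (- (INR (S N) / INR q))) in *.
    assert (Hw : 0 < w) by apply exp_pos.
    assert (Hwp : w <= p) by (apply Rpower_neg_le; auto).
    assert (Hi : 0 < / t) by (apply Rinv_0_lt_compat; lra).
    assert (Hpr : 0 <= p * r) by (apply Rmult_le_pos; lra).
    split.
    + assert (E : energy (S N) t x y - H0 x y =
        (energy N t x y - H0 x y) + w * (Hk (S N) x y - Hk (S N) 0 0))
        by (unfold w; rewrite energy_S; ring).
      rewrite E; triangle.
      assert (Hm : Rabs (w * (Hk (S N) x y - Hk (S N) 0 0)) <= p * (C' * r)).
      { apply Rabs_mult_le; auto; rewrite Rabs_pos_eq; lra. }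
      assert (0 <= INR (S N) / INR q * C' * (p * r)) by (apply Rmult_le_pos; [nra | auto]).
      nra.
    + assert (Ew : Rpower t (- (INR (S N) / INR q) - 1) = w * / t).
      { unfold Rminus; rewrite Rpower_plus, (Rpower_Ropp t 1), Rpower_1 by lra; reflexivity. }
      rewrite energy_dt_S, Ew.
      triangle.
      assert (Hm : Rabs (- (INR (S N) / INR q) * (w * / t) * (Hk (S N) x y - Hk (S N) 0 0)) <=
        INR (S N) / INR q * (p * / t) * (C' * r)).
      { apply Rabs_mult_le; auto; apply Rabs_mult_le.
        - rewrite Rabs_Ropp, Rabs_pos_eq; lra.
        - apply Rabs_mult_le; rewrite Rabs_pos_eq; lra. }
      assert (Hpr2 : 0 <= p * / t * r) by (apply Rmult_le_pos; [nra | auto]).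
      nra.
Qed.

Variable n : nat.
Hypothesis Hn : (1 <= n <= q)%nat.
Hypothesis HFi : forall i : nat, (1 <= i < n)%nat -> forall x y : R, Fk i x y = 0.

Definition wt (t : R) : R := Rpower t (- (INR n / INR q)).
(** Coefficient of t^(-n/q) in the rate of change of the energy along solutions. *)
Definition gain (x y : R) : R := d_y H0 x y * Fk n x y.
Definition energy_rate (x y t : R) : R :=
  d_x (energy n t) x y * vf1 x y t + d_y (energy n t) x y * vf2 x y t + energy_dt n t x y.

Lemma wt_pos (t : R) : 0 < wt t.
Proof. apply exp_pos. Qed.

Lemma exponent_bounds : 0 <= INR n / INR q <= 1.
Proof.
  assert (Hq := q_R_pos); split.
  - apply Rmult_le_pos; [apply pos_INR | left; now apply Rinv_0_lt_compat].
  - apply Rle_div_l; auto; rewrite Rmult_1_l; apply le_INR; lia.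
Qed.

(** A main use of [n <= q]: the drift is not integrable in time, and terms o(1/t) from the explicit
    time dependence are o([wt t]). *)
Lemma inv_le_wt (t : R) : 1 <= t -> / t <= wt t.
Proof.
  intros Ht; rewrite <- (Rpower_1 t) at 1 by lra; rewrite <- Rpower_Ropp.
  apply Rpower_neg_le; auto; apply exponent_bounds.
Qed.

Lemma F_leading (R0 eta : R) : 0 < eta ->
  exists t1, 1 <= t1 /\ forall x y t, t1 <= t -> inbox R0 x y ->
    Rabs (F x y t - wt t * Fk n x y) <= eta * wt t * nm x y.
Proof.
  intros He.
  destruct (F_remainder_small n R0 eta He) as [t1 [Ht1 B]].
  exists t1; split; auto; intros x y t Ht Hb; specialize (B x y t Ht Hb).
  change (Rabs (remainder q F Fk n t x y) <= eta * wt t * nm x y) in B.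
  (* The coefficients before [n] vanish identically, so subtracting them changes nothing. *)
  assert (Hlow : forall m, (m < n)%nat -> remainder q F Fk m t x y = F x y t).
  { induction m as [| m IH]; intros Hm; [reflexivity |].
    simpl remainder; rewrite IH by lia; rewrite HFi by lia; ring. }
  unfold wt in *; destruct n as [| m]; [lia |].
  simpl remainder in B; rewrite Hlow in B by lia.
  match type of B with Rabs ?a <= _ => match goal with |- Rabs ?b <= _ => replace b with a by
    (change (match m with 0%nat => 1 | S _ => INR m + 1 end) with (INR (S m)); ring) end end.
  exact B.
Qed.

Lemma energy_limit (R0 eta : R) : 0 < eta ->
  exists t1, 1 <= t1 /\ forall x y t, t1 <= t -> inbox R0 x y ->
    Rabs (energy n t x y - H0 x y) <= eta * (nm x y * nm x y).
Proof.
  intros He; destruct (energy_close n R0) as [C [HC B]].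
  destruct (Rpower_neg_small (1 / INR q) (eta / C)) as [t1 [Ht1 Hs]];
    [apply Rdiv_lt_0_compat; [lra | apply q_R_pos] | now apply Rdiv_lt_0_compat |].
  exists t1; split; auto; intros x y t Ht Hb.
  destruct (B x y t ltac:(lra) Hb) as [B1 _]; specialize (Hs t Ht).
  eapply Rle_trans; [exact B1 |].
  apply Rmult_le_compat_r; [assert (Hnn := nm_pos x y); nra |].
  apply Rmult_le_compat_l with (r := C) in Hs; [| lra].
  replace (C * (eta / C)) with eta in Hs by (field; lra); exact Hs.
Qed.

Lemma F0_zero : Fk n 0 0 = 0.
Proof.
  apply (coefficient_zero q F Fk
    (fun t Ht => smooth3_slice F t (F_smooth Hstd) Ht)
    (Fk_smooth Hstd) (F_expansion Hstd) 0 0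
    (fun t Ht => proj2 (proj2 (equilibrium Hstd t Ht))) n); lia.
Qed.

(** Every product in the rate has two factors that are O(r), r being [nm x y]; hence an error
    relative to r^2 rather than a merely uniform one. *)
Lemma energy_rate_leading (R0 eta : R) : 0 < eta ->
  exists t1, 1 <= t1 /\ forall x y t, t1 <= t -> inbox R0 x y ->
    Rabs (energy_rate x y t - wt t * gain x y) <= eta * wt t * (nm x y * nm x y).
Proof.
  intros He.
  destruct (origin_isolated Hstd) as [Hx0 [Hy0 _]].
  assert (HS := H0_smooth Hstd).
  destruct (smooth2_vanish_linear (d_x H0) R0 (smooth2_dx _ HS) Hx0) as [C1 [HC1 B1]].
  destruct (smooth2_vanish_linear (d_y H0) R0 (smooth2_dy _ HS) Hy0) as [C2 [HC2 B2]].
  destruct (smooth2_vanish_linear (Fk n) R0) as [C3 [HC3 B3]];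
    [apply Hstd; lia | apply F0_zero |].
  (* Exceeds the sum of the constants in the estimates of the five error terms below. *)
  set (A := 10 + 2 * C1 + 5 * C2 + 5 * C3).
  set (e := Rmin 1 (eta / A)).
  assert (HA : 0 < A) by (unfold A; lra).
  assert (Hep : 0 < e) by (apply Rmin_pos; [lra | now apply Rdiv_lt_0_compat]).
  assert (He1 : e <= 1) by apply Rmin_l.
  assert (HeA : e * A <= eta).
  { assert (Hr := Rmin_r 1 (eta / A)); fold e in Hr.
    apply Rmult_le_compat_r with (r := A) in Hr; [| lra].
    replace (eta / A * A) with eta in Hr by (field; lra); exact Hr. }
  destruct (grad_limit R0 e Hep) as [t1 [Ht1 G1]].
  destruct (F_leading R0 e Hep) as [t2 [Ht2 G2]].
  destruct (energy_close n R0) as [C [HC G3]].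
  destruct (Rpower_neg_small (1 / INR q) (e / C)) as [t3 [Ht3 G4]];
    [apply Rdiv_lt_0_compat; [lra | apply q_R_pos] | now apply Rdiv_lt_0_compat |].
  destruct (dH_remainder_small 1 0 n R0 e Hep ltac:(tauto)) as [t4 [Ht4 G5]].
  destruct (dH_remainder_small 0 1 n R0 e Hep ltac:(tauto)) as [t5 [Ht5 G6]].
  (* Each threshold is at least 1, so the sum dominates all of them. *)
  exists (t1 + t2 + t3 + t4 + t5); split; [lra |]; intros x y t Ht Hb.
  specialize (B1 x y Hb); specialize (B2 x y Hb); specialize (B3 x y Hb).
  destruct (G1 x y t ltac:(lra) Hb) as [G1x [G1y _]].
  specialize (G2 x y t ltac:(lra) Hb); destruct (G3 x y t ltac:(lra) Hb) as [_ G3'].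
  specialize (G4 t ltac:(lra)); specialize (G5 x y t ltac:(lra) Hb);
    specialize (G6 x y t ltac:(lra) Hb).
  fold (wt t) in G5, G6.
  destruct (energy_grad n t x y ltac:(lra)) as [Ex Ey].
  unfold energy_rate, gain, vf1, vf2; rewrite Ex, Ey.
  set (a := pdiff 1 0 (remainder q dH Hk n t) x y) in *.
  set (b := pdiff 0 1 (remainder q dH Hk n t) x y) in *.
  set (hx := d_x (fun u v => H u v t) x y) in *.
  set (hy := d_y (fun u v => H u v t) x y) in *.
  set (h0x := d_x H0 x y) in *; set (h0y := d_y H0 x y) in *.
  set (f := F x y t) in *; set (fn := Fk n x y) in *; set (r := nm x y) in *.
  set (w := wt t) in *; set (et := energy_dt n t x y) in *.
  assert (Hw : 0 < w) by apply wt_pos.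
  assert (Hr : 0 <= r) by apply nm_pos.
  assert (Hit : / t <= w) by (apply inv_le_wt; lra).
  assert (Hew : e * w <= w) by nra.
  assert (Ket : Rabs et <= e * w * (r * r)).
  { eapply Rle_trans; [exact G3' |].
    apply Rmult_le_compat_r; [nra |].
    apply Rle_trans with (e * / t).
    - apply Rmult_le_compat_r; [left; apply Rinv_0_lt_compat; lra |].
      apply Rmult_le_compat_l with (r := C) in G4; [| lra].
      replace (C * (e / C)) with e in G4 by (field; lra); exact G4.
    - apply Rmult_le_compat_l; lra. }
  assert (Khx : Rabs hx <= (C1 + 1) * r).
  { replace hx with ((hx - h0x) + h0x) by ring; triangle; nra. }
  assert (Khy : Rabs hy <= (C2 + 1) * r).
  { replace hy with ((hy - h0y) + h0y) by ring; triangle; nra. }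
  assert (Kf : Rabs f <= (C3 + 1) * (w * r)).
  { replace f with ((f - w * fn) + w * fn) by ring; triangle.
    assert (Rabs (w * fn) <= w * (C3 * r))
      by (apply Rabs_mult_le; auto; rewrite Rabs_pos_eq; lra).
    nra. }
  assert (Kb1 : Rabs (hy - b - h0y) <= (1 + w) * e * r).
  { replace (hy - b - h0y) with ((hy - h0y) + - b) by ring.
    triangle; rewrite Rabs_Ropp; nra. }
  assert (Hw1 : w <= 1).
  { unfold w, wt; rewrite <- (Rpower_O t) by lra; apply Rle_Rpower; [lra |].
    assert (Hnq := exponent_bounds); lra. }
  assert (Kb : Rabs (hy - b - h0y) <= 2 * e * r).
  { eapply Rle_trans; [exact Kb1 |]; rewrite !Rmult_assoc.
    apply Rmult_le_compat_r; [apply Rmult_le_pos; lra | lra]. }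
  (* The product [hx * hy] cancels. What is left is the bracket with the remainder gradient (a, b),
     then the replacement of the force term by its leading part, then the time derivative. *)
  replace ((hx - a) * hy + (hy - b) * (- hx + f) + et - w * (h0y * fn))
    with (((- a * hy + b * hx) + ((hy - b - h0y) * f + h0y * (f - w * fn))) + et) by ring.
  assert (P1 : Rabs (- a * hy) <= e * w * r * ((C2 + 1) * r))
    by (apply Rabs_mult_le; auto; now rewrite Rabs_Ropp).
  assert (P2 : Rabs (b * hx) <= e * w * r * ((C1 + 1) * r)) by now apply Rabs_mult_le.
  assert (P3 : Rabs ((hy - b - h0y) * f) <= 2 * e * r * ((C3 + 1) * (w * r)))
    by now apply Rabs_mult_le.
  assert (P4 : Rabs (h0y * (f - w * fn)) <= C2 * r * (e * w * r)) by now apply Rabs_mult_le.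
  assert (Hewr : 0 <= w * (r * r)) by (apply Rmult_le_pos; nra).
  apply Rle_trans with (e * A * (w * (r * r))).
  - triangle.
    eapply Rle_trans; [apply Rplus_le_compat_r, Rabs_triang |].
    eapply Rle_trans; [apply Rplus_le_compat_r, Rplus_le_compat; apply Rabs_triang |].
    apply Rle_trans with ((C2 + 1 + (C1 + 1) + 2 * (C3 + 1) + C2 + 1) * (e * (w * (r * r)))).
    + nra.
    + rewrite (Rmult_comm e A), Rmult_assoc; apply Rmult_le_compat_r; [| unfold A; lra].
      apply Rmult_le_pos; lra.
  - replace (eta * w * (r * r)) with (eta * (w * (r * r))) by ring.
    now apply Rmult_le_compat_r.
Qed.


(** * The field clamped to a box *)

(** The projection onto an interval is 1-Lipschitz, so composing with it extends Lipschitz bounds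
    from a box to the plane; solutions that remain in the box are unaffected. *)
Definition clamp (R0 u : R) : R := Rmax (Rmin u R0) (- R0).

Lemma clamp_id (R0 u : R) : Rabs u <= R0 -> clamp R0 u = u.
Proof.
  intros Hu; apply Rabs_le_between in Hu; unfold clamp, Rmin, Rmax.
  destruct (Rle_dec u R0); destruct (Rle_dec _ (- R0)); lra.
Qed.

Lemma clamp_bound (R0 u : R) : 0 <= R0 -> Rabs (clamp R0 u) <= R0.
Proof.
  intros HR; apply Rabs_le; unfold clamp, Rmin, Rmax.
  destruct (Rle_dec u R0); destruct (Rle_dec _ (- R0)); lra.
Qed.

Lemma clamp_lipschitz (R0 u v : R) : Rabs (clamp R0 u - clamp R0 v) <= Rabs (u - v).
Proof.
  unfold clamp; apply Rle_trans with (Rabs (Rmin u R0 - Rmin v R0)).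
  - generalize (Rmin u R0) (Rmin v R0); intros a b; unfold Rmax.
    destruct (Rle_dec a (- R0)), (Rle_dec b (- R0)); unfold Rabs;
      repeat destruct (Rcase_abs _); lra.
  - unfold Rmin; destruct (Rle_dec u R0), (Rle_dec v R0); unfold Rabs;
      repeat destruct (Rcase_abs _); lra.
Qed.

Lemma clamp_continuous (R0 u : R) : continuous (clamp R0) u.
Proof.
  apply continuity_pt_filterlim, continuity_pt_locally; intros eps.
  exists eps; intros v Hv; eapply Rle_lt_trans; [apply clamp_lipschitz | exact Hv].
Qed.

Lemma clamp_inbox (R0 x y : R) : 0 <= R0 -> inbox R0 (clamp R0 x) (clamp R0 y).
Proof. intros HR; split; now apply clamp_bound. Qed.

Lemma nm_clamp_lipschitz (R0 x y x' y' : R) :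
  nm (clamp R0 x - clamp R0 x') (clamp R0 y - clamp R0 y') <= nm (x - x') (y - y').
Proof. apply Rplus_le_compat; apply clamp_lipschitz. Qed.

Definition clamped_solution (R0 tau0 : R) (x y : R -> R) : Prop :=
  forall t, tau0 <= t ->
    is_derive x t (vf1 (clamp R0 (x t)) (clamp R0 (y t)) t) /\
    is_derive y t (vf2 (clamp R0 (x t)) (clamp R0 (y t)) t).

Lemma clamped_solution_unclamp (R0 tau0 t : R) (x y : R -> R) :
  clamped_solution R0 tau0 x y -> tau0 <= t -> inbox R0 (x t) (y t) ->
  is_derive x t (vf1 (x t) (y t) t) /\ is_derive y t (vf2 (x t) (y t) t).
Proof.
  intros Hz Ht [Hx Hy]; specialize (Hz t Ht); rewrite !clamp_id in Hz by auto; exact Hz.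
Qed.

Lemma clamped_solution_continuous (R0 tau0 t : R) (x y : R -> R) :
  clamped_solution R0 tau0 x y -> tau0 <= t -> continuous x t /\ continuous y t.
Proof.
  intros Hz Ht; destruct (Hz t Ht) as [Hx Hy].
  split; eapply is_derive_cont; eassumption.
Qed.

Lemma clamped_exists (R0 tau0 a b : R) : 0 <= R0 -> 0 < tau0 ->
  exists x y, x tau0 = a /\ y tau0 = b /\ clamped_solution R0 tau0 x y.
Proof.
  intros HR Htau; destruct (vf_lipschitz R0 tau0 Htau) as [K [HK HL]].
  (* Time is frozen before [tau0], since [picard_global] asks for continuity and a Lipschitz bound
     at all times. *)
  set (G1 := fun x y t => vf1 (clamp R0 x) (clamp R0 y) (Rmax t tau0)).
  set (G2 := fun x y t => vf2 (clamp R0 x) (clamp R0 y) (Rmax t tau0)).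
  assert (Hc : forall V : R -> R -> R -> R,
    (forall x y t, 0 < t -> continuous3 V x y t) ->
    forall x y t, continuous (fun p : R * R * R =>
      V (clamp R0 (fst (fst p))) (clamp R0 (snd (fst p))) (Rmax (snd p) tau0)) (x, y, t)).
  { intros V HV x y t.
    apply (continuous_uncurry3 V (fun p : R * R * R => clamp R0 (fst (fst p)))
      (fun p : R * R * R => clamp R0 (snd (fst p))) (fun p : R * R * R => Rmax (snd p) tau0)).
    - apply HV; assert (H1 := Rmax_r t tau0); simpl; lra.
    - apply (continuous_comp (fun p : R * R * R => fst (fst p)) (clamp R0));
        [| apply clamp_continuous].
      apply (continuous_comp fst fst); apply continuous_fst.
    - apply (continuous_comp (fun p : R * R * R => snd (fst p)) (clamp R0));
        [| apply clamp_continuous].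
      apply (continuous_comp fst snd); [apply continuous_fst | apply continuous_snd].
    - apply (continuous_comp snd (fun s => Rmax s tau0));
        [apply continuous_snd | apply continuous_Rmax_l]. }
  destruct (picard_global G1 G2 tau0 K a b HK) as [x [y [Hx [Hy Hd]]]].
  - intros x y t; exact (Hc vf1 (fun x y t Ht => proj1 (vf_continuous x y t Ht)) x y t).
  - intros x y t; exact (Hc vf2 (fun x y t Ht => proj2 (vf_continuous x y t Ht)) x y t).
  - intros x y x' y' t.
    destruct (HL (clamp R0 x) (clamp R0 y) (clamp R0 x') (clamp R0 y') (Rmax t tau0)
      (Rmax_r _ _) (clamp_inbox _ _ _ HR) (clamp_inbox _ _ _ HR)) as [L1 L2].
    assert (Hm : K * nm (clamp R0 x - clamp R0 x') (clamp R0 y - clamp R0 y') <=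
      K * nm (x - x') (y - y'))
      by (apply Rmult_le_compat_l; [lra | apply nm_clamp_lipschitz]).
    split; eapply Rle_trans; eassumption.
  - exists x, y; split; [exact Hx | split; [exact Hy |]].
    intros t Ht; destruct (Hd t Ht) as [D1 D2]; unfold G1, G2 in D1, D2.
    rewrite Rmax_left in D1, D2 by auto; now split.
Qed.

(** On a bounded time interval both solutions lie in a common box; there [curves_close] with
    [eta = 0] applies. *)
Lemma solution_unique (tau0 t R0 : R) (x y x' y' : R -> R) : 0 < tau0 -> tau0 <= t ->
  (forall s, tau0 <= s <= t ->
     is_derive x s (vf1 (x s) (y s) s) /\ is_derive y s (vf2 (x s) (y s) s) /\
     is_derive x' s (vf1 (x' s) (y' s) s) /\ is_derive y' s (vf2 (x' s) (y' s) s)) ->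
  x tau0 = x' tau0 -> y tau0 = y' tau0 -> x t = x' t /\ y t = y' t.
Proof.
  intros Htau Ht Hd Ex Ey.
  destruct (continuous_bounded1 (fun s => nm (x s) (y s) + nm (x' s) (y' s)) tau0 t)
    as [M [HM HMb]].
  { intros s Hs; destruct (Hd s Hs) as [D1 [D2 [D3 D4]]].
    apply continuous_Rplus; apply continuous_nm; eapply is_derive_cont; eassumption. }
  assert (Hin : forall s, tau0 <= s <= t -> inbox M (x s) (y s) /\ inbox M (x' s) (y' s)).
  { intros s Hs; specialize (HMb s Hs); apply Rabs_le_between in HMb.
    assert (H1 := nm_pos (x s) (y s)); assert (H2 := nm_pos (x' s) (y' s)).
    split; apply nm_inbox; lra. }
  destruct (vf_lipschitz M tau0 Htau) as [K [HK HL]].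
  assert (HD := curves_close x y x' y' (fun s => vf1 (x s) (y s) s) (fun s => vf2 (x s) (y s) s)
    (fun s => vf1 (x' s) (y' s) s) (fun s => vf2 (x' s) (y' s) s) K 0 tau0 t
    ltac:(lra) ltac:(lra) Ht Hd).
  cbv zeta beta in HD; rewrite Ex, Ey, !Rminus_diag in HD.
  replace ((0 * 0 + 0 * 0 + 2 * 0 * 0 * (t - tau0)) * exp ((4 * K + 2) * (t - tau0)))
    with 0 in HD by ring.
  assert (Hle : (x t - x' t) * (x t - x' t) + (y t - y' t) * (y t - y' t) <= 0).
  { apply HD; intros s Hs; rewrite !Rplus_0_r; apply HL; [lra | apply Hin; auto | apply Hin; auto]. }
  assert (S1 := Rle_0_sqr (x t - x' t)); assert (S2 := Rle_0_sqr (y t - y' t)).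
  unfold Rsqr in S1, S2.
  split; apply Rminus_diag_uniq, Rsqr_0_uniq; unfold Rsqr; lra.
Qed.

(** Reduces the stability notions to the clamped solution: if it never leaves the box it is a global
    solution, and uniqueness makes it the continuation of any local one. *)
Lemma every_solution_intro (R0 tau0 a b : R) (x y : R -> R) (P : (R -> R) -> (R -> R) -> Prop) :
  0 < tau0 -> clamped_solution R0 tau0 x y -> x tau0 = a -> y tau0 = b ->
  (forall t, tau0 <= t -> inbox R0 (x t) (y t)) -> P x y ->
  every_solution H F tau0 a b P.
Proof.
  intros Htau Hz Ex Ey Hin HP T x1 y1 [HT Hs] Ex1 Ey1.
  exists x, y; split; [| split; auto].
  - split; [exact I |]; intros t Ht _.
    exact (clamped_solution_unclamp R0 tau0 t x y Hz Ht (Hin t Ht)).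
  - intros t Ht HtT; apply (solution_unique tau0 t R0); auto; try congruence.
    intros s Hss.
    destruct (clamped_solution_unclamp R0 tau0 s x y Hz (proj1 Hss) (Hin s (proj1 Hss))) as [D1 D2].
    destruct (Hs s (proj1 Hss)) as [D3 D4]; [| exact (conj D1 (conj D2 (conj D3 D4)))].
    destruct T as [T | |]; simpl in *; auto; lra.
Qed.

(** Supplies a local solution to which an assumed stability can be applied in the proof of
    instability. *)
Lemma clamped_solution_local (R0 tau0 : R) (x y : R -> R) :
  clamped_solution R0 tau0 x y -> nm (x tau0) (y tau0) < R0 ->
  exists T : R, solution_on H F tau0 T x y.
Proof.
  intros Hz Hlt; destruct (clamped_solution_continuous R0 tau0 tau0 x y Hz (Rle_refl _)) as [Cx Cy].
  assert (Cn : continuous (fun t => nm (x t) (y t)) tau0)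
    by now apply continuous_nm.
  assert (He : 0 < R0 - nm (x tau0) (y tau0)) by lra.
  destruct (proj1 (continuity_pt_locally _ tau0) (proj2 (continuity_pt_filterlim _ tau0) Cn)
    (mkposreal _ He)) as [d Hd].
  exists (tau0 + d); split; [simpl; assert (Hp := cond_pos d); lra |].
  intros t Ht HtT; simpl in HtT.
  apply (clamped_solution_unclamp R0 tau0 t x y Hz Ht), nm_inbox.
  assert (Hb : Rabs (nm (x t) (y t) - nm (x tau0) (y tau0)) < R0 - nm (x tau0) (y tau0)).
  { apply (Hd t); change (Rabs (t - tau0) < d); apply Rabs_def1; lra. }
  apply Rabs_lt_between in Hb; lra.
Qed.

(** * Behaviour near the equilibrium *)

Lemma H0_origin : H0 0 0 = 0.
Proof.
  destruct (H0_quadratic Hstd) as [C [r [Hr B]]].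
  assert (Hrad : rad 0 0 = 0)
    by (unfold rad; replace (0 ^ 2 + 0 ^ 2) with 0 by ring; apply sqrt_0).
  specialize (B 0 0); rewrite Hrad in B; specialize (B Hr).
  replace (H0 0 0 - (0 ^ 2 + 0 ^ 2) / 2) with (H0 0 0) in B by field.
  replace (C * 0 ^ 3) with 0 in B by ring.
  apply Rabs_le_between in B; lra.
Qed.

Lemma H0_second_order (eta : R) : 0 < eta ->
  exists r, 0 < r /\ forall x y, nm x y < r ->
    Rabs (H0 x y - (x * x + y * y) / 2) <= eta * (nm x y * nm x y).
Proof.
  intros He; destruct (H0_quadratic Hstd) as [C [r [Hr B]]].
  set (c := Rabs C + 1).
  assert (Hc : 0 < c) by (unfold c; assert (H1 := Rabs_pos C); lra).
  assert (Hec : 0 < eta / c) by now apply Rdiv_lt_0_compat.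
  exists (Rmin r (eta / c)); split; [now apply Rmin_pos |]; intros x y Hxy.
  assert (H1 := Rmin_l r (eta / c)); assert (H2 := Rmin_r r (eta / c)).
  assert (H3 := rad_le_nm x y); assert (H4 := proj1 (rad_sqr x y)).
  specialize (B x y ltac:(lra)).
  replace (x ^ 2 + y ^ 2) with (x * x + y * y) in B by ring.
  eapply Rle_trans; [exact B |].
  set (s := rad x y) in *; set (m := nm x y) in *.
  assert (Hcm : c * m <= eta).
  { apply Rle_trans with (c * (eta / c)); [apply Rmult_le_compat_l; lra | right; field; lra]. }
  assert (HC : C <= c) by (unfold c; assert (H5 := Rle_abs C); lra).
  assert (Hs3 : s ^ 3 <= m * (m * m)) by (simpl; rewrite Rmult_1_r; apply Rmult_le_compat; nra).
  assert (Hs0 : 0 <= s ^ 3) by now apply pow_le.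
  apply Rle_trans with (c * (m * (m * m))).
  - apply Rle_trans with (c * s ^ 3); [apply Rmult_le_compat_r; auto | apply Rmult_le_compat_l; lra].
  - rewrite <- Rmult_assoc; apply Rmult_le_compat_r; auto; nra.
Qed.

(* Comparing both expansions of [H0] along the ray through [(u,v)]. *)
Lemma H0_hessian_form (u v : R) :
  d_x (d_x H0) 0 0 * u * u + 2 * d_x (d_y H0) 0 0 * u * v + d_y (d_y H0) 0 0 * v * v = u * u + v * v.
Proof.
  assert (HS := H0_smooth Hstd).
  destruct (origin_isolated Hstd) as [Hx0 [Hy0 _]].
  assert (Hsch := smooth2_schwarz H0 0 0 HS).
  set (a := d_x (d_x H0) 0 0); set (b := d_x (d_y H0) 0 0) in *; set (c := d_y (d_y H0) 0 0).
  apply Rminus_diag_uniq, NNPP; intros Hne; apply Rabs_pos_lt in Hne.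
  set (k := a * u * u + 2 * b * u * v + c * v * v) in *.
  set (m := nm u v * nm u v + 1).
  assert (Hm0 := nm_pos u v).
  assert (Hm : 0 < m) by (unfold m; nra).
  (* The two expansions will bound the defect by 3 eta m, which is 3/8 of the defect: a
     contradiction. *)
  set (eta := Rabs (k - (u * u + v * v)) / (8 * m)).
  assert (He : 0 < eta) by (apply Rdiv_lt_0_compat; lra).
  destruct (smooth2_first_order (d_x H0) eta He (smooth2_dx _ HS) Hx0) as [r1 [Hr1 B1]].
  destruct (smooth2_first_order (d_y H0) eta He (smooth2_dy _ HS) Hy0) as [r2 [Hr2 B2]].
  destruct (H0_second_order eta He) as [r3 [Hr3 B3]].
  (* Keeps the segment inside all three discs; the 1 avoids dividing by zero when u = v = 0. *)
  set (s1 := Rmin r1 (Rmin r2 r3) / (2 * (nm u v + 1))).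
  assert (Hmin : 0 < Rmin r1 (Rmin r2 r3)) by (repeat apply Rmin_pos; auto).
  assert (Hs1 : 0 < s1) by (apply Rdiv_lt_0_compat; lra).
  assert (Hin : forall s, 0 <= s <= s1 -> nm (s * u) (s * v) = s * nm u v /\
    s * nm u v < r1 /\ s * nm u v < r2 /\ s * nm u v < r3).
  { intros s Hs; split.
    - unfold nm; rewrite !Rabs_mult, (Rabs_pos_eq s) by lra; ring.
    - bounds_of (Rmin r1 (Rmin r2 r3)) (Rmin r1 (Rmin r2 r3)).
      assert (Hsn : s * nm u v <= s1 * (nm u v + 1)) by (apply Rmult_le_compat; lra).
      replace (s1 * (nm u v + 1)) with (Rmin r1 (Rmin r2 r3) / 2) in Hsn
        by (unfold s1; field; lra).
      lra. }
  (* Integrates the first-order expansion of the gradient along the ray, which yields the value k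
     s^2 / 2 up to eta m s^2 / 2. *)
  assert (HD := dominated_increment
    (fun s => H0 (s * u) (s * v) - k * (s * s) / 2)
    (fun s => (d_x H0 (s * u) (s * v) * u + d_y H0 (s * u) (s * v) * v) - k * s)
    (fun s => eta * m * (s * s) / 2) (fun s => eta * m * s) 0 s1 ltac:(lra)).
  cbv beta in HD; rewrite !Rmult_0_l, H0_origin in HD.
  assert (Hfin : Rabs (H0 (s1 * u) (s1 * v) - k * (s1 * s1) / 2) <= eta * m * (s1 * s1) / 2).
  { replace (H0 (s1 * u) (s1 * v) - k * (s1 * s1) / 2) with
      (H0 (s1 * u) (s1 * v) - k * (s1 * s1) / 2 - (0 - k * 0 / 2)) by field.
    replace (eta * m * (s1 * s1) / 2) with (eta * m * (s1 * s1) / 2 - eta * m * 0 / 2) by field.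
    apply HD.
    - intros s Hs; apply is_derive_Rminus.
      + apply (smooth2_chain H0 (fun r => r * u) (fun r => r * v)); auto; auto_derive; auto; ring.
      + auto_derive; auto; field.
    - intros s Hs; auto_derive; auto; field.
    - intros s Hs; destruct (Hin s Hs) as [E [I1 [I2 I3]]].
      specialize (B1 (s * u) (s * v)); specialize (B2 (s * u) (s * v)); rewrite E in B1, B2.
      specialize (B1 I1); specialize (B2 I2).
      change (d_x (d_x H0) 0 0) with a in B1; rewrite <- Hsch in B1.
      change (d_x (d_y H0) 0 0) with b in B2; change (d_y (d_y H0) 0 0) with c in B2.
      set (p := d_x H0 (s * u) (s * v)) in *; set (w := d_y H0 (s * u) (s * v)) in *.
      replace (p * u + w * v - k * s) with
        ((p - (a * (s * u) + b * (s * v))) * u + (w - (b * (s * u) + c * (s * v))) * v)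
        by (unfold k; ring).
      triangle; rewrite !Rabs_mult.
      apply Rle_trans with (eta * (s * nm u v) * Rabs u + eta * (s * nm u v) * Rabs v).
      + apply Rplus_le_compat; apply Rmult_le_compat_r; auto using Rabs_pos.
      + replace (eta * (s * nm u v) * Rabs u + eta * (s * nm u v) * Rabs v)
          with (eta * s * (nm u v * nm u v)) by (unfold nm; ring).
        replace (eta * m * s) with (eta * s * m) by ring.
        apply Rmult_le_compat_l; [apply Rmult_le_pos; lra | unfold m; lra]. }
  destruct (Hin s1 ltac:(lra)) as [E [I1 [I2 I3]]].
  specialize (B3 (s1 * u) (s1 * v)); rewrite E in B3; specialize (B3 I3).
  assert (Hss : 0 < s1 * s1) by now apply Rmult_lt_0_compat.
  assert (Hkk : Rabs (k - (u * u + v * v)) * (s1 * s1) <= 3 * eta * m * (s1 * s1)).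
  { rewrite <- (Rabs_pos_eq (s1 * s1)) at 1 by lra; rewrite <- Rabs_mult.
    replace ((k - (u * u + v * v)) * (s1 * s1)) with
      (2 * (H0 (s1 * u) (s1 * v) - (s1 * u * (s1 * u) + s1 * v * (s1 * v)) / 2) -
       2 * (H0 (s1 * u) (s1 * v) - k * (s1 * s1) / 2)) by field.
    apply Rabs_le_between in B3; apply Rabs_le_between in Hfin.
    assert (Hb : eta * (s1 * nm u v * (s1 * nm u v)) <= eta * m * (s1 * s1)).
    { replace (eta * (s1 * nm u v * (s1 * nm u v))) with (eta * (nm u v * nm u v) * (s1 * s1)) by ring.
      apply Rmult_le_compat_r; [lra |]; apply Rmult_le_compat_l; unfold m; lra. }
    apply Rabs_le; lra. }
  apply Rmult_le_reg_r in Hkk; auto.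
  assert (Eeta : 3 * eta * m = 3 / 8 * Rabs (k - (u * u + v * v))) by (unfold eta; field; lra).
  lra.
Qed.

(** [H0_quadratic] concerns values only. Evaluating the Hessian form at (1,0), (0,1) and (1,1) shows
    that the Hessian is the identity, which controls the gradient. *)
Lemma H0_grad_first_order (eta : R) : 0 < eta ->
  exists r, 0 < r /\ forall x y, nm x y < r ->
    Rabs (d_x H0 x y - x) <= eta * nm x y /\ Rabs (d_y H0 x y - y) <= eta * nm x y.
Proof.
  intros He; assert (HS := H0_smooth Hstd).
  destruct (origin_isolated Hstd) as [Hx0 [Hy0 _]].
  assert (E1 := H0_hessian_form 1 0); assert (E2 := H0_hessian_form 0 1);
    assert (E3 := H0_hessian_form 1 1).
  destruct (smooth2_first_order (d_x H0) eta He (smooth2_dx _ HS) Hx0) as [r1 [Hr1 B1]].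
  destruct (smooth2_first_order (d_y H0) eta He (smooth2_dy _ HS) Hy0) as [r2 [Hr2 B2]].
  exists (Rmin r1 r2); split; [now apply Rmin_pos |]; intros x y Hxy.
  assert (M1 := Rmin_l r1 r2); assert (M2 := Rmin_r r1 r2).
  specialize (B1 x y ltac:(lra)); specialize (B2 x y ltac:(lra)).
  rewrite <- smooth2_schwarz in B1 by auto.
  set (a := d_x (d_x H0) 0 0) in *; set (b := d_x (d_y H0) 0 0) in *;
    set (c := d_y (d_y H0) 0 0) in *.
  replace a with 1 in B1 by lra; replace b with 0 in B1, B2 by lra; replace c with 1 in B2 by lra.
  rewrite Rmult_1_l, Rmult_0_l, Rplus_0_r in B1.
  rewrite Rmult_1_l, Rmult_0_l, Rplus_0_l in B2.
  now split.
Qed.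

Lemma H0_bounds_near_origin : exists r, 0 < r /\ forall x y, nm x y < r ->
  nm x y * nm x y / 8 <= H0 x y <= nm x y * nm x y.
Proof.
  destruct (H0_second_order (1 / 8)) as [r [Hr B]]; [lra |].
  exists r; split; auto; intros x y Hxy; specialize (B x y Hxy).
  apply Rabs_le_between in B; assert (N1 := nm_sqr x y); assert (N2 := sqr_nm x y); lra.
Qed.

(** * Level curves and periodic orbits *)

Lemma path_joined_trans (S : R -> R -> Prop) (a b a' b' a'' b'' : R) :
  path_joined S a b a' b' -> path_joined S a' b' a'' b'' -> path_joined S a b a'' b''.
Proof.
  intros [c1 [c2 [C1 [C2 [E1 [E2 [E3 [E4 HS]]]]]]]] [d1 [d2 [D1 [D2 [F1 [F2 [F3 [F4 HS']]]]]]]].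
  assert (Hglue : forall c d : R -> R, (forall s, continuous c s) -> (forall s, continuous d s) ->
    c 1 = d 0 -> exists e : R -> R, (forall s, continuous e s) /\
      (forall s, s <= / 2 -> e s = c (2 * s)) /\ (forall s, / 2 <= s -> e s = d (2 * s - 1))).
  { intros c d Hc Hd Ecd.
    (* One of the two terms is always constant, so the glued path is continuous on the whole line
       without a case distinction. *)
    exists (fun s => c (Rmin (2 * s) 1) + d (Rmax (2 * s - 1) 0) - c 1).
    assert (Hmin : forall s, continuous (fun r => Rmin (2 * r) 1) s).
    { intros s; apply (continuous_comp (fun r => 2 * r) (fun r => Rmin r 1));
        [apply continuous_Rscal, continuous_id | apply continuous_Rmin_l]. }
    assert (Hmax : forall s, continuous (fun r => Rmax (2 * r - 1) 0) s).
    { intros s; apply (continuous_comp (fun r => 2 * r - 1) (fun r => Rmax r 0));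
        [| apply continuous_Rmax_l].
      apply continuous_Rminus; [| apply continuous_const].
      apply continuous_Rscal, continuous_id. }
    split; [| split].
    - intros s; apply continuous_Rminus; [| apply continuous_const].
      apply continuous_Rplus.
      + now apply (continuous_comp (fun r => Rmin (2 * r) 1) c).
      + now apply (continuous_comp (fun r => Rmax (2 * r - 1) 0) d).
    - intros s Hs; rewrite Rmin_left, Rmax_right by lra; rewrite Ecd; ring.
    - intros s Hs; rewrite Rmin_right, Rmax_left by lra; ring. }
  destruct (Hglue c1 d1 C1 D1) as [e1 [G1 [G1a G1b]]]; [congruence |].
  destruct (Hglue c2 d2 C2 D2) as [e2 [G2 [G2a G2b]]]; [congruence |].
  exists e1, e2; repeat split; auto.
  - rewrite G1a, Rmult_0_r by lra; auto.
  - rewrite G2a, Rmult_0_r by lra; auto.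
  - rewrite G1b by lra; replace (2 * 1 - 1) with 1 by ring; auto.
  - rewrite G2b by lra; replace (2 * 1 - 1) with 1 by ring; auto.
  - intros s Hs; destruct (Rle_dec s (/ 2)).
    + rewrite G1a, G2a by lra; apply HS; lra.
    + rewrite G1b, G2b by lra; apply HS'; lra.
Qed.

(** A path must be continuous on all of R while the curve is controlled on [t0, t1] only; clamping
    the parameter bridges this. *)
Lemma path_joined_curve (S : R -> R -> Prop) (x y : R -> R) (t0 t1 : R) : t0 <= t1 ->
  (forall t, t0 <= t <= t1 -> continuous x t /\ continuous y t /\ S (x t) (y t)) ->
  path_joined S (x t0) (y t0) (x t1) (y t1).
Proof.
  intros Ht Hc.
  assert (Hext : forall c : R -> R, (forall t, t0 <= t <= t1 -> continuous c t) ->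
    exists e : R -> R, (forall s, continuous e s) /\
      forall s, 0 <= s <= 1 -> e s = c (t0 + s * (t1 - t0))).
  { intros c Hcc.
    exists (fun s => c (Rmax (Rmin (t0 + s * (t1 - t0)) t1) t0)); split.
    - intros s; apply (continuous_comp (fun r => Rmax (Rmin (t0 + r * (t1 - t0)) t1) t0) c).
      + apply (continuous_comp (fun r => Rmin (t0 + r * (t1 - t0)) t1) (fun r => Rmax r t0));
          [| apply continuous_Rmax_l].
        apply (continuous_comp (fun r => t0 + r * (t1 - t0)) (fun r => Rmin r t1));
          [| apply continuous_Rmin_l].
        apply (ex_derive_continuous (K := R_AbsRing) (V := R_NormedModule)); auto_derive; auto.
      + apply Hcc; split; [apply Rmax_r |].
        apply Rmax_lub; [apply Rmin_r | exact Ht].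
    - intros s Hs; f_equal.
      assert (Hp : 0 <= s * (t1 - t0)) by (apply Rmult_le_pos; lra).
      assert (Hp' : s * (t1 - t0) <= 1 * (t1 - t0)) by (apply Rmult_le_compat_r; lra).
      rewrite Rmin_left, Rmax_left; lra. }
  destruct (Hext x) as [e1 [E1 E1']]; [intros; now apply Hc |].
  destruct (Hext y) as [e2 [E2 E2']]; [intros; now apply Hc |].
  exists e1, e2; repeat split; auto.
  - rewrite E1' by lra; f_equal; ring.
  - rewrite E2' by lra; f_equal; ring.
  - rewrite E1' by lra; f_equal; ring.
  - rewrite E2' by lra; f_equal; ring.
  - intros s Hs; rewrite E1', E2' by lra; apply Hc.
    assert (Hp : 0 <= s * (t1 - t0)) by (apply Rmult_le_pos; lra).
    assert (Hp' : s * (t1 - t0) <= 1 * (t1 - t0)) by (apply Rmult_le_compat_r; lra).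
    lra.
Qed.

Lemma path_joined_sym (S : R -> R -> Prop) (a b a' b' : R) :
  path_joined S a b a' b' -> path_joined S a' b' a b.
Proof.
  intros [c1 [c2 [C1 [C2 [E1 [E2 [E3 [E4 HS]]]]]]]].
  assert (Hrev : forall c : R -> R, (forall s, continuous c s) ->
    forall s, continuous (fun r => c (1 - r)) s).
  { intros c Hc s; apply (continuous_comp (fun r => 1 - r) c); auto.
    apply (ex_derive_continuous (K := R_AbsRing) (V := R_NormedModule)); auto_derive; auto. }
  exists (fun s => c1 (1 - s)), (fun s => c2 (1 - s)).
  rewrite !Rminus_0_r, !Rminus_diag; repeat split; auto.
  intros s Hs; apply HS; lra.
Qed.

Lemma path_joined_segment (S : R -> R -> Prop) (a b a' b' : R) :
  (forall s, 0 <= s <= 1 -> S (a + s * (a' - a)) (b + s * (b' - b))) ->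
  path_joined S a b a' b'.
Proof.
  intros HS.
  assert (Hlin : forall u v s, continuous (fun r => u + r * v) s).
  { intros u v s; apply (ex_derive_continuous (K := R_AbsRing) (V := R_NormedModule));
      auto_derive; auto. }
  exists (fun s => a + s * (a' - a)), (fun s => b + s * (b' - b)).
  repeat split; auto; try ring.
Qed.

Lemma orbit_continuous (E t : R) : 0 < E <= E0 ->
  continuous (fun s => x0 s E) t /\ continuous (fun s => y0 s E) t.
Proof.
  intros HE; destruct (orbit_solution Hstd E HE t) as [Hx Hy].
  split; eapply is_derive_cont; eassumption.
Qed.

Lemma orbit_energy (E t : R) : 0 < E <= E0 -> H0 (x0 t E) (y0 t E) = E.
Proof.
  intros HE; apply (proj1 (orbit_level Hstd E HE (x0 t E) (y0 t E))).
  now exists t.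
Qed.

(** The orbit through (s, 0) cannot reach the level [nm = m]: there [H0] is at least m^2 / 8, while
    the energy is at most s^2 = m^2 / 16. The segment from the origin shows that (s, 0) lies on a
    curve of the family. *)
Lemma small_orbit (r : R) : 0 < r -> exists E, 0 < E < E0 /\
  forall t, nm (x0 t E) (y0 t E) < r.
Proof.
  intros Hr; destruct H0_bounds_near_origin as [r1 [Hr1 B]].
  assert (HE0 := E0_pos Hstd).
  set (m := Rmin (r1 / 2) (Rmin r (Rmin 1 E0))).
  assert (Hm : 0 < m) by (unfold m; repeat apply Rmin_pos; lra).
  minmax_bounds m.
  set (s := m / 4).
  assert (Hs : 0 < s) by (unfold s; lra).
  assert (Hnm : forall u, 0 <= u -> nm u 0 = u)
    by (intros u Hu; unfold nm; rewrite Rabs_R0, Rabs_pos_eq; lra).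
  assert (HB : forall u, 0 <= u <= s -> u * u / 8 <= H0 u 0 <= u * u).
  { intros u Hu; specialize (B u 0); rewrite Hnm in B by lra; apply B; unfold s in Hu; lra. }
  assert (HsE := HB s ltac:(lra)).
  assert (HE : 0 < H0 s 0 <= E0 /\ H0 s 0 < E0 /\ H0 s 0 < m * m / 8) by (unfold s in *; nra).
  set (E := H0 s 0) in *.
  exists E; split; [lra |].
  assert (Hlev : level_curve H0 E0 E s 0).
  { split; [reflexivity |]; apply path_joined_segment; intros u Hu.
    replace (0 + u * (s - 0)) with (u * s) by ring; replace (0 + u * (0 - 0)) with 0 by ring.
    assert (Hus : 0 <= u * s <= s) by nra.
    apply Rle_trans with (u * s * (u * s)).
    - now apply HB.
    - apply Rle_trans with (s * s); [nra | unfold s; nra]. }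
  apply (orbit_level Hstd E (proj1 HE)) in Hlev.
  destruct Hlev as [t0 [Ex Ey]]; simpl in Ex, Ey.
  intros t; apply Rnot_le_lt; intros Hge.
  destruct (IVT_gen_consistent (fun t => nm (x0 t E) (y0 t E)) t0 t m) as [t1 [_ Ht1]].
  - intros u; destruct (orbit_continuous E u (proj1 HE)) as [Cx Cy].
    now apply continuous_nm.
  - rewrite Ex, Ey, Hnm, Rmin_left, Rmax_right by (unfold s; lra); unfold s; lra.
  - destruct (B (x0 t1 E) (y0 t1 E)) as [B1 _]; [lra |].
    rewrite orbit_energy, Ht1 in B1 by tauto; lra.
Qed.

Definition period (E : R) : R := 2 * PI / omega E.

Lemma period_spec (E : R) : 0 < E <= E0 -> 0 < period E /\ 0 < omega E /\
  forall t, x0 (t + period E) E = x0 t E /\ y0 (t + period E) E = y0 t E.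
Proof.
  intros HE; destruct (orbit_period Hstd E HE) as [Hp [Hper _]].
  fold (period E) in Hp, Hper; repeat split; try apply Hper; auto.
  assert (Hpi := PI_RGT_0); apply Rnot_le_lt; intros Hle.
  unfold period in Hp.
  assert (Hi : / omega E <= 0).
  { destruct Hle as [Hlt | ->]; [left; now apply Rinv_lt_0_compat | rewrite Rinv_0; lra]. }
  unfold Rdiv in Hp; nra.
Qed.

Variables (lambda mu : R) (Fhat : R -> R -> R).
Hypothesis HFn : forall x y, Fk n x y = d_y H0 x y * (lambda - mu * H0 x y) + Fhat x y.
Hypothesis HFhat : forall E : R, 0 < E < E0 ->
  is_RInt (fun phi =>
    Fhat (angle_param x0 omega phi E) (angle_param y0 omega phi E) *
    d_y H0 (angle_param x0 omega phi E) (angle_param y0 omega phi E)) 0 (2 * PI) 0.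

(** This is [d_y H0 * Fhat], expressed through [gain] so that its continuity comes from that of [H0]
    and [Fk n]. *)
Definition gain_hat (x y : R) : R := gain x y - d_y H0 x y * (d_y H0 x y * (lambda - mu * H0 x y)).

(** The substitution phi = omega(E) s turns the angular average into one over time. *)
Lemma gain_hat_average (E : R) : 0 < E < E0 ->
  is_RInt (fun s => gain_hat (x0 s E) (y0 s E)) 0 (period E) 0.
Proof.
  intros HE; destruct (period_spec E) as [Hp [Hw _]]; [lra |].
  assert (HI := HFhat E HE).
  replace 0 with (omega E * 0 + 0) in HI at 1 by ring.
  replace (2 * PI) with (omega E * period E + 0) in HI by (unfold period; field; lra).
  apply is_RInt_comp_lin, (is_RInt_scal _ _ _ (/ omega E)) in HI.
  change (scal (/ omega E) 0) with (/ omega E * 0) in HI; rewrite Rmult_0_r in HI.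
  refine (is_RInt_ext _ _ _ _ _ _ HI); intros s _.
  unfold scal; simpl; unfold mult; simpl; unfold angle_param.
  replace ((omega E * s + 0) / omega E) with s by (field; lra).
  unfold gain_hat, gain; rewrite HFn; field; lra.
Qed.

Lemma Fk_n_smooth2 : smooth2 (Fk n).
Proof. apply Hstd; lia. Qed.

Lemma gain_hat_orbit_continuous (E t : R) : 0 < E <= E0 ->
  continuous (fun s => gain (x0 s E) (y0 s E)) t /\
  continuous (fun s => gain_hat (x0 s E) (y0 s E)) t.
Proof.
  intros HE; destruct (orbit_continuous E t HE) as [Cx Cy].
  assert (HS := H0_smooth Hstd).
  assert (C1 : continuous (fun s => H0 (x0 s E) (y0 s E)) t) by now apply smooth2_comp_cont.
  assert (C2 : continuous (fun s => d_y H0 (x0 s E) (y0 s E)) t)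
    by now apply (smooth2_comp_cont (d_y H0)); try apply smooth2_dy.
  assert (C3 : continuous (fun s => Fk n (x0 s E) (y0 s E)) t)
    by now apply smooth2_comp_cont; try apply Fk_n_smooth2.
  assert (C4 : continuous (fun s => gain (x0 s E) (y0 s E)) t)
    by now apply continuous_Rmult.
  split; auto.
  apply continuous_Rminus; auto.
  apply continuous_Rmult; auto; apply continuous_Rmult; auto.
  apply continuous_Rminus; [apply continuous_const |].
  now apply continuous_Rscal.
Qed.

(** * Lyapunov function at the equilibrium *)

Lemma local_expansion (eta : R) : 0 < eta ->
  exists r, 0 < r <= 1 /\ forall x y, nm x y < r ->
    Rabs (d_x H0 x y - x) <= eta * nm x y /\
    Rabs (d_y H0 x y - y) <= eta * nm x y /\
    Rabs (Fk n x y - (d_x (Fk n) 0 0 * x + d_y (Fk n) 0 0 * y)) <= eta * nm x y /\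
    Rabs (H0 x y - (x * x + y * y) / 2) <= eta * (nm x y * nm x y) /\
    Rabs (mu * H0 x y) <= eta.
Proof.
  intros He.
  destruct (H0_grad_first_order eta He) as [r1 [Hr1 B1]].
  destruct (smooth2_first_order (Fk n) eta He Fk_n_smooth2 F0_zero) as [r2 [Hr2 B2]].
  destruct (H0_second_order eta He) as [r3 [Hr3 B3]].
  destruct H0_bounds_near_origin as [r4 [Hr4 B4]].
  assert (Hmu := Rabs_pos mu).
  assert (Hem : 0 < eta / (Rabs mu + 1)) by (apply Rdiv_lt_0_compat; lra).
  set (r := Rmin 1 (Rmin (eta / (Rabs mu + 1)) (Rmin r1 (Rmin r2 (Rmin r3 r4))))).
  minmax_bounds r.
  exists r; split; [split; [unfold r; repeat apply Rmin_pos; lra | lra] |].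
  intros x y Hxy; assert (Hm := nm_pos x y).
  destruct (B1 x y ltac:(lra)) as [B1x B1y].
  specialize (B2 x y ltac:(lra)); specialize (B3 x y ltac:(lra)); specialize (B4 x y ltac:(lra)).
  repeat split; auto.
  rewrite Rabs_mult, (Rabs_pos_eq (H0 x y)) by nra.
  apply Rle_trans with ((Rabs mu + 1) * (eta / (Rabs mu + 1))); [| right; field; lra].
  apply Rmult_le_compat; nra.
Qed.

(* On a small orbit, up to the derivative of [al x^2 / 2 + beta x y / 2] with [al = d_x (Fk n) 0 0],
   [gain_hat] is close to [beta (x^2 + y^2) / 2], where [beta = d_y (Fk n) 0 0 - lambda]. *)
Lemma leading_coefficient : d_y (Fk n) 0 0 = lambda.
Proof.
  apply Rminus_diag_uniq, NNPP; intros Hne.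
  set (al := d_x (Fk n) 0 0); set (beta := d_y (Fk n) 0 0 - lambda) in *.
  assert (Hb : 0 < Rabs beta) by now apply Rabs_pos_lt.
  assert (Hl := Rabs_pos lambda).
  (* Sum of the constants in the estimates [Q1] to [Q6] of the error term. *)
  set (A := 6 + Rabs beta + 2 * Rabs lambda).
  set (eta := Rmin 1 (Rabs beta / (16 * A))).
  assert (HA : 0 < A) by (unfold A; lra).
  assert (He : 0 < eta) by (apply Rmin_pos; [lra | apply Rdiv_lt_0_compat; lra]).
  assert (He1 : eta <= 1) by apply Rmin_l.
  assert (HeA : eta * A <= Rabs beta / 16).
  { apply Rle_trans with (Rabs beta / (16 * A) * A);
      [apply Rmult_le_compat_r; [lra | apply Rmin_r] | right; field; lra]. }
  destruct (local_expansion eta He) as [r [[Hr Hr1] B]].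
  destruct (small_orbit r Hr) as [E [HE Horb]].
  assert (HE' : 0 < E <= E0) by lra.
  destruct (period_spec E HE') as [HT [_ Hper]].
  set (x := fun t => x0 t E); set (y := fun t => y0 t E).
  set (dPhi := fun t => al * x t * d_y H0 (x t) (y t) +
    beta / 2 * (d_y H0 (x t) (y t) * y t - x t * d_x H0 (x t) (y t))).
  assert (HS := H0_smooth Hstd).
  assert (Hsol := orbit_solution Hstd E HE').
  assert (Hcx : forall t, continuous x t) by (intros t; apply (orbit_continuous E t HE')).
  assert (Hcy : forall t, continuous y t) by (intros t; apply (orbit_continuous E t HE')).
  assert (HPhi : forall t, is_derive (fun s => al / 2 * (x s * x s) + beta / 2 * (x s * y s)) t (dPhi t)).
  { intros t; destruct (Hsol t) as [Dx Dy]; fold x in Dx; fold y in Dy.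
    eapply is_derive_eq.
    - apply is_derive_Rplus; apply is_derive_Rscal; apply is_derive_Rmult; eassumption.
    - unfold dPhi, x, y; field. }
  assert (HcP : forall t, continuous dPhi t).
  { intros t.
    assert (C1 : continuous (fun s => d_x H0 (x s) (y s)) t)
      by (apply (smooth2_comp_cont (d_x H0)); auto; now apply smooth2_dx).
    assert (C2 : continuous (fun s => d_y H0 (x s) (y s)) t)
      by (apply (smooth2_comp_cont (d_y H0)); auto; now apply smooth2_dy).
    apply continuous_Rplus.
    - apply continuous_Rmult; auto; apply continuous_Rmult; auto;
        apply continuous_const.
    - apply continuous_Rmult; [apply continuous_const |].
      apply continuous_Rminus; now apply continuous_Rmult. }
  assert (HI := is_RInt_derive (V := R_CompleteNormedModule) _ _ 0 (period E)
    (fun t _ => HPhi t) (fun t _ => HcP t)).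
  destruct (Hper 0) as [Px Py]; rewrite Rplus_0_l in Px, Py.
  change (x (period E) = x 0) in Px; change (y (period E) = y 0) in Py; cbv beta in HI.
  rewrite Px, Py in HI.
  rewrite minus_eq_zero in HI.
  (* The integral vanishes by periodicity and by the zero average. The factor [beta] brings the
     integrand close to beta^2 (x^2 + y^2) / 2, positive for either sign of [beta]. *)
  assert (HI2 := is_RInt_scal _ _ _ beta _ (is_RInt_minus _ _ _ _ _ _ (gain_hat_average E HE) HI)).
  assert (Hpos : 0 < RInt (fun t => beta * (gain_hat (x t) (y t) - dPhi t)) 0 (period E)).
  { apply RInt_gt_0; auto.
    - intros t _; destruct (B (x t) (y t) (Horb t)) as [B1 [B2 [B3 [_ B5]]]].
      set (m := nm (x t) (y t)) in *.
      assert (Hm0 : 0 <= m) by apply nm_pos.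
      destruct (nm_le (x t) (y t)) as [Lx Ly]; fold m in Lx, Ly.
      set (u := x t) in *; set (v := y t) in *.
      set (e1 := d_x H0 u v - u) in *; set (e2 := d_y H0 u v - v) in *.
      set (e3 := Fk n u v - (al * u + d_y (Fk n) 0 0 * v)) in *.
      assert (Hhy : Rabs (d_y H0 u v) <= 2 * m).
      { replace (d_y H0 u v) with (e2 + v) by (unfold e2; ring).
        triangle; nra. }
      assert (Eq : gain_hat u v - dPhi t = beta / 2 * (u * u + v * v) +
        (d_y H0 u v * e3 + beta * (v * e2 + u * e1) / 2 - lambda * (e2 * d_y H0 u v) +
         d_y H0 u v * d_y H0 u v * (mu * H0 u v))).
      { unfold gain_hat, gain, dPhi, e1, e2, e3, beta; fold u v; field. }
      rewrite Eq.
      assert (Q1 : Rabs (d_y H0 u v * e3) <= 2 * m * (eta * m)) by now apply Rabs_mult_le.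
      assert (Q2 : Rabs (v * e2) <= m * (eta * m)) by now apply Rabs_mult_le.
      assert (Q3 : Rabs (u * e1) <= m * (eta * m)) by now apply Rabs_mult_le.
      assert (Q4 : Rabs (lambda * (e2 * d_y H0 u v)) <= Rabs lambda * (eta * m * (2 * m)))
        by (apply Rabs_mult_le; [lra | now apply Rabs_mult_le]).
      assert (Q5 : Rabs (d_y H0 u v * d_y H0 u v * (mu * H0 u v)) <= 2 * m * (2 * m) * eta)
        by (apply Rabs_mult_le; [now apply Rabs_mult_le | auto]).
      assert (Q6 : Rabs (beta * (v * e2 + u * e1)) <= Rabs beta * (2 * (eta * (m * m)))).
      { apply Rabs_mult_le; [lra |].
        triangle; lra. }
      set (err := d_y H0 u v * e3 + beta * (v * e2 + u * e1) / 2 - lambda * (e2 * d_y H0 u v) +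
         d_y H0 u v * d_y H0 u v * (mu * H0 u v)).
      assert (Herr : Rabs err <= eta * A * (m * m)).
      { unfold err, A; apply Rabs_le_between in Q1; apply Rabs_le_between in Q4;
          apply Rabs_le_between in Q5; apply Rabs_le_between in Q6; apply Rabs_le; nra. }
      assert (Hmm := nm_sqr u v); fold m in Hmm.
      (* The orbit has positive energy, so it avoids the origin. *)
      assert (Hzero : 0 < u * u + v * v).
      { apply Rnot_le_lt; intros Hle.
        assert (u = 0 /\ v = 0) as [Hu0 Hv0] by (split; nra).
        assert (HEn := orbit_energy E t HE').
        change (H0 u v = E) in HEn; rewrite Hu0, Hv0, H0_origin in HEn; lra. }
      assert (Hfin : Rabs err <= Rabs beta / 8 * (u * u + v * v)).
      { apply Rle_trans with (Rabs beta / 16 * (2 * (u * u + v * v))); [| lra].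
        eapply Rle_trans; [exact Herr |]; apply Rmult_le_compat; nra. }
      assert (Hbe : Rabs (beta * err) <= Rabs beta * (Rabs beta / 8 * (u * u + v * v)))
        by (apply Rabs_mult_le; lra).
      assert (Hbb : beta * beta = Rabs beta * Rabs beta) by apply Rsqr_abs.
      apply Rabs_le_between in Hbe.
      replace (beta * (beta / 2 * (u * u + v * v) + err))
        with (beta * beta / 2 * (u * u + v * v) + beta * err) by field.
      rewrite Hbb.
      assert (0 < Rabs beta * Rabs beta * (u * u + v * v)) by (repeat apply Rmult_lt_0_compat; auto).
      nra.
    - intros t _; apply continuous_Rscal.
      apply continuous_Rminus; auto.
      apply (gain_hat_orbit_continuous E t HE'). }
  apply (is_RInt_unique (V := R_CompleteNormedModule)) in HI2.
  change (RInt (fun t => beta * (gain_hat (x t) (y t) - dPhi t)) 0 (period E) =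
    beta * (0 - 0)) in HI2.
  rewrite HI2 in Hpos; lra.
Qed.

(** With al = [d_x (Fk n) 0 0], the leading rate is [wt t] times lambda y^2 + al x y. Along x' = y,
    y' = -x one has (x y)' = y^2 - x^2 and (x^2)' = 2 x y, so the subtracted form leaves exactly
    lambda (x^2 + y^2) / 2. *)
Definition lyapunov (t x y : R) : R :=
  energy n t x y - wt t * (lambda / 2 * (x * y) + d_x (Fk n) 0 0 / 2 * (x * x)).

Definition lyapunov_rate (x y t : R) : R :=
  energy_rate x y t -
  (- (INR n / INR q) * Rpower t (- (INR n / INR q) - 1) *
     (lambda / 2 * (x * y) + d_x (Fk n) 0 0 / 2 * (x * x)) +
   wt t * (lambda / 2 * (vf1 x y t * y + x * vf2 x y t) +
     d_x (Fk n) 0 0 / 2 * (vf1 x y t * x + x * vf1 x y t))).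

Lemma lyapunov_chain (x y : R -> R) (t : R) : 0 < t ->
  is_derive x t (vf1 (x t) (y t) t) -> is_derive y t (vf2 (x t) (y t) t) ->
  is_derive (fun s => lyapunov s (x s) (y s)) t (lyapunov_rate (x t) (y t) t).
Proof.
  intros Ht Dx Dy.
  assert (Dw : is_derive wt t (- (INR n / INR q) * Rpower t (- (INR n / INR q) - 1)))
    by (apply is_derive_Reals; now apply derivable_pt_lim_power).
  exact (is_derive_Rminus _ _ _ _ _ (energy_chain n x y t _ _ Ht Dx Dy)
    (is_derive_Rmult _ _ _ _ _ Dw (is_derive_Rplus _ _ _ _ _
      (is_derive_Rscal _ _ _ _ (is_derive_Rmult _ _ _ _ _ Dx Dy))
      (is_derive_Rscal _ _ _ _ (is_derive_Rmult _ _ _ _ _ Dx Dx))))).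
Qed.

Lemma wt_small (eta : R) : 0 < eta -> exists t1, 1 <= t1 /\ forall t, t1 <= t -> wt t <= eta.
Proof.
  intros He; apply Rpower_neg_small; auto.
  apply Rdiv_lt_0_compat; [apply lt_0_INR; lia | apply q_R_pos].
Qed.

Lemma lyapunov_bounds : lambda <> 0 ->
  exists r t1, 0 < r <= 1 /\ 1 <= t1 /\ forall x y t, t1 <= t -> nm x y < r ->
    (x * x + y * y) / 4 <= lyapunov t x y <= x * x + y * y /\
    Rabs (lyapunov_rate x y t - wt t * (lambda / 2 * (x * x + y * y))) <=
      Rabs lambda / 4 * wt t * (x * x + y * y).
Proof.
  intros Hlam; set (al := d_x (Fk n) 0 0).
  assert (Hl : 0 < Rabs lambda) by now apply Rabs_pos_lt.
  assert (Hal := Rabs_pos al).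
  set (A := 3 + 4 * Rabs al + 4 * Rabs lambda).
  assert (HA : 0 < A) by (unfold A; lra).
  (* The bound by 1 in the inner minimum serves the comparison with x^2 + y^2, the bound by |lambda|
     the estimate of the rate. *)
  set (eta := Rmin 1 (Rmin (Rabs lambda) 1 / (8 * A))).
  assert (Hl1 : 0 < Rmin (Rabs lambda) 1) by (apply Rmin_pos; lra).
  assert (He : 0 < eta) by (apply Rmin_pos; [lra | apply Rdiv_lt_0_compat; lra]).
  assert (He1 : eta <= 1) by apply Rmin_l.
  assert (HeA : eta * A <= Rmin (Rabs lambda) 1 / 8).
  { apply Rle_trans with (Rmin (Rabs lambda) 1 / (8 * A) * A);
      [apply Rmult_le_compat_r; [lra | apply Rmin_r] | right; field; lra]. }
  assert (HeA1 := Rmin_l (Rabs lambda) 1); assert (HeA2 := Rmin_r (Rabs lambda) 1).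
  destruct (local_expansion eta He) as [r [Hr B]].
  destruct (energy_limit 1 eta He) as [t1 [Ht1 G1]].
  destruct (energy_rate_leading 1 eta He) as [t2 [Ht2 G2]].
  destruct (vf_limit 1 eta He) as [t3 [Ht3 G3]].
  destruct (wt_small eta He) as [t4 [Ht4 G4]].
  (* The last term gives [/ t <= eta], which makes the time derivative of the weight negligible. *)
  exists r, (t1 + t2 + t3 + t4 + / eta).
  assert (Hie : 0 < / eta) by now apply Rinv_0_lt_compat.
  split; [exact Hr | split; [lra |]]; intros x y t Ht Hxy.
  assert (Hb : inbox 1 x y) by (apply nm_inbox; lra).
  specialize (G1 x y t ltac:(lra) Hb); specialize (G2 x y t ltac:(lra) Hb);
    destruct (G3 x y t ltac:(lra) Hb) as [G3x G3y]; specialize (G4 t ltac:(lra)).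
  destruct (B x y Hxy) as [B1 [B2 [B3 [B4 _]]]]; rewrite leading_coefficient in B3; fold al in B3.
  unfold lyapunov, lyapunov_rate; fold al.
  assert (Hit : / t <= eta).
  { rewrite <- (Rinv_inv eta); apply Rinv_le_contravar; lra. }
  assert (Hit0 : 0 < / t) by (apply Rinv_0_lt_compat; lra).
  assert (Ew : Rpower t (- (INR n / INR q) - 1) = wt t * / t).
  { unfold Rminus; rewrite Rpower_plus, (Rpower_Ropp t 1), Rpower_1 by lra; reflexivity. }
  rewrite Ew; clear Ew.
  assert (Hnq := exponent_bounds).
  assert (Hw := wt_pos t); set (w := wt t) in *; set (nq := INR n / INR q) in *.
  assert (Hmm := nm_sqr x y); assert (Hmm' := sqr_nm x y).
  destruct (nm_le x y) as [Lx Ly]; assert (Hm0 := nm_pos x y).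
  set (m := nm x y) in *.
  assert (K1 : Rabs (lambda / 2 * (x * y) + al / 2 * (x * x)) <= (Rabs lambda / 2 + Rabs al / 2) * (m * m)).
  { triangle.
    assert (Rabs (lambda / 2 * (x * y)) <= Rabs lambda / 2 * (m * m)).
    { apply Rabs_mult_le; [| now apply Rabs_mult_le].
      unfold Rdiv; rewrite Rabs_mult, (Rabs_pos_eq (/ 2)); lra. }
    assert (Rabs (al / 2 * (x * x)) <= Rabs al / 2 * (m * m)).
    { apply Rabs_mult_le; [| now apply Rabs_mult_le].
      unfold Rdiv; rewrite Rabs_mult, (Rabs_pos_eq (/ 2)); lra. }
    lra. }
  set (c := lambda / 2 * (x * y) + al / 2 * (x * x)) in *.
  split.
  - assert (K2 : Rabs (w * c) <= eta * ((Rabs lambda / 2 + Rabs al / 2) * (m * m)))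
      by (apply Rabs_mult_le; [rewrite Rabs_pos_eq; lra | auto]).
    assert (K3 : eta * A * (m * m) <= 1 / 8 * (m * m)) by (apply Rmult_le_compat_r; lra).
    assert (Hem : 0 <= eta * (m * m)) by (apply Rmult_le_pos; lra).
    apply Rabs_le_between in G1; apply Rabs_le_between in B4; apply Rabs_le_between in K2.
    unfold A in K3; nra.
  - set (e1 := vf1 x y t) in *; set (e2 := vf2 x y t) in *.
    set (f := Fk n x y - (al * x + lambda * y)) in *.
    assert (V1 : Rabs (e1 - y) <= 2 * eta * m).
    { replace (e1 - y) with ((e1 - d_y H0 x y) + (d_y H0 x y - y)) by ring.
      triangle; lra. }
    assert (V2 : Rabs (e2 + x) <= 2 * eta * m).
    { replace (e2 + x) with ((e2 - - d_x H0 x y) + - (d_x H0 x y - x)) by ring.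
      triangle; rewrite Rabs_Ropp; lra. }
    assert (Hhy : Rabs (d_y H0 x y) <= 2 * m).
    { replace (d_y H0 x y) with ((d_y H0 x y - y) + y) by ring.
      triangle; nra. }
    assert (Eq : energy_rate x y t -
      (- nq * (w * / t) * c + w * (lambda / 2 * (e1 * y + x * e2) + al / 2 * (e1 * x + x * e1))) -
      w * (lambda / 2 * (x * x + y * y)) =
      (energy_rate x y t - w * gain x y) + w *
      (d_y H0 x y * f + (d_y H0 x y - y) * (al * x + lambda * y) + nq * / t * c
       - (lambda / 2 * ((e1 - y) * y + x * (e2 + x)) + al * (x * (e1 - y))))).
    { unfold gain, f; field; lra. }
    rewrite Eq; clear Eq.
    assert (Q1 : Rabs (d_y H0 x y * f) <= 2 * m * (eta * m)) by now apply Rabs_mult_le.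
    assert (Q2 : Rabs ((d_y H0 x y - y) * (al * x + lambda * y)) <=
      eta * m * (Rabs al * m + Rabs lambda * m)).
    { apply Rabs_mult_le; auto; triangle.
      apply Rplus_le_compat; apply Rabs_mult_le; auto; lra. }
    assert (Q3 : Rabs (nq * / t * c) <= 1 * eta * ((Rabs lambda / 2 + Rabs al / 2) * (m * m))).
    { apply Rabs_mult_le; auto; apply Rabs_mult_le; rewrite Rabs_pos_eq; lra. }
    assert (Q4 : Rabs (lambda / 2 * ((e1 - y) * y + x * (e2 + x))) <=
      Rabs lambda / 2 * (2 * eta * m * m + m * (2 * eta * m))).
    { apply Rabs_mult_le; [unfold Rdiv; rewrite Rabs_mult, (Rabs_pos_eq (/ 2)); lra |].
      triangle; apply Rplus_le_compat; now apply Rabs_mult_le. }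
    assert (Q5 : Rabs (al * (x * (e1 - y))) <= Rabs al * (m * (2 * eta * m)))
      by (apply Rabs_mult_le; [lra | now apply Rabs_mult_le]).
    set (z := d_y H0 x y * f + (d_y H0 x y - y) * (al * x + lambda * y) + nq * / t * c
       - (lambda / 2 * ((e1 - y) * y + x * (e2 + x)) + al * (x * (e1 - y)))) in *.
    set (em := eta * (m * m)).
    assert (Hem : 0 <= em) by (apply Rmult_le_pos; lra).
    assert (Hz : Rabs z <= (A - 1) * em).
    { unfold z, A, em in *; apply Rabs_le_between in Q1; apply Rabs_le_between in Q2;
        apply Rabs_le_between in Q3; apply Rabs_le_between in Q4; apply Rabs_le_between in Q5.
      apply Rabs_le; lra. }
    triangle.
    rewrite Rabs_mult, (Rabs_pos_eq w) by lra.
    apply Rle_trans with (w * (A * em)).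
    + assert (Hwz : w * Rabs z <= w * ((A - 1) * em)) by (apply Rmult_le_compat_l; lra).
      unfold em in *; lra.
    + replace (Rabs lambda / 4 * w * (x * x + y * y)) with (w * (Rabs lambda / 8 * (2 * (x * x + y * y)))) by field.
      apply Rmult_le_compat_l; [lra |].
      replace (A * em) with (eta * A * (m * m)) by (unfold em; ring).
      apply Rmult_le_compat; try lra; apply Rmult_le_pos; lra.
Qed.

(** If the solution stayed in the small disc, the Lyapunov function would be at most 1 there, yet
    its rate is at least lambda / 4 times its initial value over t, so it would grow like ln t. *)
Lemma origin_unstable : 0 < lambda -> unstable H F.
Proof.
  intros Hl Hst; destruct lyapunov_bounds as [r [t1 [Hr [Ht1 B]]]]; [lra |].
  (* Half of [r], because [nm] is at most twice [rad]. *)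
  destruct (Hst t1 (r / 2)) as [delta [Hd Hst']]; [lra | lra |].
  set (a := Rmin delta r / 4).
  assert (Hmin : 0 < Rmin delta r) by (apply Rmin_pos; lra).
  assert (Hm1 := Rmin_l delta r); assert (Hm2 := Rmin_r delta r).
  assert (Ha : 0 < a) by (unfold a; lra).
  assert (Hnm : nm a 0 = a) by (unfold nm; rewrite Rabs_R0, Rabs_pos_eq; lra).
  destruct (clamped_exists 1 t1 a 0) as [x [y [Ex [Ey Hz]]]]; [lra | lra |].
  destruct (clamped_solution_local 1 t1 x y Hz) as [T HT];
    [rewrite Ex, Ey, Hnm; unfold a; lra |].
  destruct (Hst' a 0) with (T := Finite T) (x := x) (y := y) as [x' [y' [[_ Hsol] [Hag HP]]]]; auto.
  { assert (H1 := rad_le_nm a 0); rewrite Hnm in H1; unfold a in *; lra. }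
  destruct (Hag t1 (Rle_refl _)) as [Ex' Ey']; [apply HT |].
  rewrite Ex in Ex'; rewrite Ey in Ey'; clear Hag HT Hz Ex Ey x y T Hst'.
  assert (Hin : forall t, t1 <= t -> nm (x' t) (y' t) < r).
  { intros t Ht; specialize (HP t Ht); assert (H1 := nm_le_rad (x' t) (y' t)); lra. }
  set (l := fun t => lyapunov t (x' t) (y' t)).
  assert (Dl : forall t, t1 <= t -> is_derive l t (lyapunov_rate (x' t) (y' t) t)).
  { intros t Ht; destruct (Hsol t Ht I); now apply lyapunov_chain; try lra. }
  assert (Hl0 : forall t, t1 <= t -> 0 <= l t <= 1 /\
    lambda / 4 * / t * l t <= lyapunov_rate (x' t) (y' t) t).
  { intros t Ht; destruct (B (x' t) (y' t) t Ht (Hin t Ht)) as [[B1 B2] B3].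
    assert (N1 := sqr_nm (x' t) (y' t)); assert (N2 := nm_pos (x' t) (y' t)).
    specialize (Hin t Ht).
    set (s := x' t * x' t + y' t * y' t) in *.
    assert (Hs : 0 <= s <= 1) by (unfold s in *; nra).
    split; [unfold l; lra |].
    rewrite (Rabs_pos_eq lambda) in B3 by lra; apply Rabs_le_between in B3.
    assert (Hw := inv_le_wt t ltac:(lra)).
    assert (Hi : 0 < / t) by (apply Rinv_0_lt_compat; lra).
    assert (Hls : / t * l t <= wt t * s) by (apply Rmult_le_compat; unfold l; lra).
    apply Rmult_le_compat_l with (r := lambda / 4) in Hls; lra. }
  assert (Hinc : forall t, t1 <= t -> l t1 <= l t).
  { intros t Ht.
    apply (nonneg_derive_le l (fun s => lyapunov_rate (x' s) (y' s) s)); auto; intros s Hs.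
    - apply Dl; lra.
    - destruct (Hl0 s (proj1 Hs)) as [H1 H2].
      assert (Hi : 0 < / s) by (apply Rinv_0_lt_compat; lra).
      assert (0 <= lambda / 4 * / s * l s) by (repeat apply Rmult_le_pos; lra). lra. }
  assert (Hpos : 0 < l t1).
  { destruct (B (x' t1) (y' t1) t1 (Rle_refl _) (Hin t1 (Rle_refl _))) as [[B1 _] _].
    rewrite Ex', Ey' in B1; unfold l; rewrite Ex', Ey'; nra. }
  set (k := lambda / 4 * l t1).
  assert (Hk0 : 0 < k) by (unfold k; apply Rmult_lt_0_compat; lra).
  (* At this time k ln(t2 / t1) = 2, more than the bound 1 allows. *)
  set (t2 := t1 * exp (2 / k)).
  assert (Hexp : 1 < exp (2 / k)).
  { rewrite <- exp_0; apply exp_increasing, Rdiv_lt_0_compat; lra. }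
  assert (Ht2 : t1 <= t2) by (unfold t2; nra).
  assert (HM := mvt_le (fun s => k * ln s - l s)
    (fun s => k * / s - lyapunov_rate (x' s) (y' s) s) t1 t2 0 Ht2).
  assert (Hfin : k * ln t2 - l t2 - (k * ln t1 - l t1) <= 0 * (t2 - t1)).
  { apply HM; intros s Hs.
    - apply is_derive_Rminus; [| apply Dl; lra].
      apply is_derive_Rscal, is_derive_Reals, derivable_pt_lim_ln; lra.
    - destruct (Hl0 s (proj1 Hs)) as [_ H2]; specialize (Hinc s (proj1 Hs)).
      assert (Hi : 0 < / s) by (apply Rinv_0_lt_compat; lra).
      enough (k * / s <= lambda / 4 * / s * l s) by lra.
      unfold k; replace (lambda / 4 * l t1 * / s) with (lambda / 4 * / s * l t1) by ring.
      apply Rmult_le_compat_l; auto; apply Rmult_le_pos; lra. }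
  unfold t2 in Hfin at 1; rewrite ln_mult, ln_exp in Hfin by (try apply exp_pos; lra).
  destruct (Hl0 t2 Ht2) as [H1 _].
  replace (k * (ln t1 + 2 / k)) with (k * ln t1 + 2) in Hfin by (field; lra).
  lra.
Qed.

(** The Lyapunov function works only after [t1], whereas stability is required from every [tau0].
    Gronwall's lemma covers the gap up to [s0] at the price of a small [delta]. *)
Lemma origin_attracts (tau0 eps : R) : lambda < 0 -> 0 < tau0 -> 0 < eps ->
  exists delta, 0 < delta /\ forall a b, rad a b <= delta ->
  exists x y, clamped_solution 1 tau0 x y /\ x tau0 = a /\ y tau0 = b /\
    (forall t, tau0 <= t -> nm (x t) (y t) < eps /\ nm (x t) (y t) < 1) /\
    is_lim x p_infty 0 /\ is_lim y p_infty 0.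
Proof.
  intros Hl Htau Heps; destruct lyapunov_bounds as [r [t1 [Hr [Ht1 B]]]]; [lra |].
  rewrite (Rabs_left lambda) in B by lra.
  set (rho := Rmin eps r / 2).
  assert (Hmin : 0 < Rmin eps r) by (apply Rmin_pos; lra).
  assert (Hm1 := Rmin_l eps r); assert (Hm2 := Rmin_r eps r).
  assert (Hrho : 0 < rho /\ rho < eps /\ rho < r) by (unfold rho; lra).
  set (s0 := Rmax tau0 t1).
  assert (Hs1 : tau0 <= s0) by apply Rmax_l.
  assert (Hs2 : t1 <= s0) by apply Rmax_r.
  destruct (vf_lipschitz 1 tau0 Htau) as [K [HK HL]].
  set (e := exp ((4 * K + 2) * (s0 - tau0))).
  assert (He : 1 <= e).
  { apply exp_ge_1, Rmult_le_pos; lra. }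
  exists (rho / (8 * e)); split; [apply Rdiv_lt_0_compat; lra |]; intros a b Hab.
  destruct (clamped_exists 1 tau0 a b) as [x [y [Ex [Ey Hz]]]]; [lra | lra |].
  exists x, y; split; [exact Hz | split; [exact Ex | split; [exact Ey |]]].
  assert (Hearly : forall t, tau0 <= t <= s0 -> nm (x t) (y t) < rho / 4).
  { intros t Ht.
    (* The comparison curve is the equilibrium itself, so there is no defect and [eta = 0]. *)
    assert (HD := curves_close x y (fun _ => 0) (fun _ => 0)
      (fun s => vf1 (clamp 1 (x s)) (clamp 1 (y s)) s)
      (fun s => vf2 (clamp 1 (x s)) (clamp 1 (y s)) s) (fun _ => 0) (fun _ => 0) K 0 tau0 t
      ltac:(lra) ltac:(lra) (proj1 Ht)).
    cbv zeta beta in HD; rewrite Ex, Ey, !Rminus_0_r in HD.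
    assert (Hle : x t * x t + y t * y t <=
      (a * a + b * b + 2 * 0 * 0 * (t - tau0)) * exp ((4 * K + 2) * (t - tau0))).
    { apply HD.
      - intros s Hs; destruct (Hz s (proj1 Hs)) as [D1 D2].
        assert (D0 : is_derive (fun _ : R => 0) s 0)
          by apply (is_derive_const (V := R_NormedModule)).
        exact (conj D1 (conj D2 (conj D0 D0))).
      - intros s Hs; rewrite !Rminus_0_r, !Rplus_0_r.
        destruct (HL (clamp 1 (x s)) (clamp 1 (y s)) 0 0 s (proj1 Hs)) as [L1 L2];
          [apply clamp_inbox; lra | split; rewrite Rabs_R0; lra |].
        destruct (vf_zero s ltac:(lra)) as [Z1 Z2]; rewrite Z1, Z2, !Rminus_0_r in *.
        assert (Hn1 : nm (clamp 1 (x s)) (clamp 1 (y s)) <= nm (x s) (y s)).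
        { assert (Hc := nm_clamp_lipschitz 1 (x s) (y s) 0 0).
          rewrite (clamp_id 1 0), !Rminus_0_r in Hc by (rewrite Rabs_R0; lra); exact Hc. }
        apply Rmult_le_compat_l with (r := K) in Hn1; lra. }
    clear HD.
    assert (He' : exp ((4 * K + 2) * (t - tau0)) <= e).
    { apply exp_monotone, Rmult_le_compat_l; lra. }
    assert (Hp := exp_pos ((4 * K + 2) * (t - tau0))).
    destruct (rad_sqr a b) as [R1 R2].
    assert (Hab2 : rad a b * rad a b <= rho / (8 * e) * (rho / (8 * e)))
      by (apply Rmult_le_compat; auto).
    assert (Hx : x t * x t + y t * y t <= rho / (8 * e) * (rho / (8 * e)) * e).
    { eapply Rle_trans; [exact Hle |]; apply Rmult_le_compat; nra. }
    replace (rho / (8 * e) * (rho / (8 * e)) * e) with (rho * rho / 64 * / e) in Hx by (field; lra).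
    assert (Hie : / e <= 1) by (rewrite <- Rinv_1; apply Rinv_le_contravar; lra).
    assert (Hx2 : x t * x t + y t * y t <= rho * rho / 64).
    { eapply Rle_trans; [exact Hx |]; rewrite <- (Rmult_1_r (rho * rho / 64)) at 2.
      apply Rmult_le_compat_l; nra. }
    assert (N1 := nm_sqr (x t) (y t)); assert (N2 := nm_pos (x t) (y t)); nra. }
  assert (Hcn : forall t, tau0 <= t -> continuous (fun s => nm (x s) (y s)) t).
  { intros t Ht; destruct (clamped_solution_continuous 1 tau0 t x y Hz Ht) as [Cx Cy].
    now apply continuous_nm. }
  set (l := fun t => lyapunov t (x t) (y t)).
  assert (Dl : forall t, s0 <= t -> nm (x t) (y t) < r ->
    is_derive l t (lyapunov_rate (x t) (y t) t)).
  { intros t Ht Hn1.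
    destruct (clamped_solution_unclamp 1 tau0 t x y Hz) as [D1 D2];
      [lra | apply nm_inbox; lra |]; now apply lyapunov_chain; try lra. }
  assert (Hrate : forall t, s0 <= t -> nm (x t) (y t) < r ->
    0 <= l t /\ lyapunov_rate (x t) (y t) t <= lambda / 4 * / t * l t).
  { intros t Ht Hn1; destruct (B (x t) (y t) t ltac:(lra) Hn1) as [[B1 B2] B3].
    set (s := x t * x t + y t * y t) in *.
    split; [unfold l; lra |].
    apply Rabs_le_between in B3.
    assert (Hw := inv_le_wt t ltac:(lra)).
    assert (Hi : 0 < / t) by (apply Rinv_0_lt_compat; lra).
    assert (Hls : / t * l t <= wt t * s) by (apply Rmult_le_compat; unfold l; lra).
    apply Rmult_le_compat_l with (r := - lambda / 4) in Hls; lra. }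
  (* On first reaching [nm = rho] the Lyapunov function would be at least rho^2 / 8, but it has not
     increased since [s0], where it was below rho^2 / 16. *)
  assert (Htrap : forall t, s0 <= t -> nm (x t) (y t) < rho).
  { intros t Ht; apply Rnot_le_lt; intros Hge.
    destruct (first_hit (fun s => nm (x s) (y s)) s0 t rho Ht) as [t3 [Ht3 [E3 Hle]]].
    - intros s Hs; apply Hcn; lra.
    - specialize (Hearly s0); lra.
    - exact Hge.
    - assert (HM := mvt_le l (fun s => lyapunov_rate (x s) (y s) s) s0 t3 0 (proj1 Ht3)).
      assert (Hdec : l t3 - l s0 <= 0 * (t3 - s0)).
      { apply HM; intros s Hs; specialize (Hle s Hs).
        - apply Dl; lra.
        - destruct (Hrate s (proj1 Hs) ltac:(lra)) as [H1 H2].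
          assert (Hi : 0 < / s) by (apply Rinv_0_lt_compat; lra).
          assert (0 <= - lambda / 4 * / s * l s) by (repeat apply Rmult_le_pos; lra). lra. }
      specialize (Hearly s0 ltac:(lra)).
      destruct (B (x t3) (y t3) t3 ltac:(lra) ltac:(lra)) as [[B1 _] _].
      destruct (B (x s0) (y s0) s0 ltac:(lra) ltac:(lra)) as [[_ B2] _].
      fold (l t3) in B1; fold (l s0) in B2.
      assert (N1 := nm_sqr (x t3) (y t3)); assert (N2 := sqr_nm (x s0) (y s0)).
      assert (N3 := nm_pos (x s0) (y s0)); rewrite E3 in N1; nra. }
  assert (Hall : forall t, tau0 <= t -> nm (x t) (y t) < rho).
  { intros t Ht; destruct (Rle_dec s0 t); [now apply Htrap |].
    specialize (Hearly t ltac:(lra)); lra. }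
  split; [intros t Ht; specialize (Hall t Ht); lra |].
  set (c := - lambda / 4).
  assert (Hc : 0 < c) by (unfold c; lra).
  (* The rate bound l' <= - c l / t says that l t^c does not increase. *)
  assert (Hdecay : forall t, s0 <= t -> l t <= l s0 * Rpower s0 c * Rpower t (- c)).
  { intros t Ht.
    assert (HM := mvt_le (fun s => l s * Rpower s c)
      (fun s => lyapunov_rate (x s) (y s) s * Rpower s c + l s * (c * Rpower s (c - 1))) s0 t 0 Ht).
    assert (Hdec : l t * Rpower t c - l s0 * Rpower s0 c <= 0 * (t - s0)).
    { apply HM; intros s Hs; specialize (Htrap s (proj1 Hs)).
      - assert (Dp : is_derive (fun s => Rpower s c) s (c * Rpower s (c - 1)))
          by (apply is_derive_Reals, derivable_pt_lim_power; lra).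
        exact (is_derive_Rmult _ _ _ _ _ (Dl s (proj1 Hs) ltac:(lra)) Dp).
      - destruct (Hrate s (proj1 Hs) ltac:(lra)) as [H1 H2].
        unfold Rminus; rewrite Rpower_plus, (Rpower_Ropp s 1), Rpower_1 by lra.
        assert (Hp : 0 < Rpower s c) by apply exp_pos.
        replace (lyapunov_rate (x s) (y s) s * Rpower s c + l s * (c * (Rpower s c * / s)))
          with (Rpower s c * (lyapunov_rate (x s) (y s) s - lambda / 4 * / s * l s))
          by (unfold c; field; lra).
        nra. }
    assert (Hp : 0 < Rpower t (- c)) by apply exp_pos.
    rewrite <- (Rmult_1_r (l t)), <- (Rpower_inv_mult t c), <- Rmult_assoc.
    apply Rmult_le_compat_r; lra. }
  assert (Hlim : forall eps' : posreal, exists M, forall t, M < t -> nm (x t) (y t) < eps').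
  { intros eps'; assert (Hep := cond_pos eps').
    set (C := l s0 * Rpower s0 c).
    assert (HC : 0 <= C).
    { apply Rmult_le_pos; [apply (Hrate s0 (Rle_refl _)) | left; apply exp_pos].
      specialize (Htrap s0 (Rle_refl _)); lra. }
    destruct (Rpower_neg_small c (eps' * eps' / (16 * (C + 1))) Hc) as [t2 [Ht2 Hsm]].
    { apply Rdiv_lt_0_compat; nra. }
    exists (Rmax s0 t2); intros t Ht.
    assert (M1 := Rmax_l s0 t2); assert (M2 := Rmax_r s0 t2).
    specialize (Hdecay t ltac:(lra)); fold C in Hdecay; specialize (Hsm t ltac:(lra)).
    specialize (Htrap t ltac:(lra)).
    destruct (B (x t) (y t) t ltac:(lra) ltac:(lra)) as [[B1 _] _]; fold (l t) in B1.
    assert (Hp : 0 < Rpower t (- c)) by apply exp_pos.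
    assert (Hlt : l t <= eps' * eps' / 16).
    { eapply Rle_trans; [exact Hdecay |].
      replace (eps' * eps' / 16) with ((C + 1) * (eps' * eps' / (16 * (C + 1)))) by (field; lra).
      apply Rmult_le_compat; lra. }
    assert (N1 := nm_sqr (x t) (y t)); assert (N2 := nm_pos (x t) (y t)); nra. }
  split; apply is_lim_spec; intros eps'; destruct (Hlim eps') as [M HM]; exists M; intros t Ht;
    specialize (HM t Ht); destruct (nm_le (x t) (y t)); rewrite Rminus_0_r; lra.
Qed.

Lemma origin_asymptotically_stable : lambda < 0 -> asymptotically_stable H F.
Proof.
  intros Hl; split.
  - intros tau0 eps Htau Heps.
    destruct (origin_attracts tau0 eps Hl Htau Heps) as [delta [Hd B]].
    exists delta; split; auto; intros a b Hab.
    destruct (B a b Hab) as [x [y [Hz [Ex [Ey [Hin _]]]]]].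
    apply (every_solution_intro 1 tau0 a b x y); auto.
    + intros t Ht; apply nm_inbox; left; now apply Hin.
    + intros t Ht; eapply Rle_lt_trans; [apply rad_le_nm | now apply Hin].
  - intros tau0 Htau.
    destruct (origin_attracts tau0 1 Hl Htau Rlt_0_1) as [delta [Hd B]].
    exists delta; split; auto; intros a b Hab.
    destruct (B a b Hab) as [x [y [Hz [Ex [Ey [Hin Hlim]]]]]].
    apply (every_solution_intro 1 tau0 a b x y); auto.
    intros t Ht; apply nm_inbox; left; now apply Hin.
Qed.

(** * Averaging along the periodic orbits *)

Lemma periodic_primitive (W w : R -> R) (T : R) :
  (forall t, is_derive W t (w t)) -> (forall t, w (t + T) = w t) ->
  forall t, W (t + T) - W t = W T - W 0.
Proof.
  intros HW Hw.
  assert (Hd : forall t, is_derive (fun s => W (s + T) - W s) t 0).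
  { intros t; eapply is_derive_eq; [apply is_derive_Rminus; [| apply HW] |].
    - apply (is_derive_comp W (fun s => s + T)); [apply HW |].
      apply is_derive_Rplus; [apply (is_derive_id (K := R_AbsRing)) |].
      apply (is_derive_const (V := R_NormedModule)).
    - rewrite Hw; unfold scal, one, zero; simpl; unfold mult; simpl; ring. }
  intros t.
  assert (H1 := mvt_abs_sym (fun s => W (s + T) - W s) (fun _ => 0) 0 t 0
    (fun s _ => Hd s) (fun s _ => Req_le _ _ Rabs_R0)).
  cbv beta in H1; rewrite Rplus_0_l, Rmult_0_l in H1.
  apply Rabs_le_between in H1; lra.
Qed.

(** For s <= t and k large, W(s) <= W(t) <= W(s + k T) = W(s). *)
Lemma periodic_nondecreasing_constant (W w : R -> R) (T : R) : 0 < T ->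
  (forall t, is_derive W t (w t)) -> (forall t, 0 <= w t) -> (forall t, W (t + T) = W t) ->
  forall s t, W s = W t.
Proof.
  intros HT HW Hw Hper.
  assert (Hinc : forall s t, s <= t -> W s <= W t).
  { intros s t Hst; apply (nonneg_derive_le W w); auto. }
  assert (HkT : forall k t, W (t + INR k * T) = W t).
  { induction k as [| k IH]; intros t; [simpl INR; f_equal; ring |].
    rewrite S_INR; replace (t + (INR k + 1) * T) with (t + INR k * T + T) by ring.
    now rewrite Hper. }
  assert (Hle : forall s t, s <= t -> W s = W t).
  { intros s t Hst; apply Rle_antisym; [now apply Hinc |].
    destruct (nfloor_ex ((t - s) / T)) as [k [_ Hkf]];
      [apply Rmult_le_pos; [lra | left; now apply Rinv_0_lt_compat] |].
    rewrite <- (HkT (S k) s); apply Hinc; rewrite S_INR.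
    apply Rmult_lt_compat_r with (r := T) in Hkf; auto.
    replace ((t - s) / T * T) with (t - s) in Hkf by (field; lra); lra. }
  intros s t; destruct (Rle_dec s t); [now apply Hle | symmetry; apply Hle; lra].
Qed.

(** A simple closed curve does not embed in a line: the value midway between [c2 0] and [c2 (/ 2)]
    would be taken on both halves. This rules out that [d_y H0] vanishes along a whole orbit. *)
Lemma level_curve_not_vertical (E c : R) : 0 < E <= E0 -> ~ forall t, x0 t E = c.
Proof.
  intros HE Hx.
  destruct (level_closed Hstd E HE)
    as [[c1 [c2 [C1 [C2 [_ [E2 [Hinj Hlev]]]]]]] _].
  assert (Hc1 : forall s, 0 <= s <= 1 -> c1 s = c).
  { intros s Hs.
    assert (HL : level_curve H0 E0 E (c1 s) (c2 s)) by (apply Hlev; now exists s).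
    apply (orbit_level Hstd E HE) in HL.
    destruct HL as [t [Ht _]]; simpl in Ht; now rewrite <- Ht. }
  assert (Hinj' : forall s s', 0 <= s < 1 -> 0 <= s' < 1 -> c2 s = c2 s' -> s = s').
  { intros s s' Hs Hs' Heq; apply Hinj; auto; rewrite !Hc1; lra. }
  assert (Hne : c2 0 <> c2 (/ 2)) by (intros Heq; apply Hinj' in Heq; lra).
  set (w := (c2 0 + c2 (/ 2)) / 2).
  assert (Hw : forall a b : R, Rmin a b <= (a + b) / 2 <= Rmax a b)
    by (intros a b; unfold Rmin, Rmax; destruct (Rle_dec a b); lra).
  destruct (IVT_gen_consistent c2 0 (/ 2) w C2 (Hw _ _)) as [s1 [Hs1 Es1]].
  destruct (IVT_gen_consistent c2 1 (/ 2) w C2) as [s2 [Hs2 Es2]];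
    [rewrite <- E2; apply Hw |].
  rewrite Rmin_left, Rmax_right in Hs1 by lra; rewrite Rmin_right, Rmax_left in Hs2 by lra.
  assert (Hd1 : s1 <> / 2) by (intros ->; unfold w in Es1; lra).
  assert (Hd2 : s2 <> 1) by (intros ->; unfold w in Es2; lra).
  assert (s1 = s2) by (apply Hinj'; lra).
  lra.
Qed.

(** As [H0 = E] on the orbit and [gain_hat] averages to 0, the increment over a period is (lambda -
    mu E) times the integral of (d_y H0)^2. It is stated through a primitive [P] so that [P] can be
    differentiated along the shadowed orbit. *)
Lemma gain_average (E : R) : 0 < E < E0 -> lambda - mu * E <> 0 ->
  exists P, (forall t, is_derive P t (gain (x0 t E) (y0 t E))) /\
    (forall t, P (t + period E) - P t = P (period E) - P 0) /\
    0 < (lambda - mu * E) * (P (period E) - P 0).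
Proof.
  intros HE Hne; assert (HE' : 0 < E <= E0) by lra.
  destruct (period_spec E HE') as [HT [_ Hper]].
  set (T := period E) in *.
  assert (HS := H0_smooth Hstd).
  set (v := fun t => d_y H0 (x0 t E) (y0 t E)).
  assert (Hcv : forall t, continuous v t).
  { intros t; destruct (orbit_continuous E t HE') as [Cx Cy].
    apply (smooth2_comp_cont (d_y H0)); auto; now apply smooth2_dy. }
  set (Q := fun t => 0 + RInt (fun s => v s * v s) 0 t).
  assert (HQ : forall t, is_derive Q t (v t * v t)).
  { intros t; apply (is_derive_primitive (fun s => v s * v s)); intros s.
    now apply continuous_Rmult. }
  set (P := fun t => 0 + RInt (fun s => gain (x0 s E) (y0 s E)) 0 t).
  assert (HP : forall t, is_derive P t (gain (x0 t E) (y0 t E))).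
  { intros t; apply (is_derive_primitive (fun s => gain (x0 s E) (y0 s E))); intros s.
    exact (proj1 (gain_hat_orbit_continuous E s HE')). }
  assert (HPT : P T - P 0 = (lambda - mu * E) * (Q T - Q 0)).
  { assert (HI := is_RInt_minus _ _ _ _ _ _
      (is_RInt_derive (V := R_CompleteNormedModule) P _ 0 T (fun t _ => HP t)
        (fun t _ => proj1 (gain_hat_orbit_continuous E t HE')))
      (gain_hat_average E HE)).
    assert (HJ := is_RInt_scal _ _ _ (lambda - mu * E) _
      (is_RInt_derive (V := R_CompleteNormedModule) Q _ 0 T (fun t _ => HQ t)
        (fun t _ => continuous_Rmult _ _ _ (Hcv t) (Hcv t)))).
    assert (HK : is_RInt (fun t => minus (gain (x0 t E) (y0 t E)) (gain_hat (x0 t E) (y0 t E))) 0 T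
      (scal (lambda - mu * E) (minus (Q T) (Q 0)))).
    { refine (is_RInt_ext _ _ _ _ _ _ HJ); intros t _.
      unfold minus, plus, opp, scal; simpl; unfold mult; simpl.
      unfold gain_hat, v; rewrite orbit_energy by auto; ring. }
    apply (is_RInt_unique (V := R_CompleteNormedModule)) in HI.
    apply (is_RInt_unique (V := R_CompleteNormedModule)) in HK.
    assert (HIK := eq_trans (eq_sym HI) HK).
    unfold minus, plus, opp, scal in HIK; simpl in HIK; unfold mult in HIK; simpl in HIK.
    lra. }
  assert (HQpos : 0 < Q T - Q 0).
  { assert (Hge : 0 <= Q T - Q 0).
    { enough (Q 0 <= Q T) by lra; apply (nonneg_derive_le Q (fun t => v t * v t)); auto; [lra |].
      intros r _; apply Rle_0_sqr. }
    (* A zero integral would make [Q] constant, hence d_y H0 = 0 on the orbit, hence [x0] constant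
       in time. *)
    destruct Hge as [Hgt | Heq]; auto; exfalso.
    assert (Hconst : forall s t, Q s = Q t).
    { apply (periodic_nondecreasing_constant Q (fun t => v t * v t) T HT HQ); [intros t; nra |].
      intros t; assert (H1 := periodic_primitive Q _ T HQ).
      enough (Q (t + T) - Q t = Q T - Q 0) by lra; apply H1.
      intros s; unfold v; destruct (Hper s) as [-> ->]; reflexivity. }
    apply (level_curve_not_vertical E (x0 0 E) HE'); intros t.
    assert (Hv : forall s, v s = 0).
    { intros s; assert (Hz : is_derive Q s 0).
      { apply is_derive_ext with (fun _ => Q s); [intros; apply Hconst |].
        apply (is_derive_const (V := R_NormedModule)). }
      apply is_derive_unique in Hz; assert (H1 := is_derive_unique _ _ _ (HQ s)).
      apply Rsqr_0_uniq; unfold Rsqr; congruence. }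
    assert (H1 := mvt_abs_sym (fun s => x0 s E) v 0 t 0).
    apply Rminus_diag_uniq; assert (H2 : Rabs (x0 t E - x0 0 E) <= 0 * Rabs (t - 0)).
    { apply H1; intros s _.
      - apply (orbit_solution Hstd E HE' s).
      - rewrite Hv, Rabs_R0; lra. }
    apply Rabs_le_between in H2; lra. }
  exists P; split; [exact HP | split].
  - apply periodic_primitive with (1 := HP); intros t; destruct (Hper t) as [-> ->]; reflexivity.
  - rewrite HPT.
    assert (H1 : 0 < (lambda - mu * E) * (lambda - mu * E)) by (apply Rsqr_pos_lt; auto).
    rewrite <- Rmult_assoc; now apply Rmult_lt_0_compat.
Qed.

(** * The region filled by the level curves *)

(** The condition in [level_curve] that does not involve [E]: it singles out the family of curves
    around the origin. *)
Definition Omega (u v : R) : Prop := path_joined (fun a b => H0 a b <= E0) 0 0 u v.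

Lemma path_joined_mono (S S' : R -> R -> Prop) (a b a' b' : R) :
  (forall u v, S u v -> S' u v) -> path_joined S a b a' b' -> path_joined S' a b a' b'.
Proof.
  intros Hsub [c1 [c2 [C1 [C2 [E1 [E2 [E3 [E4 HS]]]]]]]].
  exists c1, c2; repeat split; auto.
Qed.

(** A point of energy E < E0 is joined to the origin within {H0 <= E}: follow a given path until its
    energy first equals E, then the orbit of energy E, which contains the point. Such a path misses
    the curve of energy E0, and that curve encloses the origin. *)
Lemma Omega_bounded : exists rho, 0 < rho /\
  forall u v, Omega u v -> 0 < H0 u v < E0 -> rad u v <= rho.
Proof.
  assert (HE0 := E0_pos Hstd).
  assert (HS := H0_smooth Hstd).
  destruct (level_closed Hstd E0) as [_ [_ [rho Hrho]]]; [lra |].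
  exists (Rabs rho + 1); split; [assert (H1 := Rabs_pos rho); lra |]; intros u v Huv HE.
  apply Rle_trans with rho; [| assert (H1 := Rle_abs rho); lra].
  set (E := H0 u v) in *; assert (HE' : 0 < E <= E0) by lra.
  apply Hrho, path_joined_mono with (S := fun a b => H0 a b <= E).
  { intros a b Hab [Heq _]; lra. }
  destruct Huv as [c1 [c2 [C1 [C2 [E1 [E2 [E3 [E4 Hpath]]]]]]]].
  assert (Hch : forall s, continuous (fun r => H0 (c1 r) (c2 r)) s)
    by (intros s; now apply smooth2_comp_cont).
  destruct (first_hit (fun s => H0 (c1 s) (c2 s)) 0 1 E) as [t [Ht [Et Hle]]]; auto; try lra.
  { rewrite E1, E2, H0_origin; lra. }
  { rewrite E3, E4; unfold E; lra. }
  assert (J1 : path_joined (fun a b => H0 a b <= E) 0 0 (c1 t) (c2 t)).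
  { assert (J := path_joined_curve (fun a b => H0 a b <= E) c1 c2 0 t (proj1 Ht)
      (fun s Hs => conj (C1 s) (conj (C2 s) (Hle s Hs)))).
    now rewrite E1, E2 in J. }
  apply path_joined_trans with (1 := J1).
  assert (L1 : level_curve H0 E0 E (c1 t) (c2 t)).
  { split; auto; apply path_joined_mono with (2 := J1); intros; lra. }
  assert (L2 : level_curve H0 E0 E u v).
  { split; auto; exists c1, c2; repeat split; auto. }
  apply (orbit_level Hstd E HE') in L1.
  apply (orbit_level Hstd E HE') in L2.
  destruct L1 as [s1 [Eu1 Ev1]]; destruct L2 as [s2 [Eu2 Ev2]].
  rewrite <- Eu1, <- Ev1, <- Eu2, <- Ev2; clear Eu1 Ev1 Eu2 Ev2.
  assert (Harc : forall a b, a <= b ->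
    path_joined (fun p r => H0 p r <= E) (x0 a E) (y0 a E) (x0 b E) (y0 b E)).
  { intros a b Hab; apply (path_joined_curve _ (fun s => x0 s E) (fun s => y0 s E)); auto.
    intros s _; destruct (orbit_continuous E s HE') as [Cx Cy].
    split; [exact Cx | split; [exact Cy |]]; rewrite orbit_energy; lra. }
  destruct (Rle_dec s1 s2); [now apply Harc | apply path_joined_sym, Harc; lra].
Qed.

Lemma Omega_along (x y : R -> R) (t0 t1 : R) : t0 <= t1 ->
  (forall t, t0 <= t <= t1 -> continuous x t /\ continuous y t /\ H0 (x t) (y t) <= E0) ->
  Omega (x t0) (y t0) -> Omega (x t1) (y t1).
Proof.
  intros Ht Hc HO; apply path_joined_trans with (1 := HO).
  now apply (path_joined_curve _ x y).
Qed.

Variable rho : R.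
Hypothesis Hrho_pos : 0 < rho.
Hypothesis Hrho : forall u v, Omega u v -> 0 < H0 u v < E0 -> rad u v <= rho.

Lemma Omega_inbox (u v : R) : Omega u v -> 0 < H0 u v < E0 -> inbox rho u v.
Proof. intros HO HE; now apply rad_inbox, Hrho. Qed.

(** The exponent is at most 1, so the ratio of the two weights is at least t0 / t. *)
Lemma wt_variation (t0 t : R) : 1 <= t0 -> t0 <= t ->
  wt t <= wt t0 /\ wt t0 - wt t <= wt t0 * ((t - t0) / t0).
Proof.
  intros Ht0 Ht; assert (Ha := exponent_bounds); unfold wt; set (a := INR n / INR q) in *.
  assert (Hr : 1 <= t / t0) by (apply Rle_div_r; lra).
  assert (E : Rpower t (- a) = Rpower t0 (- a) * Rpower (t / t0) (- a)).
  { rewrite Rpower_mult_distr by lra; f_equal; field; lra. }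
  assert (Hp : 0 < Rpower t0 (- a)) by apply exp_pos.
  assert (H1 : Rpower (t / t0) (- a) <= 1).
  { rewrite <- (Rpower_O (t / t0)) by lra; apply Rle_Rpower; lra. }
  assert (H2 : t0 / t <= Rpower (t / t0) (- a)).
  { apply Rle_trans with (Rpower (t / t0) (- (1))); [| apply Rpower_neg_le; lra].
    right; rewrite Rpower_Ropp, Rpower_1 by lra; field; lra. }
  rewrite E; split.
  - rewrite <- (Rmult_1_r (Rpower t0 (- a))) at 2; apply Rmult_le_compat_l; lra.
  - replace (Rpower t0 (- a) - Rpower t0 (- a) * Rpower (t / t0) (- a))
      with (Rpower t0 (- a) * (1 - Rpower (t / t0) (- a))) by ring.
    apply Rmult_le_compat_l; [lra |].
    apply Rle_trans with ((t - t0) / t); [replace ((t - t0) / t) with (1 - t0 / t) by (field; lra); lra |].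
    apply Rmult_le_compat_l; [lra | apply Rinv_le_contravar; lra].
Qed.

(** * Drift of the energy on the annulus *)

Lemma gain_lipschitz (R0 : R) : exists C M, 0 < C /\ 0 < M /\
  (forall x y, inbox R0 x y -> Rabs (gain x y) <= M) /\
  forall x y x' y', inbox R0 x y -> inbox R0 x' y' ->
    Rabs (gain x y - gain x' y') <= C * nm (x - x') (y - y').
Proof.
  assert (HS := smooth2_dy _ (H0_smooth Hstd)).
  destruct (smooth2_locally_lipschitz (d_y H0) R0 HS) as [C1 [HC1 L1]].
  destruct (smooth2_locally_lipschitz (Fk n) R0 Fk_n_smooth2) as [C2 [HC2 L2]].
  destruct (continuous_bounded2 (d_y H0) R0) as [M1 [HM1 B1]];
    [intros; now apply smooth2_cont |].
  destruct (continuous_bounded2 (Fk n) R0) as [M2 [HM2 B2]];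
    [intros; apply smooth2_cont, Fk_n_smooth2 |].
  exists (C1 * M2 + M1 * C2), (M1 * M2).
  assert (0 < C1 * M2) by now apply Rmult_lt_0_compat.
  assert (0 < M1 * C2) by now apply Rmult_lt_0_compat.
  split; [lra | split; [now apply Rmult_lt_0_compat | split]].
  - intros x y Hb; apply Rabs_mult_le; auto.
  - intros x y x' y' Hb Hb'; unfold gain.
    replace (d_y H0 x y * Fk n x y - d_y H0 x' y' * Fk n x' y') with
      ((d_y H0 x y - d_y H0 x' y') * Fk n x y + d_y H0 x' y' * (Fk n x y - Fk n x' y')) by ring.
    triangle.
    assert (P1 : Rabs ((d_y H0 x y - d_y H0 x' y') * Fk n x y) <= C1 * nm (x - x') (y - y') * M2)
      by (apply Rabs_mult_le; auto).
    assert (P2 : Rabs (d_y H0 x' y' * (Fk n x y - Fk n x' y')) <= M1 * (C2 * nm (x - x') (y - y')))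
      by (apply Rabs_mult_le; auto).
    lra.
Qed.

(** The clamped field is evaluated in the box even if the solution is outside it, so no a priori
    bound on the solution is required. *)
Lemma shadowing (E s0 T e : R) : 0 < E < E0 -> 0 <= T -> 0 < e ->
  (forall t, Omega (x0 t E) (y0 t E)) ->
  exists d t1, 0 < d /\ 1 <= t1 /\ forall tau0 t0 x y,
    tau0 <= t0 -> t1 <= t0 -> clamped_solution (rho + 1) tau0 x y ->
    Rabs (x t0 - x0 s0 E) < d -> Rabs (y t0 - y0 s0 E) < d ->
    forall t, t0 <= t <= t0 + T ->
      nm (x t - x0 (s0 + (t - t0)) E) (y t - y0 (s0 + (t - t0)) E) <= e.
Proof.
  intros HE HT He HO; assert (HE' : 0 < E <= E0) by lra.
  assert (HS := H0_smooth Hstd).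
  set (R0 := rho + 1).
  assert (HR0 : 0 < R0) by (unfold R0; lra).
  destruct (smooth2_locally_lipschitz (d_x H0) R0 (smooth2_dx _ HS)) as [K1 [HK1 L1]].
  destruct (smooth2_locally_lipschitz (d_y H0) R0 (smooth2_dy _ HS)) as [K2 [HK2 L2]].
  set (K := K1 + K2).
  set (Th := exp ((4 * K + 2) * T)).
  assert (HTh : 1 <= Th).
  { apply exp_ge_1, Rmult_le_pos; unfold K; lra. }
  (* Chosen against the Gronwall factor [Th] so that the initial distance and the defect of the
     field each contribute at most e^2 / 8 to the squared distance. *)
  set (d := e / (4 * Th)); set (eta := e / (4 * Th * (T + 1))).
  assert (H4 : 0 < 4 * Th * (T + 1)) by (apply Rmult_lt_0_compat; lra).
  assert (Hd : 0 < d) by (apply Rdiv_lt_0_compat; lra).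
  assert (Heta : 0 < eta) by now apply Rdiv_lt_0_compat.
  destruct (vf_limit R0 (eta / (2 * R0))) as [t1 [Ht1 V]]; [apply Rdiv_lt_0_compat; lra |].
  exists d, t1; split; [exact Hd | split; [exact Ht1 |]].
  intros tau0 t0 x y Htau Ht0 Hz Hx0 Hy0 t Ht.
  set (u := fun t => x0 (s0 + (t - t0)) E); set (v := fun t => y0 (s0 + (t - t0)) E).
  assert (Hin : forall s, inbox R0 (u s) (v s)).
  { intros s; assert (Hb : inbox rho (u s) (v s)).
    { apply Omega_inbox; [apply HO |]; unfold u, v; rewrite orbit_energy; lra. }
    unfold inbox, R0 in *; lra. }
  assert (Hshift : forall (z : R -> R) s l, is_derive z (s0 + (s - t0)) l ->
    is_derive (fun r => z (s0 + (r - t0))) s l).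
  { intros z s l Hzl; eapply is_derive_eq.
    - apply (is_derive_comp z (fun r => s0 + (r - t0))); [exact Hzl |].
      auto_derive; auto.
    - unfold scal; simpl; unfold mult; simpl; ring. }
  assert (HD := curves_close x y u v
    (fun s => vf1 (clamp R0 (x s)) (clamp R0 (y s)) s)
    (fun s => vf2 (clamp R0 (x s)) (clamp R0 (y s)) s)
    (fun s => d_y H0 (u s) (v s)) (fun s => - d_x H0 (u s) (v s)) K eta t0 t
    ltac:(unfold K; lra) ltac:(lra) (proj1 Ht)).
  assert (Hle : (x t - u t) * (x t - u t) + (y t - v t) * (y t - v t) <=
    ((x t0 - u t0) * (x t0 - u t0) + (y t0 - v t0) * (y t0 - v t0) +
     2 * eta * eta * (t - t0)) * exp ((4 * K + 2) * (t - t0))).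
  { apply HD.
    - intros s Hs; destruct (Hz s ltac:(lra)) as [D1 D2].
      destruct (orbit_solution Hstd E HE' (s0 + (s - t0))) as [D3 D4].
      exact (conj D1 (conj D2 (conj (Hshift (fun r => x0 r E) s _ D3) (Hshift (fun r => y0 r E) s _ D4)))).
    - intros s Hs.
      assert (Hc : inbox R0 (clamp R0 (x s)) (clamp R0 (y s))) by (apply clamp_inbox; lra).
      destruct (V _ _ s ltac:(lra) Hc) as [V1 V2].
      specialize (L1 _ _ _ _ Hc (Hin s)); specialize (L2 _ _ _ _ Hc (Hin s)).
      assert (Hn1 : eta / (2 * R0) * nm (clamp R0 (x s)) (clamp R0 (y s)) <= eta).
      { apply inbox_nm in Hc.
        apply Rle_trans with (eta / (2 * R0) * (2 * R0)); [| right; field; lra].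
        apply Rmult_le_compat_l; auto; left; apply Rdiv_lt_0_compat; lra. }
      assert (Hn2 : nm (clamp R0 (x s) - u s) (clamp R0 (y s) - v s) <= nm (x s - u s) (y s - v s)).
      { rewrite <- (clamp_id R0 (u s)) at 1 by apply Hin.
        rewrite <- (clamp_id R0 (v s)) at 1 by apply Hin.
        apply nm_clamp_lipschitz. }
      assert (Hn3 := nm_pos (clamp R0 (x s) - u s) (clamp R0 (y s) - v s)).
      set (m := nm (clamp R0 (x s) - u s) (clamp R0 (y s) - v s)) in *.
      set (m' := nm (x s - u s) (y s - v s)) in *.
      assert (Hk1 : K1 * m <= K * m') by (apply Rmult_le_compat; unfold K; lra).
      assert (Hk2 : K2 * m <= K * m') by (apply Rmult_le_compat; unfold K; lra).
      split.
      + match goal with |- Rabs (?a - ?b) <= _ =>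
          replace (a - b) with ((a - d_y H0 (clamp R0 (x s)) (clamp R0 (y s))) +
            (d_y H0 (clamp R0 (x s)) (clamp R0 (y s)) - b)) by ring end.
        triangle; lra.
      + match goal with |- Rabs (?a - - ?b) <= _ =>
          replace (a - - b) with ((a - - d_x H0 (clamp R0 (x s)) (clamp R0 (y s))) +
            - (d_x H0 (clamp R0 (x s)) (clamp R0 (y s)) - b)) by ring end.
        triangle; rewrite Rabs_Ropp; lra. }
  clear HD.
  assert (Hu0 : u t0 = x0 s0 E) by (unfold u; f_equal; ring).
  assert (Hv0 : v t0 = y0 s0 E) by (unfold v; f_equal; ring).
  rewrite Hu0, Hv0 in Hle.
  assert (Hx2 : (x t0 - x0 s0 E) * (x t0 - x0 s0 E) <= d * d).
  { apply Rabs_lt_between in Hx0; nra. }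
  assert (Hy2 : (y t0 - y0 s0 E) * (y t0 - y0 s0 E) <= d * d).
  { apply Rabs_lt_between in Hy0; nra. }
  assert (HeT : 2 * eta * eta * (t - t0) <= 2 * eta * eta * T).
  { apply Rmult_le_compat_l; [apply Rmult_le_pos |]; lra. }
  assert (Hexp : exp ((4 * K + 2) * (t - t0)) <= Th).
  { apply exp_monotone, Rmult_le_compat_l; unfold K; lra. }
  assert (Hep := exp_pos ((4 * K + 2) * (t - t0))).
  assert (Hfin : (x t - u t) * (x t - u t) + (y t - v t) * (y t - v t) <=
    (2 * (d * d) + 2 * eta * eta * T) * Th).
  { eapply Rle_trans; [exact Hle |]; apply Rmult_le_compat; try lra.
    assert (0 <= 2 * eta * eta * (t - t0)).
    { apply Rmult_le_pos; [apply Rmult_le_pos |]; lra. }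
    assert (S1 := Rle_0_sqr (x t0 - x0 s0 E)); assert (S2 := Rle_0_sqr (y t0 - y0 s0 E)).
    unfold Rsqr in S1, S2; lra. }
  assert (Hd2 : d * d * Th <= e * e / 16).
  { replace (d * d * Th) with (e * e / 16 * / Th) by (unfold d; field; lra).
    rewrite <- (Rmult_1_r (e * e / 16)) at 2; apply Rmult_le_compat_l; [nra |].
    rewrite <- Rinv_1; apply Rinv_le_contravar; lra. }
  assert (He2 : eta * eta * T * Th <= e * e / 16).
  { replace (eta * eta * T * Th) with (d * d * Th * (T / ((T + 1) * (T + 1))))
      by (unfold eta, d; field; lra).
    assert (HT1 : T / ((T + 1) * (T + 1)) <= 1) by (apply Rle_div_l; nra).
    assert (HT0 : 0 <= T / ((T + 1) * (T + 1)))
      by (apply Rmult_le_pos; [lra | left; apply Rinv_0_lt_compat; nra]).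
    nra. }
  fold (u t) (v t).
  assert (N1 := nm_sqr (x t - u t) (y t - v t)); assert (N2 := nm_pos (x t - u t) (y t - v t)).
  nra.
Qed.

(* [T] is the period of the orbit through [(u,v)] and [k] half of the absolute value of the
   integral of [gain] over it. *)
Lemma local_step (u v sg eta : R) : sg * sg = 1 -> 0 < eta ->
  Omega u v -> 0 < H0 u v < E0 -> sg * (lambda - mu * H0 u v) < 0 ->
  exists d T k t1, 0 < d /\ 0 < T /\ 0 < k /\ 1 <= t1 /\ forall tau0 t0 x y,
    tau0 <= t0 -> t1 <= t0 -> clamped_solution (rho + 1) tau0 x y ->
    Rabs (x t0 - u) < d -> Rabs (y t0 - v) < d ->
    (forall t, t0 <= t <= t0 + T ->
       Rabs (energy n t (x t) (y t) - energy n t0 (x t0) (y t0)) <= eta) /\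
    sg * (energy n (t0 + T) (x (t0 + T)) (y (t0 + T)) - energy n t0 (x t0) (y t0)) <= - k * wt t0.
Proof.
  intros Hsg Heta HO HE Hneg.
  set (E := H0 u v) in *; assert (HE' : 0 < E <= E0) by lra.
  assert (HL : level_curve H0 E0 E u v) by (split; auto).
  apply (orbit_level Hstd E HE') in HL.
  destruct HL as [s0 [Eu Ev]]; simpl in Eu, Ev.
  assert (HOo : forall t, Omega (x0 t E) (y0 t E)).
  { intros t; apply (proj1 (orbit_level Hstd E HE' (x0 t E) (y0 t E))).
    now exists t. }
  destruct (gain_average E HE) as [P [HP [HPper HPpos]]]; [intros H1; rewrite H1 in Hneg; lra |].
  destruct (period_spec E HE') as [HT _].
  set (T := period E) in *; set (I := P T - P 0) in *.
  assert (HI : 0 < - sg * I).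
  { apply Rmult_lt_reg_l with (- sg * (lambda - mu * E)); [lra |].
    replace (- sg * (lambda - mu * E) * (- sg * I)) with (sg * sg * ((lambda - mu * E) * I)) by ring.
    rewrite Hsg, Rmult_0_r; lra. }
  set (R0 := rho + 1); assert (HR0 : 0 < R0) by (unfold R0; lra).
  destruct (gain_lipschitz R0) as [Cg [M [HCg [HM [BM Lg]]]]].
  destruct (smooth2_locally_lipschitz H0 R0 (H0_smooth Hstd)) as [CH [HCH LH]].
  (* Three errors of size [z * wt t0] over a time T add up to at most half of the main term. *)
  set (z := - sg * I / (6 * (T + 1))).
  assert (Hz0 : 0 < z) by (apply Rdiv_lt_0_compat; lra).
  set (e := Rmin 1 (Rmin (z / Cg) (eta / (4 * CH)))).
  assert (He : 0 < e) by (repeat apply Rmin_pos; try apply Rdiv_lt_0_compat; lra).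
  minmax_bounds e.
  assert (HeC : Cg * e <= z).
  { apply Rle_trans with (Cg * (z / Cg)); [apply Rmult_le_compat_l; lra | right; field; lra]. }
  assert (HeH : CH * e <= eta / 4).
  { apply Rle_trans with (CH * (eta / (4 * CH))); [apply Rmult_le_compat_l; lra | right; field; lra]. }
  destruct (shadowing E s0 T e HE ltac:(lra) He HOo) as [d [t1 [Hd [Ht1 Hsh]]]].
  assert (H4R : 0 < 4 * R0 * R0) by nra.
  destruct (energy_rate_leading R0 (z / (4 * R0 * R0))) as [t2 [Ht2 G2]];
    [now apply Rdiv_lt_0_compat |].
  destruct (energy_limit R0 (eta / (16 * R0 * R0))) as [t3 [Ht3 G3]];
    [apply Rdiv_lt_0_compat; nra |].
  assert (HTM : 0 <= T * M / z) by (apply Rmult_le_pos; [nra | left; now apply Rinv_0_lt_compat]).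
  (* The term T M / z makes the variation of the weight over one period negligible. *)
  exists d, T, (- sg * I / 2), (t1 + t2 + t3 + T * M / z).
  split; [exact Hd | split; [exact HT | split; [lra | split; [lra |]]]].
  intros tau0 t0 x y Htau Ht0 Hz Hx Hy.
  assert (Hclose := Hsh tau0 t0 x y Htau ltac:(lra) Hz
    ltac:(now rewrite Eu) ltac:(now rewrite Ev)).
  set (p := fun t => x0 (s0 + (t - t0)) E) in *; set (r := fun t => y0 (s0 + (t - t0)) E) in *.
  assert (Hinp : forall t, inbox rho (p t) (r t)).
  { intros t; apply Omega_inbox; [apply HOo |]; unfold p, r; rewrite orbit_energy; lra. }
  assert (HEp : forall t, H0 (p t) (r t) = E) by (intros t; unfold p, r; now apply orbit_energy).
  assert (Hin : forall t, t0 <= t <= t0 + T -> inbox R0 (x t) (y t) /\ inbox R0 (p t) (r t)).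
  { intros t Ht; specialize (Hclose t Ht); fold (p t) (r t) in Hclose.
    destruct (Hinp t) as [I1 I2]; destruct (nm_le (x t - p t) (y t - r t)) as [N1 N2].
    unfold inbox, R0.
    replace (x t) with ((x t - p t) + p t) by ring; replace (y t) with ((y t - r t) + r t) by ring.
    assert (A1 := Rabs_triang (x t - p t) (p t)); assert (A2 := Rabs_triang (y t - r t) (r t)).
    repeat split; lra. }
  assert (Hnm : forall t, t0 <= t <= t0 + T -> nm (x t) (y t) * nm (x t) (y t) <= 4 * R0 * R0).
  { intros t Ht; destruct (Hin t Ht) as [I1 _]; apply inbox_nm in I1.
    assert (N := nm_pos (x t) (y t)); nra. }
  split.
  - assert (Hone : forall t, t0 <= t <= t0 + T ->
      Rabs (energy n t (x t) (y t) - E) <= eta / 2).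
    { intros t Ht; destruct (Hin t Ht) as [I1 I2].
      specialize (G3 (x t) (y t) t ltac:(lra) I1); specialize (LH _ _ _ _ I1 I2).
      rewrite HEp in LH; specialize (Hclose t Ht); fold (p t) (r t) in Hclose.
      replace (energy n t (x t) (y t) - E) with
        ((energy n t (x t) (y t) - H0 (x t) (y t)) + (H0 (x t) (y t) - E)) by ring.
      triangle.
      assert (B1 : eta / (16 * R0 * R0) * (nm (x t) (y t) * nm (x t) (y t)) <= eta / 4).
      { apply Rle_trans with (eta / (16 * R0 * R0) * (4 * R0 * R0)); [| right; field; lra].
        apply Rmult_le_compat_l; [left; apply Rdiv_lt_0_compat; nra | auto]. }
      assert (B2 : CH * nm (x t - p t) (y t - r t) <= CH * e) by (apply Rmult_le_compat_l; lra).
      lra. }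
    intros t Ht; assert (H1 := Hone t Ht); assert (H2 := Hone t0 ltac:(lra)).
    apply Rabs_le_between in H1; apply Rabs_le_between in H2; apply Rabs_le; lra.
  - assert (Hw0 := wt_pos t0).
    (* Compares the energy with [P] along the limiting orbit, the weight being frozen at its initial
       value. *)
    assert (HD := mvt_abs
      (fun t => energy n t (x t) (y t) - wt t0 * P (s0 + (t - t0)))
      (fun t => energy_rate (x t) (y t) t - wt t0 * gain (p t) (r t)) t0 (t0 + T)
      (wt t0 * (3 * z)) ltac:(lra)).
    assert (HPI : P (s0 + (t0 + T - t0)) - P (s0 + (t0 - t0)) = I).
    { replace (s0 + (t0 + T - t0)) with (s0 + T) by ring; replace (s0 + (t0 - t0)) with s0 by ring.
      apply HPper. }
    assert (Hmain : Rabs (energy n (t0 + T) (x (t0 + T)) (y (t0 + T)) -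
      wt t0 * P (s0 + (t0 + T - t0)) - (energy n t0 (x t0) (y t0) - wt t0 * P (s0 + (t0 - t0)))) <=
      wt t0 * (3 * z) * (t0 + T - t0)).
    { apply HD; intros t Ht; destruct (Hin t Ht) as [I1 I2].
      - destruct (clamped_solution_unclamp R0 tau0 t x y Hz ltac:(lra) I1) as [D1 D2].
        apply is_derive_Rminus.
        + apply (energy_chain n x y t); auto; lra.
        + apply is_derive_Rscal; eapply is_derive_eq.
          * apply (is_derive_comp P (fun r => s0 + (r - t0))); [apply HP | auto_derive; auto].
          * unfold scal; simpl; unfold mult; simpl; unfold p, r; ring.
      - specialize (G2 (x t) (y t) t ltac:(lra) I1); specialize (Lg _ _ _ _ I1 I2).
        specialize (BM _ _ I1); specialize (Hclose t Ht); fold (p t) (r t) in Hclose.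
        destruct (wt_variation t0 t ltac:(lra) (proj1 Ht)) as [W1 W2].
        assert (Hw := wt_pos t).
        replace (energy_rate (x t) (y t) t - wt t0 * gain (p t) (r t)) with
          ((energy_rate (x t) (y t) t - wt t * gain (x t) (y t)) +
           ((wt t - wt t0) * gain (x t) (y t) +
            wt t0 * (gain (x t) (y t) - gain (p t) (r t)))) by ring.
        assert (B1 : z / (4 * R0 * R0) * wt t * (nm (x t) (y t) * nm (x t) (y t)) <= wt t0 * z).
        { apply Rle_trans with (z / (4 * R0 * R0) * wt t * (4 * R0 * R0)).
          - apply Rmult_le_compat_l; [| auto].
            apply Rmult_le_pos; [left; now apply Rdiv_lt_0_compat | lra].
          - replace (z / (4 * R0 * R0) * wt t * (4 * R0 * R0)) with (wt t * z) by (field; lra).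
            apply Rmult_le_compat_r; lra. }
        assert (B2 : Rabs ((wt t - wt t0) * gain (x t) (y t)) <= wt t0 * z).
        { apply Rle_trans with (wt t0 * ((t - t0) / t0) * M).
          - apply Rabs_mult_le; auto; rewrite Rabs_left1; lra.
          - rewrite Rmult_assoc; apply Rmult_le_compat_l; [lra |].
            assert (HTz : T * M <= z * t0).
            { replace (T * M) with (z * (T * M / z)) by (field; lra).
              apply Rmult_le_compat_l; lra. }
            replace ((t - t0) / t0 * M) with ((t - t0) * M / t0) by (field; lra).
            apply Rle_div_l; [lra |].
            apply Rle_trans with (T * M); [apply Rmult_le_compat_r; lra | exact HTz]. }
        assert (B3 : Rabs (wt t0 * (gain (x t) (y t) - gain (p t) (r t))) <= wt t0 * z).
        { apply Rabs_mult_le; [rewrite Rabs_pos_eq; lra |].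
          eapply Rle_trans; [exact Lg |].
          apply Rle_trans with (Cg * e); [apply Rmult_le_compat_l; lra | exact HeC]. }
        triangle.
        eapply Rle_trans; [apply Rplus_le_compat_l, Rabs_triang |]; lra. }
    clear HD.
    set (D := energy n (t0 + T) (x (t0 + T)) (y (t0 + T)) - energy n t0 (x t0) (y t0)) in *.
    assert (HDI : Rabs (D - wt t0 * I) <= wt t0 * (3 * z * T)).
    { replace (D - wt t0 * I) with (energy n (t0 + T) (x (t0 + T)) (y (t0 + T)) -
        wt t0 * P (s0 + (t0 + T - t0)) - (energy n t0 (x t0) (y t0) - wt t0 * P (s0 + (t0 - t0))))
        by (rewrite <- HPI; unfold D; ring).
      eapply Rle_trans; [exact Hmain |]; right; ring. }
    assert (H3z : 3 * z * T <= - sg * I / 2).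
    { replace (3 * z * T) with (- sg * I / 2 * (T / (T + 1))) by (unfold z; field; lra).
      assert (HT1 : T / (T + 1) <= 1) by (apply Rle_div_l; lra).
      rewrite <- (Rmult_1_r (- sg * I / 2)) at 2; apply Rmult_le_compat_l; lra. }
    assert (Hsg1 := Rabs_sign sg Hsg).
    assert (HsD : Rabs (sg * (D - wt t0 * I)) <= 1 * (wt t0 * (- sg * I / 2))).
    { apply Rabs_mult_le; [lra |]; eapply Rle_trans; [exact HDI |].
      apply Rmult_le_compat_l; lra. }
    apply Rabs_le_between in HsD; lra.
Qed.

(** * Uniform drift, trapping and convergence at the cycle *)

Variable Vc : R.
Hypothesis HVc : 0 < Vc < E0.
Hypothesis Hmu_pos : 0 < mu.
Hypothesis HVc_eq : lambda = mu * Vc.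

(* [sg = 1] is the outer side of the cycle, [sg = -1] the inner one. *)
Definition side (sg e1 e2 u v : R) : Prop := Omega u v /\ e1 <= sg * (H0 u v - Vc) <= e2.

Lemma side_energy (sg e1 e2 u v : R) : sg * sg = 1 -> 0 < e1 -> e2 < Vc -> e2 < E0 - Vc ->
  side sg e1 e2 u v -> 0 < H0 u v < E0 /\ inbox rho u v.
Proof.
  intros Hsg He1 He2 He3 [HO HE].
  assert (Hs : sg = 1 \/ sg = -1).
  { assert (H1 : (sg - 1) * (sg + 1) = 0) by lra.
    apply Rmult_integral in H1; destruct H1; [left | right]; lra. }
  assert (H1 : 0 < H0 u v < E0) by (destruct Hs as [-> | ->]; lra).
  split; auto; now apply Omega_inbox.
Qed.

(** The data of [local_step] depend on the base point without any known continuity. They are packed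
    into one positive number per point, used as a gauge on the box; the covering lemma returns a
    common lower bound. *)
Lemma uniform_step (sg e1 e2 eta : R) : sg * sg = 1 -> 0 < e1 -> e2 < Vc -> e2 < E0 - Vc ->
  0 < eta ->
  exists d, 0 < d /\ forall tau0 t0 x y,
    tau0 <= t0 -> / d <= t0 -> clamped_solution (rho + 1) tau0 x y -> side sg e1 e2 (x t0) (y t0) ->
    exists T, d <= T <= / d /\
    (forall t, t0 <= t <= t0 + T ->
       Rabs (energy n t (x t) (y t) - energy n t0 (x t0) (y t0)) <= eta) /\
    sg * (energy n (t0 + T) (x (t0 + T)) (y (t0 + T)) - energy n t0 (x t0) (y t0)) <= - d * wt t0.
Proof.
  intros Hsg He1 He2 He3 Heta.
  assert (HS := H0_smooth Hstd).
  assert (Hloc : forall u v, exists d : posreal, forall tau0 t0 x y,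
    tau0 <= t0 -> / d <= t0 -> clamped_solution (rho + 1) tau0 x y -> side sg e1 e2 (x t0) (y t0) ->
    Rabs (x t0 - u) < d -> Rabs (y t0 - v) < d ->
    exists T, d <= T <= / d /\
    (forall t, t0 <= t <= t0 + T ->
       Rabs (energy n t (x t) (y t) - energy n t0 (x t0) (y t0)) <= eta) /\
    sg * (energy n (t0 + T) (x (t0 + T)) (y (t0 + T)) - energy n t0 (x t0) (y t0)) <= - d * wt t0).
  { intros u v; destruct (classic (side sg e1 e2 u v)) as [Hin | Hout].
    - destruct (side_energy sg e1 e2 u v Hsg He1 He2 He3 Hin) as [HE _].
      destruct Hin as [HO HE1].
      destruct (local_step u v sg eta Hsg Heta HO HE) as [d [T [k [t1 [Hd [HT [Hk0 [Ht1 Hstep]]]]]]]].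
      { rewrite HVc_eq; replace (sg * (mu * Vc - mu * H0 u v)) with (- (mu * (sg * (H0 u v - Vc)))) by ring.
        assert (0 < mu * (sg * (H0 u v - Vc))) by (apply Rmult_lt_0_compat; lra). lra. }
      (* A single number below the radius, the period, its inverse, the drift constant and the
         inverse of the threshold time, so that all conclusions survive when it is decreased. *)
      set (m := Rmin d (Rmin T (Rmin (/ T) (Rmin k (/ t1))))).
      assert (HiT : 0 < / T) by now apply Rinv_0_lt_compat.
      assert (Hit : 0 < / t1) by (apply Rinv_0_lt_compat; lra).
      assert (Hm : 0 < m) by (unfold m; repeat apply Rmin_pos; auto).
      minmax_bounds m.
      exists (mkposreal m Hm); simpl; intros tau0 t0 x y Htau Ht0 Hz _ Hx Hy.
      assert (Ht1m : t1 <= / m) by (rewrite <- (Rinv_inv t1); apply Rinv_le_contravar; lra).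
      destruct (Hstep tau0 t0 x y Htau ltac:(lra) Hz ltac:(lra) ltac:(lra)) as [S1 S2].
      exists T; split; [split; [lra |] | split; [exact S1 |]].
      + rewrite <- (Rinv_inv T); apply Rinv_le_contravar; lra.
      + assert (Hw := wt_pos t0).
        assert (m * wt t0 <= k * wt t0) by (apply Rmult_le_compat_r; lra). lra.
    (* The set [side] is closed, so near a point outside it the claim is vacuous. *)
    - enough (Hfar : exists d : posreal, forall a b, Rabs (a - u) < d -> Rabs (b - v) < d ->
        ~ side sg e1 e2 a b).
      { destruct Hfar as [d Hd]; exists d; intros tau0 t0 x y _ _ _ Hs Hx Hy.
        now destruct (Hd (x t0) (y t0) Hx Hy). }
      assert (Hc := smooth2_cont H0 u v HS).
      destruct (classic (e1 <= sg * (H0 u v - Vc) <= e2)) as [HE | HE].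
      + assert (Hlt : H0 u v < E0).
        { assert (Hs : (sg - 1) * (sg + 1) = 0) by lra.
          apply Rmult_integral in Hs; destruct Hs as [Hs | Hs];
            [replace sg with 1 in HE by lra | replace sg with (-1) in HE by lra]; lra. }
        destruct (continuous_eps2 H0 u v (E0 - H0 u v) ltac:(lra) Hc) as [d Hd].
        exists d; intros a b Ha Hb [HO _]; apply Hout; split; auto.
        (* A nearby point of [Omega] would be joined to (u, v) by a segment on which H0 < E0,
           putting (u, v) in [Omega]. *)
        apply path_joined_trans with (1 := HO); apply path_joined_segment; intros s Hs.
        assert (Hseg : forall p w : R, Rabs (p - w) < d -> Rabs (p + s * (w - p) - w) < d).
        { intros p w Hpw; replace (p + s * (w - p) - w) with ((1 - s) * (p - w)) by ring.
          rewrite Rabs_mult, Rabs_pos_eq by lra; assert (H1 := Rabs_pos (p - w)); nra. }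
        specialize (Hd _ _ (Hseg _ _ Ha) (Hseg _ _ Hb)); apply Rabs_lt_between in Hd; lra.
      + set (g := Rmax (e1 - sg * (H0 u v - Vc)) (sg * (H0 u v - Vc) - e2)).
        assert (Hg : 0 < g).
        { apply Rnot_le_lt; intros Hle; apply HE.
          assert (G1 := Rmax_l (e1 - sg * (H0 u v - Vc)) (sg * (H0 u v - Vc) - e2)).
          assert (G2 := Rmax_r (e1 - sg * (H0 u v - Vc)) (sg * (H0 u v - Vc) - e2)).
          fold g in G1, G2; lra. }
        destruct (continuous_eps2 H0 u v g Hg Hc) as [d Hd].
        exists d; intros a b Ha Hb [_ HE']; specialize (Hd a b Ha Hb).
        assert (Hs : Rabs (sg * (H0 a b - H0 u v)) < g).
        { rewrite Rabs_mult, (Rabs_sign sg) by auto; lra. }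
        apply Rabs_lt_between in Hs; unfold g in Hs.
        unfold Rmax in Hs; destruct (Rle_dec _ _); lra. }
  set (delta := fun u v => proj1_sig (constructive_indefinite_description _ (Hloc u v))).
  destruct (compactness_value_2d (- rho) rho (- rho) rho delta) as [d Hd].
  exists d; split; [apply cond_pos |]; intros tau0 t0 x y Htau Ht0 Hz Hs.
  destruct (side_energy sg e1 e2 _ _ Hsg He1 He2 He3 Hs) as [_ [Hbx Hby]].
  apply Rabs_le_between in Hbx; apply Rabs_le_between in Hby.
  apply NNPP; intros Hn0; apply (Hd (x t0) (y t0) Hbx Hby); intros [u [v [_ [_ [Hu [Hv Hdd]]]]]].
  apply Hn0; clear Hn0; unfold delta in Hu, Hv, Hdd.
  destruct (constructive_indefinite_description _ (Hloc u v)) as [e He]; simpl in Hu, Hv, Hdd.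
  assert (Hp := cond_pos d); assert (Hpe := cond_pos e).
  assert (Hinv : / e <= / d) by now apply Rinv_le_contravar.
  destruct (He tau0 t0 x y Htau ltac:(lra) Hz Hs Hu Hv) as [T [HT [S1 S2]]].
  exists T; split; [lra | split; [exact S1 |]].
  assert (Hw := wt_pos t0); assert (d * wt t0 <= e * wt t0) by (apply Rmult_le_compat_r; lra). lra.
Qed.

(** The quantity sg L + c ln t, with L the truncated energy, does not increase over a complete step.
    The incomplete last step costs eta / 2, and passing between L and [H0] at the two ends costs the
    other half. *)
Lemma drift (sg e1 e2 eta : R) : sg * sg = 1 -> 0 < e1 -> e2 < Vc -> e2 < E0 - Vc -> 0 < eta ->
  exists c ts, 0 < c /\ 1 <= ts /\ forall tau0 t1 t2 x y,
    tau0 <= t1 -> ts <= t1 -> t1 <= t2 -> clamped_solution (rho + 1) tau0 x y ->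
    (forall t, t1 <= t <= t2 -> side sg e1 e2 (x t) (y t)) ->
    sg * (H0 (x t2) (y t2) - H0 (x t1) (y t1)) <= eta - c * (ln t2 - ln t1).
Proof.
  intros Hsg He1 He2 He3 Heta.
  assert (Hsg1 := Rabs_sign sg Hsg).
  destruct (uniform_step sg e1 e2 (eta / 4) Hsg He1 He2 He3) as [d [Hd Hstep]]; [lra |].
  destruct (energy_limit rho (eta / (16 * rho * rho))) as [t3 [Ht3 G3]];
    [apply Rdiv_lt_0_compat; nra |].
  (* Over a step from s, ln grows by at most T / s <= 1 / (d s), while the energy drops by at least
     d / s; hence c = d^2. *)
  set (c := d * d).
  assert (Hc : 0 < c) by (unfold c; nra).
  assert (Hid : 0 < / d) by now apply Rinv_0_lt_compat.
  assert (Hde : 0 < 4 * d / eta) by (apply Rdiv_lt_0_compat; lra).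
  exists c, (t3 + / d + 4 * d / eta); split; [exact Hc | split; [lra |]].
  intros tau0 t1 t2 x y Htau Ht1 Ht12 Hz Hside.
  set (M := fun t => sg * energy n t (x t) (y t) + c * ln t).
  assert (Hln : forall a b, 0 < a -> a <= b -> ln b - ln a <= (b - a) / a).
  { intros a b Ha Hab.
    assert (H1 := mvt_le ln (fun t => / t) a b (/ a) Hab).
    replace ((b - a) / a) with (/ a * (b - a)) by (unfold Rdiv; ring).
    apply H1; intros t Ht.
    - apply is_derive_Reals, derivable_pt_lim_ln; lra.
    - apply Rinv_le_contravar; lra. }
  (* Each step lasts at least [d], so the number of steps left bounds the remaining time. *)
  assert (Hchain : forall k s, t1 <= s <= t2 -> t2 - s <= INR k * d -> M t2 <= M s + eta / 2).
  { induction k as [| k IH]; intros s Hs Hsk.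
    - simpl INR in Hsk; replace s with t2 by lra; lra.
    - destruct (Hstep tau0 s x y ltac:(lra) ltac:(lra) Hz (Hside s Hs)) as [T [HT [S1 S2]]].
      assert (His : 0 < / s) by (apply Rinv_0_lt_compat; lra).
      destruct (Rle_dec t2 (s + T)) as [Hle | Hgt].
      + specialize (S1 t2 ltac:(lra)).
        assert (Hv : Rabs (sg * (energy n t2 (x t2) (y t2) - energy n s (x s) (y s))) <= eta / 4)
          by (rewrite Rabs_mult, Hsg1; lra).
        apply Rabs_le_between in Hv.
        assert (Hl1 := Hln s t2 ltac:(lra) ltac:(lra)).
        assert (Hl2 : c * (ln t2 - ln s) <= eta / 4).
        { apply Rle_trans with (c * ((t2 - s) / s)); [apply Rmult_le_compat_l; lra |].
          replace (c * ((t2 - s) / s)) with (c * (t2 - s) / s) by (field; lra).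
          apply Rle_div_l; [lra |].
          apply Rle_trans with (c * / d); [apply Rmult_le_compat_l; lra |].
          replace (c * / d) with (eta / 4 * (4 * d / eta)) by (unfold c; field; lra).
          apply Rmult_le_compat_l; lra. }
        unfold M; lra.
      + assert (IH' : M t2 <= M (s + T) + eta / 2).
        { apply IH; [lra |]; rewrite S_INR in Hsk; lra. }
        enough (M (s + T) <= M s) by lra.
        assert (Hl1 := Hln s (s + T) ltac:(lra) ltac:(lra)).
        assert (Hl2 : c * (ln (s + T) - ln s) <= d * / s).
        { apply Rle_trans with (c * ((s + T - s) / s)); [apply Rmult_le_compat_l; lra |].
          replace (c * ((s + T - s) / s)) with (c * T * / s) by (field; lra).
          apply Rmult_le_compat_r; [lra |].
          apply Rle_trans with (c * / d); [apply Rmult_le_compat_l; lra |].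
          right; unfold c; field; lra. }
        assert (Hw := inv_le_wt s ltac:(lra)).
        assert (d * / s <= d * wt s) by (apply Rmult_le_compat_l; lra).
        unfold M; lra. }
  assert (HM : M t2 <= M t1 + eta / 2).
  { destruct (nfloor_ex ((t2 - t1) / d)) as [k [_ Hkf]];
      [apply Rmult_le_pos; lra |].
    apply (Hchain (S k) t1); [lra |]; rewrite S_INR.
    apply Rmult_lt_compat_r with (r := d) in Hkf; auto.
    replace ((t2 - t1) / d * d) with (t2 - t1) in Hkf by (field; lra); lra. }
  assert (HG : forall t, t1 <= t <= t2 ->
    Rabs (sg * (energy n t (x t) (y t) - H0 (x t) (y t))) <= eta / 4).
  { intros t Ht; rewrite Rabs_mult, Hsg1, Rmult_1_l.
    destruct (side_energy sg e1 e2 _ _ Hsg He1 He2 He3 (Hside t Ht)) as [_ Hb].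
    specialize (G3 (x t) (y t) t ltac:(lra) Hb).
    eapply Rle_trans; [exact G3 |].
    apply Rle_trans with (eta / (16 * rho * rho) * (4 * rho * rho)); [| right; field; lra].
    apply Rmult_le_compat_l; [left; apply Rdiv_lt_0_compat; nra |].
    apply inbox_nm in Hb; assert (N := nm_pos (x t) (y t)); nra. }
  assert (A1 := HG t1 ltac:(lra)); assert (A2 := HG t2 ltac:(lra)).
  apply Rabs_le_between in A1; apply Rabs_le_between in A2; unfold M in HM; lra.
Qed.

Lemma energy_H0_continuous (tau0 t : R) (x y : R -> R) :
  clamped_solution (rho + 1) tau0 x y -> tau0 <= t -> continuous (fun s => H0 (x s) (y s)) t.
Proof.
  intros Hz Ht; destruct (clamped_solution_continuous _ _ t x y Hz Ht).
  apply smooth2_comp_cont; auto; apply Hstd.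
Qed.

(** Escape requires a passage from distance eps / 2 to eps on one side of the cycle. Between the
    last time at eps / 2 and the first at eps the solution is in [side], where [drift] allows an
    outward change of at most eps / 4. *)
Lemma trap (eps : R) : 0 < eps -> eps < Vc -> eps < E0 - Vc ->
  exists ts, 1 <= ts /\ forall tau0 t1 x y,
    tau0 <= t1 -> ts <= t1 -> clamped_solution (rho + 1) tau0 x y ->
    Omega (x t1) (y t1) -> Rabs (H0 (x t1) (y t1) - Vc) <= eps / 2 ->
    forall t, t1 <= t -> Rabs (H0 (x t) (y t) - Vc) < eps /\ Omega (x t) (y t).
Proof.
  intros He1 He2 He3.
  destruct (drift 1 (eps / 2) eps (eps / 4)) as [ca [ta [Hca [Hta Da]]]]; try lra.
  destruct (drift (-1) (eps / 2) eps (eps / 4)) as [cb [tb [Hcb [Htb Db]]]]; try lra.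
  exists (ta + tb); split; [lra |].
  intros tau0 t1 x y Htau Ht1 Hz HO Hstart.
  set (h := fun t => H0 (x t) (y t)).
  assert (Hch : forall t, tau0 <= t -> continuous h t)
    by (intros t Ht; now apply (energy_H0_continuous tau0 t x y)).
  assert (HOm : forall t, t1 <= t -> (forall s, t1 <= s <= t -> Rabs (h s - Vc) <= eps) ->
    Omega (x t) (y t)).
  { intros t Ht Hs; apply (Omega_along x y t1 t); auto; intros s Hss.
    destruct (clamped_solution_continuous _ _ s x y Hz ltac:(lra)) as [Cx Cy].
    specialize (Hs s Hss); apply Rabs_le_between in Hs; unfold h in Hs.
    split; [exact Cx | split; [exact Cy | lra]]. }
  assert (Hmain : forall t, t1 <= t -> Rabs (h t - Vc) < eps).
  { intros t Ht; apply Rnot_le_lt; intros Hge.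
    destruct (first_hit (fun s => Rabs (h s - Vc)) t1 t eps Ht) as [t2 [Ht2 [E2 Hle]]]; auto.
    - intros s Hs; apply continuous_Rabs_comp, continuous_Rminus;
        [apply Hch; lra | apply continuous_const].
    - unfold h; lra.
    - assert (Hone : forall sg c ts, (sg = 1 \/ sg = -1) -> 0 < c -> ts <= t1 -> 1 <= ts ->
        (forall tau0 t1 t2 x y, tau0 <= t1 -> ts <= t1 -> t1 <= t2 ->
          clamped_solution (rho + 1) tau0 x y ->
          (forall t, t1 <= t <= t2 -> side sg (eps / 2) eps (x t) (y t)) ->
          sg * (H0 (x t2) (y t2) - H0 (x t1) (y t1)) <= eps / 4 - c * (ln t2 - ln t1)) ->
        sg * (h t2 - Vc) <> eps).
      { intros sg c ts Hsg Hc Hts Hts1 D Hsgn.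
        assert (Habs : forall z, sg * z <= Rabs z).
        { intros z; destruct Hsg as [-> | ->]; [rewrite Rmult_1_l; apply Rle_abs |].
          replace (-1 * z) with (- z) by ring; rewrite <- Rabs_Ropp; apply Rle_abs. }
        destruct (last_hit (fun s => sg * (h s - Vc)) t1 t2 (eps / 2)) as [t3 [Ht3 [E3 Hge3]]].
        - lra.
        - intros s Hs; apply continuous_Rscal.
          apply continuous_Rminus; [apply Hch; lra | apply continuous_const].
        - eapply Rle_trans; [apply Habs | exact Hstart].
        - lra.
        - assert (HD := D tau0 t3 t2 x y ltac:(lra) ltac:(lra) ltac:(lra) Hz).
          assert (HD' : sg * (H0 (x t2) (y t2) - H0 (x t3) (y t3)) <= eps / 4 - c * (ln t2 - ln t3)).
          { apply HD; intros s Hs; split; [| split; [now apply Hge3 |]].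
            - apply HOm; [lra |]; intros r Hr; apply Hle; lra.
            - eapply Rle_trans; [apply Habs | apply Hle; lra]. }
          fold (h t2) (h t3) in HD'.
          assert (Hl : ln t3 <= ln t2) by (apply ln_le; lra).
          assert (0 <= c * (ln t2 - ln t3)) by (apply Rmult_le_pos; lra).
          lra. }
      destruct (Rle_dec 0 (h t2 - Vc)) as [Hp | Hn0].
      + apply (Hone 1 ca ta); auto; try lra; rewrite Rabs_pos_eq in E2 by lra; lra.
      + apply (Hone (-1) cb tb); auto; try lra; rewrite Rabs_left in E2 by lra; lra. }
  intros t Ht; split; [now apply Hmain |].
  apply HOm; auto; intros s Hs; left; apply Hmain; lra.
Qed.

(** A solution that never comes within [e] stays on one side by continuity, and there the
    logarithmic drift would carry it past the cycle. *)
Lemma returns_near_cycle (eps e : R) : 0 < e -> e <= eps -> eps < Vc -> eps < E0 - Vc ->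
  forall tau0 t1 x y, 0 < tau0 -> tau0 <= t1 -> clamped_solution (rho + 1) tau0 x y ->
  (forall t, t1 <= t -> Rabs (H0 (x t) (y t) - Vc) < eps /\ Omega (x t) (y t)) ->
  exists t2, t1 <= t2 /\ Rabs (H0 (x t2) (y t2) - Vc) <= e.
Proof.
  intros He Hee He2 He3 tau0 t1 x y Htau0 Htau Hz Hin.
  apply NNPP; intros Hno.
  set (h := fun t => H0 (x t) (y t)).
  assert (Hfar : forall t, t1 <= t -> e < Rabs (h t - Vc)).
  { intros t Ht; apply Rnot_le_lt; intros Hle; apply Hno; now exists t. }
  assert (Hch : forall t, tau0 <= t -> continuous h t)
    by (intros t Ht; now apply (energy_H0_continuous tau0 t x y)).
  assert (Hside : forall sg, sg = 1 \/ sg = -1 -> ~ e < sg * (h t1 - Vc)).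
  { intros sg Hsg Hs1.
    assert (Habs : forall z, Rabs z = Rabs (sg * z)).
    { intros z; destruct Hsg as [-> | ->]; [now rewrite Rmult_1_l |].
      replace (-1 * z) with (- z) by ring; now rewrite Rabs_Ropp. }
    assert (Hstay : forall t, t1 <= t -> e < sg * (h t - Vc)).
    { intros t Ht; apply Rnot_le_lt; intros Hle.
      destruct (first_hit (fun s => - (sg * (h s - Vc))) t1 t (- e) Ht) as [t2 [Ht2 [E2 _]]];
        try lra.
      - intros s Hs; apply continuous_Ropp.
        apply continuous_Rscal.
        apply continuous_Rminus; [apply Hch; lra | apply continuous_const].
      - specialize (Hfar t2 (proj1 Ht2)).
        rewrite Habs, Rabs_pos_eq in Hfar; lra. }
    assert (Hsg2 : sg * sg = 1) by (destruct Hsg as [-> | ->]; ring).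
    destruct (drift sg e eps 1 Hsg2 He He2 He3 Rlt_0_1) as [c [ts [Hc [Hts D]]]].
    set (s := Rmax t1 ts).
    assert (S1 : t1 <= s) by apply Rmax_l; assert (S2 : ts <= s) by apply Rmax_r.
    (* Makes the drift bound equal to -2 eps, while the starting distance is below eps. *)
    set (k := (1 + 2 * eps) / c).
    assert (Hk0 : 0 < k) by (apply Rdiv_lt_0_compat; lra).
    assert (Hek : 1 < exp k) by (rewrite <- exp_0; now apply exp_increasing).
    assert (Hst : s <= s * exp k) by nra.
    assert (HD : sg * (h (s * exp k) - h s) <= 1 - c * (ln (s * exp k) - ln s)).
    { apply (D tau0 s (s * exp k) x y); auto; try lra.
      intros t Ht; split; [apply Hin; lra |]; split; [left; apply Hstay; lra |].
      apply Rle_trans with (Rabs (h t - Vc)); [rewrite Habs; apply Rle_abs |].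
      left; apply Hin; lra. }
    rewrite ln_mult, ln_exp in HD by (try apply exp_pos; lra).
    replace (c * (ln s + k - ln s)) with (1 + 2 * eps) in HD by (unfold k; field; lra).
    assert (H1 := Hstay (s * exp k) ltac:(lra)).
    destruct (Hin s S1) as [H2 _]; fold (h s) in H2.
    rewrite Habs in H2; apply Rabs_lt_between in H2; lra. }
  specialize (Hfar t1 (Rle_refl _)).
  destruct (Rle_dec 0 (h t1 - Vc)) as [Hp | Hn0].
  - apply (Hside 1); auto; rewrite Rabs_pos_eq in Hfar; lra.
  - apply (Hside (-1)); auto; rewrite Rabs_left in Hfar; lra.
Qed.

Lemma cycle_stable : stable_limit_cycle H F H0 E0 Vc.
Proof.
  intros eps Heps.
  (* Keeps the annulus away from both the origin and the curve of energy [E0]. *)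
  set (e := Rmin eps (Rmin (Vc / 2) ((E0 - Vc) / 2))).
  assert (He : 0 < e) by (unfold e; repeat apply Rmin_pos; lra).
  minmax_bounds e.
  destruct (trap e He ltac:(lra) ltac:(lra)) as [ts [Hts Htrap]].
  exists (e / 2), ts; split; [lra | split; [lra |]].
  intros a b tau0 [E [_ [_ HO]]] Hab Htau.
  destruct (clamped_exists (rho + 1) tau0 a b) as [x [y [Ex [Ey Hz]]]]; [lra | lra |].
  assert (Hin : forall t, tau0 <= t -> Rabs (H0 (x t) (y t) - Vc) < e /\ Omega (x t) (y t)).
  { apply (Htrap tau0); auto; try lra; now rewrite Ex, Ey. }
  apply (every_solution_intro (rho + 1) tau0 a b x y); auto; [lra | |].
  - intros t Ht; destruct (Hin t Ht) as [H1 H2]; apply Rabs_lt_between in H1.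
    destruct (Omega_inbox _ _ H2) as [B1 B2]; [lra |]; split; lra.
  - split; [intros t Ht; destruct (Hin t Ht); lra |].
    apply is_lim_spec; intros eps'.
    set (e' := Rmin eps' e).
    assert (He' : 0 < e') by (apply Rmin_pos; [apply cond_pos | auto]).
    minmax_bounds e'.
    destruct (trap e' He' ltac:(lra) ltac:(lra)) as [ts' [Hts' Htrap']].
    set (s := Rmax tau0 ts').
    assert (S1 : tau0 <= s) by apply Rmax_l; assert (S2 : ts' <= s) by apply Rmax_r.
    (* Convergence: wait for the trapping time of the smaller tolerance, then for a visit within
       half of it; from then on the trap holds. *)
    destruct (returns_near_cycle e (e' / 2) ltac:(lra) ltac:(lra) ltac:(lra) ltac:(lra)
      tau0 s x y ltac:(lra) S1 Hz) as [t2 [Ht2 Hnear]].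
    { intros t Ht; apply Hin; lra. }
    exists t2; intros t Ht.
    destruct (Htrap' tau0 t2 x y ltac:(lra) ltac:(lra) Hz (proj2 (Hin t2 ltac:(lra))) Hnear t
      ltac:(lra)) as [H1 _].
    lra.
Qed.

End Perturbed.

Theorem theorem3
  (H F : R -> R -> R -> R) (H0 : R -> R -> R)
  (Hk Fk : nat -> R -> R -> R) (q : nat) (E0 : R)
  (x0 y0 : R -> R -> R) (omega : R -> R)
  (Hstd : standing_assumptions H F H0 Hk Fk q E0 x0 y0 omega)
  (n : nat) (Hn : (1 <= n <= q)%nat)
  (lambda mu : R) (Hlambda : lambda <> 0) (Hmu : mu <> 0)
  (Fhat : R -> R -> R)
  (HFi : forall i : nat, (1 <= i < n)%nat -> forall x y : R, Fk i x y = 0)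
  (HFn : forall x y : R,
     Fk n x y = d_y H0 x y * (lambda - mu * H0 x y) + Fhat x y)
  (HFhat : forall E : R, 0 < E < E0 ->
     is_RInt (fun phi =>
       Fhat (angle_param x0 omega phi E) (angle_param y0 omega phi E) *
       d_y H0 (angle_param x0 omega phi E) (angle_param y0 omega phi E))
       0 (2 * PI) 0) :
  (0 < lambda -> unstable H F) /\
  (lambda < 0 -> asymptotically_stable H F) /\
  (0 < lambda -> 0 < mu -> Rabs (lambda / mu) < E0 ->
     stable_limit_cycle H F H0 E0 (lambda / mu)).
Proof.
  split; [| split].
  - eapply origin_unstable; eassumption.
  - eapply origin_asymptotically_stable; eassumption.
  - intros Hl Hm Hlt.
    assert (Hpos : 0 < lambda / mu) by now apply Rdiv_lt_0_compat.
    rewrite Rabs_pos_eq in Hlt by lra.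
    destruct (Omega_bounded _ _ _ _ _ _ _ _ _ _ Hstd n Hn) as [rho [Hrho_pos Hrho]].
    eapply cycle_stable with (rho := rho); try eassumption; [now split | field; lra].
Qed.
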